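(* Let $X$ be a smooth projective geometrically irreducible curve over $\mathbb{F}_q$. The map $$\mathrm{Cl}\,X\longrightarrow\mathbb{P}\mathrm{Bun}_2^{\rm dec}X,\qquad[D]\longmapsto c_D$$ is surjective with fibres of the form $\{[D],[-D]\}$.
   Context: $\mathrm{Cl}\,X$ is the divisor class group of $X$. $\mathbb{P}\mathrm{Bun}_2X$ is the set of isomorphism classes of rank $2$ vector bundles on $X$ modulo tensoring with line bundles, and $\mathbb{P}\mathrm{Bun}_2^{\rm dec}X$ is the subset of classes of bundles that are isomorphic to a direct sum of two line bundles. $c_D$ denotes the class of $\mathcal{L}_D\oplus\mathcal{O}_X$, where $\mathcal{L}_D$ is the line bundle associated to the divisor $D$. *)

(* Defs.v *)
From HB Require Import structures.
From mathcomp Require Import all_boot all_algebra.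
From mathcomp Require Import boolp classical_sets functions.
From mathcomp Require Import mpoly freeg.

Set Implicit Arguments.
Unset Strict Implicit.
Unset Printing Implicit Defensive.

Import GRing.Theory.
Local Open Scope ring_scope.
Local Open Scope quotient_scope.

(* The topological space Proj(k[x_0, ..., x_n] / (T)): its points are the    *)
(* homogeneous primes that contain T and omit some coordinate x_i.           *)

Record homog_prime (k : fieldType) (n : nat) (p : {mpoly k[n.+1]} -> Prop) :
    Prop := HomogPrime {
  hp_0 : p 0;
  hp_add : forall f g, p f -> p g -> p (f + g);
  hp_mul : forall f g, p g -> p (f * g);
  hp_prime : forall f g, p (f * g) -> p f \/ p g;
  hp_homog : forall f d, p f -> p (pihomog mdeg d f);
  hp_relevant : exists i, ~ p 'X_i }.

Record proj_point (k : fieldType) (n : nat) (T : {mpoly k[n.+1]} -> Prop) :=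
    ProjPoint {
  pt_ideal :> {mpoly k[n.+1]} -> Prop;
  pt_prime : homog_prime pt_ideal;
  pt_above : forall f, T f -> pt_ideal f }.

Section ProjTopology.
Variables (k : fieldType) (n : nat) (T : {mpoly k[n.+1]} -> Prop).

(* U is a union of basic open sets D_+(f), f homogeneous. *)
Definition zariski_open (U : proj_point T -> Prop) : Prop :=
  forall p, U p -> exists (d : nat) (f : {mpoly k[n.+1]}),
    [/\ f \is d.-homog, ~ p f & forall q : proj_point T, ~ q f -> U q].

Record opens := Open {
  open_set :> proj_point T -> Prop;
  open_setP : zariski_open open_set }.

Definition proj_irreducible : Prop :=
  inhabited (proj_point T) /\
  forall U V : opens, (exists p, U p) -> (exists p, V p) ->
    exists p, U p /\ V p.

(* A strict chain of d + 1 points under specialisation, that is, a strict    *)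
(* chain of d + 1 irreducible closed subsets.                                *)
Definition has_chain (d : nat) : Prop :=
  exists c : 'I_d.+1 -> proj_point T, forall i j : 'I_d.+1, (i < j)%N ->
    (forall f, c i f -> c j f) /\ (exists f, c j f /\ ~ c i f).

Definition proj_dim (d : nat) : Prop := has_chain d /\ ~ has_chain d.+1.

End ProjTopology.

Lemma fraction_div (R : idomainType) (z : {fraction R}) :
  exists x y : R, y != 0 /\ z = tofrac x / tofrac y.
Proof.
exists (\n_(repr z)), (\d_(repr z)); split; first exact: denom_ratioP.
apply: (canRL (mulfK _)); first by rewrite tofrac_eq0 denom_ratioP.
rewrite -[z in LHS]reprK; unlock FracField.tofrac; rewrite -[LHS]FracField.pi_mul.
apply/eqmodP; rewrite /= /FracField.equivf /FracField.mulf /=.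
rewrite !numden_Ratio ?oner_neq0 ?mulf_neq0 ?denom_ratioP ?oner_neq0 //.
by rewrite !mulr1 mulrC reprK.
Qed.

Section FracQuot.
Variables (R : comNzRingType) (P : prime_idealr R).

Definition dom_quot := {ideal_quot P}.
HB.instance Definition _ := GRing.ComNzRing.on dom_quot.

Definition dom_quot_unit : pred dom_quot := fun x => `[< exists y, y * x = 1 >].
Definition dom_quot_inv (x : dom_quot) : dom_quot :=
  if pselect (exists y, y * x = 1) is left h then projT1 (cid h) else x.

Lemma dom_quot_mulVx : {in dom_quot_unit, left_inverse 1 dom_quot_inv *%R}.
Proof.
move=> x /asboolP h; rewrite /dom_quot_inv; case: pselect => // h'.
by case: (cid h').
Qed.

Lemma dom_quot_unitPl (x y : dom_quot) : y * x = 1 -> dom_quot_unit x.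
Proof. by move=> h; apply/asboolP; exists y. Qed.

Lemma dom_quot_inv_out : {in [predC dom_quot_unit], dom_quot_inv =1 id}.
Proof. by move=> x /asboolP h; rewrite /dom_quot_inv; case: pselect. Qed.

HB.instance Definition _ := GRing.ComNzRing_hasMulInverse.Build dom_quot
  dom_quot_mulVx dom_quot_unitPl dom_quot_inv_out.
HB.instance Definition _ := GRing.ComUnitRing_isIntegral.Build dom_quot
  (@Quotient.rquot_IdomainAxiom _ P).

Definition dom_quot_pi (a : R) : dom_quot := \pi_{ideal_quot P} a.
Definition frac_quot_pi (a : R) : {fraction dom_quot} := tofrac (dom_quot_pi a).

Lemma frac_quot_pi_zmod : zmod_morphism frac_quot_pi.
Proof.
move=> a b; rewrite /frac_quot_pi -tofracB; congr tofrac.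
by rewrite /dom_quot_pi rmorphB.
Qed.
Lemma frac_quot_pi_monoid : monoid_morphism frac_quot_pi.
Proof.
split=> [|a b]; rewrite /frac_quot_pi.
  by rewrite -tofrac1; congr tofrac; exact: rmorph1.
by rewrite -tofracM; congr tofrac; rewrite /dom_quot_pi rmorphM.
Qed.
HB.instance Definition _ :=
  GRing.isZmodMorphism.Build R {fraction dom_quot} frac_quot_pi frac_quot_pi_zmod.
HB.instance Definition _ :=
  GRing.isMonoidMorphism.Build R {fraction dom_quot} frac_quot_pi
    frac_quot_pi_monoid.

Lemma frac_quot_pi_eq0 a : (frac_quot_pi a == 0) = (a \in P).
Proof.
rewrite /frac_quot_pi tofrac_eq0 -[a in RHS]subr0 Quotient.idealrBE.
by congr (_ == _); symmetry; exact: rmorph0.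
Qed.

Lemma frac_quot_piP (z : {fraction dom_quot}) :
  exists a b, b \notin P /\ z = frac_quot_pi a / frac_quot_pi b.
Proof.
have piK (x : dom_quot) : dom_quot_pi (repr x) = x by exact: reprK.
have [x [y [y0 ->]]] := fraction_div z.
exists (repr x), (repr y).
by rewrite -frac_quot_pi_eq0 /frac_quot_pi !piK tofrac_eq0 y0.
Qed.

(* Frac(R/P), packaged opaquely so that conversion never unfolds the        *)
(* quotient constructions.                                                   *)
Lemma frac_quot : {K : fieldType & {f : {rmorphism R -> K} |
  (forall a, (f a == 0) = (a \in P)) /\
  (forall z, exists a b, b \notin P /\ z = f a / f b)}}.
Proof.
by exists {fraction dom_quot}, frac_quot_pi; split;
  [exact: frac_quot_pi_eq0 | exact: frac_quot_piP].
Qed.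

End FracQuot.

(* Projective varieties: integral closed subschemes Proj(k[x]/I) of P^n_k.   *)

Record proj_variety (k : fieldType) := ProjVariety {
  amb_dim : nat;
  var_ideal : prime_idealr {mpoly k[amb_dim.+1]};
  var_homog : forall f d, f \in var_ideal -> pihomog mdeg d f \in var_ideal }.

Section Variety.
Variables (k : fieldType) (X : proj_variety k).
Local Notation n := (amb_dim X).
Local Notation I := (var_ideal X).
Local Notation S := {mpoly k[n.+1]}.

Definition point := proj_point (fun f : S => f \in I).

Definition var_dim (d : nat) : Prop := proj_dim (fun f : S => f \in I) d.

(* The base change of X to L is Proj of L[x] modulo the extension of I.      *)
Definition geom_irreducible : Prop :=
  forall (L : fieldType) (phi : {rmorphism k -> L}),
    proj_irreducible (fun g : {mpoly L[n.+1]} =>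
      exists2 f, f \in I & g = map_mpoly phi f).

Definition jacobian_minor (r : nat) (f : 'I_r -> S) (c : 'I_r -> 'I_n.+1) : S :=
  \det (\matrix_(i < r, j < r) mderiv (c j) (f i)).

(* The Jacobian matrix of the elements of I has rank r over the residue      *)
(* field of the affine cone at p.                                            *)
Definition jacobian_rank (p : point) (r : nat) : Prop :=
  (exists (f : 'I_r -> S) (c : 'I_r -> 'I_n.+1),
     (forall i, f i \in I) /\ ~ p (jacobian_minor f c)) /\
  (forall (f : 'I_r.+1 -> S) (c : 'I_r.+1 -> 'I_n.+1),
     (forall i, f i \in I) -> p (jacobian_minor f c)).

(* Smoothness over k, of relative dimension d: the Jacobian condition at     *)
(* every point, in homogeneous coordinates.                                  *)
Definition smooth_var (d : nat) : Prop :=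
  (d <= n)%N /\ forall p : point, jacobian_rank p (n - d).

(* The fraction field of the homogeneous coordinate ring S/I; the function   *)
(* field of X is its subfield of elements of degree 0.                       *)
Definition cone_field : fieldType := projT1 (frac_quot I).
Definition cone_elt : {rmorphism S -> cone_field} := sval (projT2 (frac_quot I)).

Definition ratfun (z : cone_field) : Prop :=
  exists (d : nat) (a b : S),
    [/\ a \is d.-homog, b \is d.-homog, b \notin I
      & z = cone_elt a / cone_elt b].

(* The local ring at p and its maximal ideal, inside the function field.     *)
Definition regular_at (p : point) (z : cone_field) : Prop :=
  exists (d : nat) (a b : S),
    [/\ a \is d.-homog, b \is d.-homog, ~ p b
      & z = cone_elt a / cone_elt b].

Definition vanishing_at (p : point) (z : cone_field) : Prop :=
  exists (d : nat) (a b : S),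
    [/\ a \is d.-homog, b \is d.-homog, p a, ~ p b
      & z = cone_elt a / cone_elt b].

Definition uniformizer (p : point) (t : cone_field) : Prop :=
  [/\ t != 0, vanishing_at p t
    & forall z, vanishing_at p z -> exists2 w, regular_at p w & z = w * t].

Definition unit_at (p : point) (u : cone_field) : Prop :=
  [/\ u != 0, regular_at p u & regular_at p u^-1].

(* v_p(z) = m for z != 0.  The local rings at the closed points of a smooth  *)
(* curve are discrete valuation rings: uniformizers exist, and the condition *)
(* does not depend on the one used.                                          *)
Definition has_order (p : point) (z : cone_field) (m : int) : Prop :=
  forall t, uniformizer p t -> exists2 u, unit_at p u & z = t ^ m * u.

Lemma cone_elt_eq0 (a : S) : (cone_elt a == 0) = (a \in I).
Proof. exact: (svalP (projT2 (frac_quot I))).1. Qed.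

Lemma cone_fieldP (z : cone_field) :
  exists a b, b \notin I /\ z = cone_elt a / cone_elt b.
Proof. exact: (svalP (projT2 (frac_quot I))).2. Qed.

Lemma pt_one (p : point) : ~ p 1.
Proof.
have [_ _ hM _ _ [i Xi]] := pt_prime p => p1; apply: Xi.
by rewrite -[X in p X]mulr1; apply: hM.
Qed.

Lemma pt_nmul (p : point) (a b : S) : ~ p a -> ~ p b -> ~ p (a * b).
Proof. by have [_ _ _ hP _ _] := pt_prime p => na nb /hP[]. Qed.

Lemma pt_cone (p : point) (a : S) : ~ p a -> cone_elt a != 0.
Proof. by move=> na; rewrite cone_elt_eq0; apply/negP => /(pt_above p). Qed.

Lemma ratfun1 : ratfun 1.
Proof.
exists 0%N, 1, 1; rewrite idealr1 rmorph1 divr1; split => //; exact: dhomog1.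
Qed.

Lemma regular1 p : regular_at p 1.
Proof.
exists 0%N, 1, 1; rewrite rmorph1 divr1; split => //; try exact: dhomog1.
exact: pt_one.
Qed.

Lemma regularM p z w : regular_at p z -> regular_at p w -> regular_at p (z * w).
Proof.
move=> [d [a [b [ha hb nb ->]]]] [e [a' [b' [ha' hb' nb' ->]]]].
exists (d + e)%N, (a * a'), (b * b'); split; try exact: dhomogM.
  exact: pt_nmul.
by rewrite !rmorphM mulf_div.
Qed.

Lemma regularB p z w : regular_at p z -> regular_at p w -> regular_at p (z - w).
Proof.
move=> [d [a [b [ha hb nb ->]]]] [e [a' [b' [ha' hb' nb' ->]]]].
exists (d + e)%N, (a * b' - a' * b), (b * b'); split; try exact: dhomogM.
- by apply: rpredB; [exact: dhomogM | rewrite addnC; exact: dhomogM].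
- exact: pt_nmul.
rewrite rmorphB !rmorphM -[in LHS]mulNr.
by rewrite addf_div ?(@pt_cone p) // mulNr.
Qed.

Lemma ratfunM z w : ratfun z -> ratfun w -> ratfun (z * w).
Proof.
move=> [d [a [b [ha hb nb ->]]]] [e [a' [b' [ha' hb' nb' ->]]]].
exists (d + e)%N, (a * a'), (b * b'); split; try exact: dhomogM.
  by rewrite prime_idealrM negb_or nb.
by rewrite !rmorphM mulf_div.
Qed.

Lemma ratfunV z : z != 0 -> ratfun z -> ratfun z^-1.
Proof.
move=> z0 [d [a [b [ha hb nb Ez]]]].
exists d, b, a; split => //; last by rewrite Ez invf_div.
by rewrite -cone_elt_eq0; apply: contraNneq z0 => a0; rewrite Ez a0 mul0r.
Qed.

Lemma ratfunB z w : ratfun z -> ratfun w -> ratfun (z - w).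
Proof.
move=> [d [a [b [ha hb nb ->]]]] [e [a' [b' [ha' hb' nb' ->]]]].
exists (d + e)%N, (a * b' - a' * b), (b * b'); split; try exact: dhomogM.
- by apply: rpredB; [exact: dhomogM | rewrite addnC; exact: dhomogM].
- by rewrite prime_idealrM negb_or nb.
rewrite rmorphB !rmorphM -[in LHS]mulNr.
by rewrite addf_div ?cone_elt_eq0 // mulNr.
Qed.

Lemma regular_ratfun p z : regular_at p z -> ratfun z.
Proof.
move=> [d [a [b [ha hb nb ->]]]]; exists d, a, b; split => //.
by apply/negP => /(pt_above p).
Qed.

Lemma unit_at1 p : unit_at p 1.
Proof. by split; rewrite ?invr1 ?oner_neq0 //; exact: regular1. Qed.

Lemma unit_at_div p u v : unit_at p u -> unit_at p v -> unit_at p (u / v).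
Proof.
move=> [u0 ru riu] [v0 rv riv]; split.
- by apply: mulf_neq0 => //; rewrite invr_eq0.
- exact: regularM.
- by rewrite invf_div; apply: regularM.
Qed.

Definition closed_point_pred (p : point) : Prop :=
  forall q : point, (forall f, p f -> q f) -> (forall f, q f -> p f).

Record closed_point := ClosedPoint {
  cp_point :> point;
  cp_closed : closed_point_pred cp_point }.
HB.instance Definition _ := gen_eqMixin closed_point.
HB.instance Definition _ := gen_choiceMixin closed_point.

Definition divisor := {freeg closed_point / int}.
HB.instance Definition _ := GRing.Zmodule.on divisor.

Definition principal_prop (D : divisor) : Prop :=
  exists z : cone_field, [/\ ratfun z, z != 0
    & forall P : closed_point, has_order P z (coeff P D)].

Definition principal : pred divisor := fun D => `[< principal_prop D >].

Lemma principal_zmod_closed : zmod_closed principal.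
Proof.
split=> [|D E /asboolP[z [rz z0 hz]] /asboolP[w [rw w0 hw]]]; apply/asboolP.
  exists 1; split; rewrite ?oner_neq0 //; first exact: ratfun1.
  move=> P t _; exists 1; first exact: unit_at1.
  by rewrite raddf0 expr0z mul1r.
exists (z / w); split.
- by apply: ratfunM => //; apply: ratfunV.
- by apply: mulf_neq0 => //; rewrite invr_eq0.
move=> P t ht; have [t0 _ _] := ht.
have [u hu ->] := hz P t ht; have [v hv ->] := hw P t ht.
exists (u / v); first exact: unit_at_div.
by rewrite raddfB /= expfzDr // -invr_expz invfM mulrACA.
Qed.

HB.instance Definition _ :=
  GRing.isZmodClosed.Build divisor principal principal_zmod_closed.

Definition principal_subgroup : zmodClosed divisor :=
  GRing.ZmodClosed.clone divisor principal _.

Definition Cl : zmodType := Quotient.quot principal_subgroup.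
Definition cl (D : divisor) : Cl := \pi_(Quotient.quot principal_subgroup) D.

Local Notation opens := (opens (fun f : S => f \in I)).

Definition osub (V U : opens) : Prop := forall p : point, V p -> U p.

(* Functions on U that are locally given by one rational function z that     *)
(* satisfies the condition A q z at each point q where it is used.           *)
Definition local_section (A : point -> cone_field -> Prop) (U : opens)
    (s : {p : point | U p} -> cone_field) : Prop :=
  forall p : {p : point | U p}, exists V : opens, V (sval p) /\
    exists z, forall q : {p : point | U p}, V (sval q) ->
      s q = z /\ A (sval q) z.

Lemma open_cap_subproof (U V : opens) : zariski_open (fun p => U p /\ V p).
Proof.
move=> p [/(open_setP (o := U))[d [f [hf pf Uf]]]].
move=> /(open_setP (o := V))[e [g [hg pg Vg]]].
exists (d + e)%N, (f * g); split; [exact: dhomogM | exact: pt_nmul |].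
move=> q nq; have [_ _ hM _ _ _] := pt_prime q.
split; [apply: Uf => qf | apply: Vg => qg]; apply: nq; last exact: hM.
by rewrite mulrC; apply: hM.
Qed.
Definition open_cap (U V : opens) : opens := Open (@open_cap_subproof U V).

Lemma open_full_subproof :
  zariski_open (fun _ : proj_point (fun f : S => f \in I) => True).
Proof.
by move=> p _; exists 0%N, 1; split; [exact: dhomog1 | exact: pt_one |].
Qed.
Definition open_full : opens := Open open_full_subproof.

Lemma local_section_op2 (A B C : point -> cone_field -> Prop) U op s t :
  (forall p z w, A p z -> B p w -> C p (op z w)) ->
  @local_section A U s -> @local_section B U t ->
  @local_section C U (fun p => op (s p) (t p)).
Proof.
move=> hop hs ht p; have [V [Vp [z hz]]] := hs p; have [W [Wp [w hw]]] := ht p.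
exists (open_cap V W); split => //; exists (op z w) => q [/= Vq Wq].
by have [-> Az] := hz q Vq; have [-> Aw] := hw q Wq; split => //; apply: hop.
Qed.

Lemma local_section_cst (A : point -> cone_field -> Prop) U z :
  (forall p, A p z) -> @local_section A U (fun=> z).
Proof. by move=> h p; exists open_full; split => //; exists z. Qed.

Definition incl (U V : opens) (h : osub V U) (p : {p : point | V p}) :
  {p : point | U p} := exist _ (sval p) (h _ (svalP p)).

Lemma local_section_res A U V (h : osub V U) s :
  @local_section A U s -> @local_section A V (s \o incl h).
Proof.
move=> hs p; have [W [Wp [z hz]]] := hs (incl h p).
by exists W; split => //; exists z => q Wq; apply: hz.
Qed.

Definition regular_fun (U : opens) : pred ({p : point | U p} -> cone_field) :=
  fun s => `[< local_section regular_at s >].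

Lemma regular_fun_subring U : subring_closed (@regular_fun U).
Proof.
split=> [|s t /asboolP hs /asboolP ht|s t /asboolP hs /asboolP ht];
  apply/asboolP.
- by apply: local_section_cst => p; apply: regular1.
- exact: local_section_op2 (@regularB) hs ht.
- exact: local_section_op2 (@regularM) hs ht.
Qed.

(* O_X(U).  It is the zero ring when U is empty. *)
Record OX (U : opens) := MkOX {
  OX_fun : {p : point | U p} -> cone_field;
  OX_funP : OX_fun \in @regular_fun U }.
HB.instance Definition _ U := [isSub for @OX_fun U].
HB.instance Definition _ U := [Choice of OX U by <:].
HB.instance Definition _ U := GRing.SubChoice_isSubComPzRing.Build _
  (@regular_fun U) (OX U) (regular_fun_subring U).

Lemma OX_local U (a : OX U) : local_section regular_at (OX_fun a).
Proof. exact/asboolP/OX_funP. Qed.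

Definition OX_res U V (h : osub V U) (a : OX U) : OX V :=
  MkOX (asboolT (local_section_res h (OX_local a))).

Definition covers (J : Type) (V : J -> opens) (U : opens) : Prop :=
  forall p : point, U p -> exists j, V j p.

Record omodule := OModule {
  sec : forall U : opens, lmodType (OX U);
  res : forall U V : opens, osub V U -> sec U -> sec V;
  resD : forall U V (h : osub V U) s t, res h (s + t) = res h s + res h t;
  resZ : forall U V (h : osub V U) a s, res h (a *: s) = OX_res h a *: res h s;
  res_id : forall U (h : osub U U) s, res h s = s;
  res_comp : forall U V W (h : osub V U) (h' : osub W V) (h'' : osub W U) s,
    res h' (res h s) = res h'' s;
  sec_eq : forall (J : Type) (V : J -> opens) U (h : forall j, osub (V j) U),
    covers V U -> forall s t : sec U,
    (forall j, res (h j) s = res (h j) t) -> s = t;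
  sec_glue : forall (J : Type) (V : J -> opens) U (h : forall j, osub (V j) U),
    covers V U -> forall s : (forall j, sec (V j)),
    (forall i j W (hi : osub W (V i)) (hj : osub W (V j)),
       res hi (s i) = res hj (s j)) ->
    exists t : sec U, forall j, res (h j) t = s j }.

Record omorphism (E F : omodule) := OMorphism {
  omap :> forall U : opens, {linear sec E U -> sec F U};
  omap_res : forall U V (h : osub V U) s,
    omap V (res h s) = res h (omap U s) }.

Definition oiso (E F : omodule) : Prop :=
  exists (f : omorphism E F) (g : omorphism F E),
    forall U, cancel (f U) (g U) /\ cancel (g U) (f U).

Record obilinear (E F G : omodule) := OBilinear {
  obil :> forall U : opens, sec E U -> sec F U -> sec G U;
  obil_l : forall U t, linear (fun s => @obil U s t);
  obil_r : forall U s, linear (@obil U s);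
  obil_res : forall U V (h : osub V U) s t,
    obil (res h s) (res h t) = res h (obil s t) }.
Arguments obil {E F G} _ U _ _.

(* T is the tensor product of E and F over O_X, by its universal property. *)
Definition is_otensor (E F T : omodule) : Prop :=
  exists b : obilinear E F T, forall (M : omodule) (c : obilinear E F M),
    exists f : omorphism T M,
      (forall U s t, f U (b U s t) = c U s t) /\
      (forall g : omorphism T M, (forall U s t, g U (b U s t) = c U s t) ->
         forall U x, g U x = f U x).

(* Locally free of rank r: near each point, r sections e_i over some U       *)
(* induce an isomorphism of O_U^r with the restriction of E to U.            *)
Definition vector_bundle (r : nat) (E : omodule) : Prop :=
  forall p : point, exists U : opens, U p /\
    exists e : 'I_r -> sec E U, forall V (h : osub V U) (s : sec E V),
      exists! a : 'I_r -> OX V, s = \sum_(i < r) a i *: res h (e i).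

Definition line_bundle := vector_bundle 1.

Lemma sig_pt_inj (U : opens) (p q : {p : point | U p}) :
  sval p = sval q -> p = q.
Proof. by case: p q => p ? [q ?] /= ?; apply: eq_exist. Qed.

Lemma local_section_glue (A : point -> cone_field -> Prop) (J : Type)
    (V : J -> opens) U (h : forall j, osub (V j) U)
    (s : forall j, {p : point | V j p} -> cone_field) :
  covers V U -> (forall j, local_section A (s j)) ->
  (forall i j W (hi : osub W (V i)) (hj : osub W (V j)),
     s i \o incl hi = s j \o incl hj) ->
  exists2 t, @local_section A U t & forall j, t \o incl (h j) = s j.
Proof.
move=> cov hs comp.
pose ix (p : {p | U p}) := cid (cov _ (svalP p)).
pose t (p : {p | U p}) := s (projT1 (ix p)) (exist _ (sval p) (projT2 (ix p))).
have tE j (p : {p | V j p}) : t (incl (h j) p) = s j p.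
  rewrite /t; case: (ix _) => i /= ip.
  have hi : osub (open_cap (V i) (V j)) (V i) by move=> ? [].
  have hj : osub (open_cap (V i) (V j)) (V j) by move=> ? [].
  have := congr1 (fun f => f (exist (open_cap (V i) (V j)) (sval p)
    (conj ip (svalP p)))) (comp _ _ _ hi hj).
  rewrite /= /incl /= => E.
  apply: etrans (etrans _ E) _; first by congr (s i _); apply: sig_pt_inj.
  by congr (s j _); apply: sig_pt_inj.
exists t; last by move=> j; apply/funext => p; apply: tE.
move=> p; have [j jp] := cov _ (svalP p).
have [W [Wp [z hz]]] := hs j (exist _ (sval p) jp).
exists (open_cap W (V j)); split => //; exists z => q [Wq jq].
have [Ez Az] := hz (exist _ (sval q) jq) Wq; split => //.
by rewrite -Ez -tE; congr t; apply: sig_pt_inj.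
Qed.

Lemma OX_resD U V (h : osub V U) (a b : OX U) :
  OX_res h (a + b) = OX_res h a + OX_res h b.
Proof. by apply: val_inj. Qed.

Lemma OX_resZ U V (h : osub V U) (a : OX U) (s : (OX U)^o) :
  OX_res h (a *: s) = OX_res h a *: (OX_res h s : (OX V)^o).
Proof. by apply: val_inj. Qed.

Lemma incl_id U (h : osub U U) p : incl h p = p.
Proof. exact: sig_pt_inj. Qed.

Lemma OX_res_id U (h : osub U U) (a : OX U) : OX_res h a = a.
Proof. by apply: val_inj; apply/funext => p /=; rewrite incl_id. Qed.

Lemma incl_comp U V W (h : osub V U) (h' : osub W V) (h'' : osub W U) p :
  incl h (incl h' p) = incl h'' p.
Proof. exact: sig_pt_inj. Qed.

Lemma OX_res_comp U V W (h : osub V U) (h' : osub W V) (h'' : osub W U)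
  (a : OX U) : OX_res h' (OX_res h a) = OX_res h'' a.
Proof. by apply: val_inj; apply/funext => p /=; rewrite (incl_comp _ _ h''). Qed.

Lemma fun_cover_eq (J : Type) (V : J -> opens) U (h : forall j, osub (V j) U)
    (s t : {p : point | U p} -> cone_field) :
  covers V U -> (forall j, s \o incl (h j) = t \o incl (h j)) -> s = t.
Proof.
move=> cov E; apply/funext => p; have [j jp] := cov _ (svalP p).
have := congr1 (fun f => f (exist (V j) (sval p) jp)) (E j).
rewrite /=; have -> // : incl (h j) (exist (V j) (sval p) jp) = p.
exact: sig_pt_inj.
Qed.

Lemma OX_eq (J : Type) (V : J -> opens) U (h : forall j, osub (V j) U) :
  covers V U -> forall s t : OX U,
  (forall j, OX_res (h j) s = OX_res (h j) t) -> s = t.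
Proof.
move=> cov s t E; apply: val_inj; apply: (fun_cover_eq (h := h) cov) => j.
exact: (congr1 (@OX_fun (V j)) (E j)).
Qed.

Lemma OX_glue (J : Type) (V : J -> opens) U (h : forall j, osub (V j) U) :
  covers V U -> forall s : (forall j, OX (V j)),
  (forall i j W (hi : osub W (V i)) (hj : osub W (V j)),
     OX_res hi (s i) = OX_res hj (s j)) ->
  exists t : OX U, forall j, OX_res (h j) t = s j.
Proof.
move=> cov s E.
have [|i j W hi hj|t ht tE] := local_section_glue (A := regular_at) h
  (s := fun j => OX_fun (s j)) cov.
- by move=> j; apply: OX_local.
- exact: (congr1 (@OX_fun W) (E i j W hi hj)).
by exists (MkOX (asboolT ht)) => j; apply: val_inj; apply: tE.
Qed.

Definition structure_sheaf : omodule :=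
  @OModule (fun U => (OX U)^o) (@OX_res) (@OX_resD) (@OX_resZ) (@OX_res_id)
    (@OX_res_comp) OX_eq OX_glue.

Section DirectSum.
Variables E F : omodule.

Definition osum_res U V (h : osub V U) (s : (sec E U * sec F U)%type) :
  (sec E V * sec F V)%type := (res h s.1, res h s.2).

Lemma osum_resD U V (h : osub V U) s t :
  osum_res h (s + t) = osum_res h s + osum_res h t.
Proof. by rewrite /osum_res !resD. Qed.

Lemma osum_resZ U V (h : osub V U) (a : OX U) s :
  osum_res h (a *: s) = OX_res h a *: osum_res h s.
Proof. by rewrite /osum_res !resZ. Qed.

Lemma osum_res_id U (h : osub U U) s : osum_res h s = s.
Proof. by case: s => s t; rewrite /osum_res !res_id. Qed.

Lemma osum_res_comp U V W (h : osub V U) (h' : osub W V) (h'' : osub W U) s :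
  osum_res h' (osum_res h s) = osum_res h'' s.
Proof. by rewrite /osum_res /= !(res_comp h h' h''). Qed.

Lemma osum_eq (J : Type) (V : J -> opens) U (h : forall j, osub (V j) U) :
  covers V U -> forall s t : (sec E U * sec F U)%type,
  (forall j, osum_res (h j) s = osum_res (h j) t) -> s = t.
Proof.
move=> cov [s1 s2] [t1 t2] EQ; congr pair; apply: (sec_eq (h := h) cov) => j.
  by have /(congr1 fst) := EQ j.
by have /(congr1 snd) := EQ j.
Qed.

Lemma osum_glue (J : Type) (V : J -> opens) U (h : forall j, osub (V j) U) :
  covers V U -> forall s : (forall j, (sec E (V j) * sec F (V j))%type),
  (forall i j W (hi : osub W (V i)) (hj : osub W (V j)),
     osum_res hi (s i) = osum_res hj (s j)) ->
  exists t : (sec E U * sec F U)%type, forall j, osum_res (h j) t = s j.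
Proof.
move=> cov s EQ.
have [|t1 t1E] := sec_glue h cov (s := fun j => (s j).1).
  by move=> i j W hi hj; have /(congr1 fst) := EQ i j W hi hj.
have [|t2 t2E] := sec_glue h cov (s := fun j => (s j).2).
  by move=> i j W hi hj; have /(congr1 snd) := EQ i j W hi hj.
exists (t1, t2) => j; by rewrite /osum_res /= t1E t2E; case: (s j).
Qed.

Definition osum : omodule :=
  @OModule (fun U => (sec E U * sec F U)%type) (@osum_res) (@osum_resD)
    (@osum_resZ) (@osum_res_id) (@osum_res_comp) osum_eq osum_glue.

End DirectSum.

(* The line bundle L_D:                                                      *)
(*   L_D(U) = {z | v_P(z) + D(P) >= 0 for all closed points P of U}.         *)

Section LineBundle.
Variable D : divisor.

Definition LD_at (p : point) (z : cone_field) : Prop :=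
  ratfun z /\
  forall (c : closed_point_pred p) t, uniformizer p t ->
    regular_at p (t ^ coeff (ClosedPoint c) D * z).

Lemma LD_at0 p : LD_at p 0.
Proof.
by split=> [|c t _]; rewrite -?(subrr 1) ?mulrBr; last rewrite subrr -(subrr 1);
  [apply: ratfunB; exact: ratfun1 | apply: regularB; exact: regular1].
Qed.

Lemma LD_atB p z w : LD_at p z -> LD_at p w -> LD_at p (z - w).
Proof.
move=> [rz hz] [rw hw]; split=> [|c t ht]; first exact: ratfunB.
by rewrite mulrBr; apply: regularB; [apply: hz | apply: hw].
Qed.

Lemma LD_atM p a z : regular_at p a -> LD_at p z -> LD_at p (a * z).
Proof.
move=> ra [rz hz]; split=> [|c t ht].
  by apply: ratfunM => //; apply: regular_ratfun ra.
by rewrite mulrCA; apply: regularM => //; apply: hz.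
Qed.

Definition LD_pred (U : opens) : pred ({p : point | U p} -> cone_field) :=
  fun s => `[< local_section LD_at s >].

Lemma LD_zmod_closed U : zmod_closed (@LD_pred U).
Proof.
split=> [|s t /asboolP hs /asboolP ht]; apply/asboolP.
  by apply: local_section_cst => p; apply: LD_at0.
exact: local_section_op2 (@LD_atB) hs ht.
Qed.

Record LD_sec (U : opens) := MkLD {
  LD_fun : {p : point | U p} -> cone_field;
  LD_funP : LD_fun \in @LD_pred U }.
HB.instance Definition _ U := [isSub for @LD_fun U].
HB.instance Definition _ U := [Choice of LD_sec U by <:].
HB.instance Definition _ U := GRing.SubChoice_isSubZmodule.Build _
  (@LD_pred U) (LD_sec U) (LD_zmod_closed U).

Lemma LD_local U (s : LD_sec U) : local_section LD_at (LD_fun s).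
Proof. exact/asboolP/LD_funP. Qed.

Definition LD_scale U (a : OX U) (s : LD_sec U) : LD_sec U :=
  MkLD (asboolT (local_section_op2 (@LD_atM) (OX_local a) (LD_local s))).

Lemma LD_scaleA U (a b : OX U) s :
  LD_scale a (LD_scale b s) = LD_scale (a * b) s.
Proof. by apply: val_inj; apply/funext => p /=; rewrite mulrA. Qed.
Lemma LD_scale1 U : left_id 1 (@LD_scale U).
Proof. by move=> s; apply: val_inj; apply/funext => p /=; rewrite mul1r. Qed.
Lemma LD_scaleDr U : right_distributive (@LD_scale U) +%R.
Proof. by move=> a s t; apply: val_inj; apply/funext => p /=; rewrite mulrDr. Qed.
Lemma LD_scaleDl U s : {morph (@LD_scale U)^~ s : a b / a + b}.
Proof. by move=> a b; apply: val_inj; apply/funext => p /=; rewrite mulrDl. Qed.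

HB.instance Definition _ U := GRing.Zmodule_isLmodule.Build (OX U) (LD_sec U)
  (@LD_scaleA U) (@LD_scale1 U) (@LD_scaleDr U) (@LD_scaleDl U).

Definition LD_res U V (h : osub V U) (s : LD_sec U) : LD_sec V :=
  MkLD (asboolT (local_section_res h (LD_local s))).

Lemma LD_resD U V (h : osub V U) (s t : LD_sec U) :
  LD_res h (s + t) = LD_res h s + LD_res h t.
Proof. by apply: val_inj. Qed.

Lemma LD_resZ U V (h : osub V U) (a : OX U) (s : LD_sec U) :
  LD_res h (a *: s) = OX_res h a *: LD_res h s.
Proof. by apply: val_inj. Qed.

Lemma LD_res_id U (h : osub U U) (s : LD_sec U) : LD_res h s = s.
Proof. by apply: val_inj; apply/funext => p /=; rewrite incl_id. Qed.

Lemma LD_res_comp U V W (h : osub V U) (h' : osub W V) (h'' : osub W U)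
  (s : LD_sec U) : LD_res h' (LD_res h s) = LD_res h'' s.
Proof. by apply: val_inj; apply/funext => p /=; rewrite (incl_comp _ _ h''). Qed.

Lemma LD_eq (J : Type) (V : J -> opens) U (h : forall j, osub (V j) U) :
  covers V U -> forall s t : LD_sec U,
  (forall j, LD_res (h j) s = LD_res (h j) t) -> s = t.
Proof.
move=> cov s t E; apply: val_inj; apply: (fun_cover_eq (h := h) cov) => j.
exact: (congr1 (@LD_fun (V j)) (E j)).
Qed.

Lemma LD_glue (J : Type) (V : J -> opens) U (h : forall j, osub (V j) U) :
  covers V U -> forall s : (forall j, LD_sec (V j)),
  (forall i j W (hi : osub W (V i)) (hj : osub W (V j)),
     LD_res hi (s i) = LD_res hj (s j)) ->
  exists t : LD_sec U, forall j, LD_res (h j) t = s j.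
Proof.
move=> cov s E.
have [|i j W hi hj|t ht tE] := local_section_glue (A := LD_at) h
  (s := fun j => LD_fun (s j)) cov.
- by move=> j; apply: LD_local.
- exact: (congr1 (@LD_fun W) (E i j W hi hj)).
by exists (MkLD (asboolT ht)) => j; apply: val_inj; apply: tE.
Qed.

Definition LD : omodule :=
  @OModule LD_sec (@LD_res) (@LD_resD) (@LD_resZ) (@LD_res_id) (@LD_res_comp)
    LD_eq LD_glue.

End LineBundle.

(* The rank 2 bundles isomorphic to the tensor product of E with some line   *)
(* bundle L; is_otensor E L is closed under isomorphism.                     *)
Definition bun_class (E : omodule) : omodule -> Prop :=
  fun E' => vector_bundle 2 E' /\
    exists L, line_bundle L /\ is_otensor E L E'.

Definition PBun2 : Type :=
  {c : omodule -> Prop | exists E, vector_bundle 2 E /\ c = bun_class E}.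

Definition decomposable (E : omodule) : Prop :=
  exists L M, [/\ line_bundle L, line_bundle M & oiso E (osum L M)].

Definition PBun2dec : Type :=
  {c : PBun2 | exists E, [/\ vector_bundle 2 E, decomposable E
                          & sval c = bun_class E]}.

Definition c_class (D : divisor) : omodule -> Prop :=
  bun_class (osum (LD D) structure_sheaf).

End Variety.

(* Main.v *)
(** Every line bundle L on X is some L_D: the quotient of a local generator of
    L by a generator at the generic point is a rational function, and D is
    read off from the orders of these functions. Hence a decomposable rank 2
    bundle is L_a (+) L_b, and since tensoring with L_A adds A to both
    divisors its class depends on a - b only; surjectivity follows. For the
    fibres, an isomorphism L_a (+) L_b = L_c (+) L_d is a 2 x 2 matrix of
    rational functions that are global sections of L_(c-a), L_(c-b), L_(d-a),
    L_(d-b), and the inverse of its determinant is a global section of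
    L_(a+b-c-d). Multiplied by the two diagonal (or the two antidiagonal)
    entries, if these are nonzero, it becomes a global regular function, hence
    a unit, so these entries have no zeros and {[a], [b]} = {[c], [d]}.

    The local theory exploits that k is finite. At a closed point p with x_0
    not in p the residue field is finite, and for a suitable power Q of |k|
    the forms g_j = x_j^Q - x_j x_0^(Q-1) generate p locally, since f^Q is
    congruent to x_0^(d(Q-1)) f modulo the g_j for f of degree d; the Jacobian
    condition makes one g_j divide the others in the local ring of X, so it is
    a uniformizer. The finiteness of residue fields and the invertibility of
    global functions both come from the centre on X of a valuation ring. *)

From HB Require Import structures.
From mathcomp Require Import all_boot all_algebra all_field.
From mathcomp Require Import boolp classical_sets functions.
From mathcomp Require Import mpoly freeg ring.
Require Import Defs.

Set Implicit Arguments.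
Unset Strict Implicit.
Unset Printing Implicit Defensive.

Import GRing.Theory.
Local Open Scope ring_scope.

(** * Ideals and homogeneous primes *)

(* The sets closed under R and disjoint from B form an inductive family: a
   rule R x y z has only two premises, so it applies inside one set of a
   chain. *)
Lemma maximal_closed_set (T : Type) (R : T -> T -> T -> Prop) (B A : set T) :
    let closed (P : set T) := forall x y z, R x y z -> P x -> P y -> P z in
    let disjoint (P : set T) := forall x, P x -> ~ B x in
    closed A -> disjoint A ->
  exists P : set T, [/\ (A `<=` P)%classic, closed P, disjoint P &
    forall P' : set T, (P `<=` P')%classic -> closed P' -> disjoint P' ->
      (P' `<=` P)%classic].
Proof.
move=> closed disjoint cA dA.
pose good (P : set T) := closed (A `|` P)%classic /\ disjoint (A `|` P)%classic.
have [F Fgood Ftot|P [[cP dP] maxP]] := @Zorn_bigcup T good.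
- have chain x y : (A `|` \bigcup_(X in F) X)%classic x ->
      (A `|` \bigcup_(X in F) X)%classic y ->
      (A x /\ A y) \/ exists2 X, F X & (A `|` X)%classic x /\
        (A `|` X)%classic y.
    case=> [Ax|[X FX Xx]] [Ay|[Y FY Yy]]; first by left.
    - by right; exists Y => //; split; [left | right].
    - by right; exists X => //; split; [right | left].
    - right; have [XY|YX] := Ftot _ _ FX FY.
        by exists Y => //; split; right=> //; exact: XY.
      by exists X => //; split; right=> //; exact: YX.
  split=> [x y z Rxyz Ux Uy|x Ux].
    have [[Ax Ay]|[X FX [Xx Xy]]] := chain x y Ux Uy.
      by left; exact: cA Rxyz Ax Ay.
    have [cX _] := Fgood X FX.
    by have [Az|Xz] := cX x y z Rxyz Xx Xy; [left | right; exists X].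
  have [[/dA//]|[X FX [Xx _]]] := chain x x Ux Ux.
  by have [_ dX] := Fgood X FX; exact: dX.
- exists (A `|` P)%classic; split=> // P' PP' cP' dP' x P'x.
  have AP' : (A `|` P')%classic = P'.
    by apply/seteqP; split=> y; [case=> // Ay; apply: PP'; left | right].
  apply: contrapT => Nx; apply: (maxP P'); last by rewrite /good AP'.
  split=> [y Py|P'P]; first by apply: PP'; right.
  by apply: Nx; right; exact: P'P.
Qed.

Section IdealPred.
Variable R : comNzRingType.
Implicit Types (A P : R -> Prop) (f g x : R).

Record ideal_pred A : Prop := IdealPred {
  ideal_pred0 : A 0;
  ideal_predD : forall f g, A f -> A g -> A (f + g);
  ideal_predMl : forall f g, A g -> A (f * g) }.

Record prime_pred P : Prop := PrimePred {
  prime_ideal_pred :> ideal_pred P;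
  prime_pred_or : forall f g, P (f * g) -> P f \/ P g }.

Lemma ideal_predMr A f g : ideal_pred A -> A f -> A (f * g).
Proof. by move=> idA Af; rewrite mulrC; exact: ideal_predMl. Qed.

Lemma ideal_predN A f : ideal_pred A -> A f -> A (- f).
Proof. by move=> idA Af; rewrite -mulN1r; exact: ideal_predMl. Qed.

Lemma ideal_predB A f g : ideal_pred A -> A f -> A g -> A (f - g).
Proof. by move=> idA Af Ag; apply: ideal_predD => //; exact: ideal_predN. Qed.

Lemma ideal_pred_sum A (J : Type) (s : seq J) (Q : pred J) (F : J -> R) :
  ideal_pred A -> (forall i, Q i -> A (F i)) -> A (\sum_(i <- s | Q i) F i).
Proof.
by move=> idA AF; apply: (big_ind A) => //;
  [exact: ideal_pred0|exact: ideal_predD].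
Qed.

Definition ideal_gen (J : finType) (g : J -> R) : R -> Prop :=
  fun f => exists h : J -> R, f = \sum_j h j * g j.

Lemma ideal_genP (J : finType) (g : J -> R) : ideal_pred (ideal_gen g).
Proof.
split=> [|_ _ [h ->] [h' ->]|f _ [h ->]].
- by exists (fun=> 0); rewrite big1 // => j _; rewrite mul0r.
- exists (fun j => h j + h' j).
  by rewrite -big_split; apply: eq_bigr => j _; rewrite mulrDl.
- exists (fun j => f * h j).
  by rewrite mulr_sumr; apply: eq_bigr => j _; rewrite mulrA.
Qed.

Lemma ideal_gen_mem (J : finType) (g : J -> R) j : ideal_gen g (g j).
Proof.
exists (fun i => (i == j)%:R); rewrite (bigD1 j) //= eqxx mul1r big1 ?addr0 //.
by move=> i /negPf->; rewrite mul0r.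
Qed.

Lemma prime_avoiding_powers A x : ideal_pred A -> (forall N, ~ A (x ^+ N)) ->
  exists2 P, prime_pred P & (forall f, A f -> P f) /\ ~ P x.
Proof.
move=> idA Ax.
pose rule f g h := h = f + g \/ exists a, h = a * g.
have ruleP (P : R -> Prop) : P 0 ->
    (forall f g h, rule f g h -> P f -> P g -> P h) -> ideal_pred P.
  by move=> P0 cP; split=> // [f g|f g Pg]; [apply: cP; left|
    apply: (cP g g) => //; right; exists f].
have closedP P : ideal_pred P -> forall f g h, rule f g h -> P f -> P g -> P h.
  by move=> idP f g _ [->|[a ->]] Pf Pg;
    [exact: ideal_predD|exact: ideal_predMl].
have [] := @maximal_closed_set R rule (fun f => exists N, f = x ^+ N) A.
- exact: closedP.
- by move=> f Af [N E]; apply: (Ax N); rewrite -E.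
move=> P [AP cP Px maxP].
have idP : ideal_pred P by apply: ruleP => //; exact: AP (ideal_pred0 idA).
have nPx N : ~ P (x ^+ N) by move=> /Px; apply; exists N.
exists P; last by split=> // /(nPx 1%N).
have power_mod f : ~ P f -> exists N a, P (x ^+ N - a * f).
  move=> nPf; apply: contrapT => none; apply: nPf.
  apply: (maxP (fun g => exists a, P (g - a * f))).
  - by move=> g Pg; exists 0; rewrite mul0r subr0.
  - apply: closedP; split=> [|g h [a Pa] [b Pb]|c g [a Pa]].
    + by exists 0; rewrite mul0r subr0; exact: ideal_pred0.
    + by exists (a + b); rewrite mulrDl opprD addrACA; exact: ideal_predD.
    + by exists (c * a); rewrite -mulrA -mulrBr; exact: ideal_predMl.
  - by move=> g [a Pa] [N E]; apply: none; exists N, a; rewrite -E.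
  - by exists 1; rewrite mul1r subrr; exact: ideal_pred0.
split=> // f g Pfg.
apply: contrapT => /not_orP[/power_mod[N [a Pa]] /power_mod[M [b Pb]]].
apply: (nPx (N + M)%N).
have -> : x ^+ (N + M) = x ^+ M * (x ^+ N - a * f) + (a * f) * (x ^+ M - b * g)
    + (a * b) * (f * g) by rewrite exprD; ring.
by apply: (ideal_predD idP); [apply: (ideal_predD idP)|]; exact: ideal_predMl.
Qed.

End IdealPred.

Section HomogeneousComponents.
Variables (k : fieldType) (n : nat).
Local Notation S := {mpoly k[n]}.
Implicit Types (f g : S) (d e : nat) (P : S -> Prop).

Lemma dhomog_X i : ('X_i : S) \is 1.-homog.
Proof. by rewrite dhomogX /= mdeg1. Qed.

Lemma dhomog_Xn i d : ('X_i : S) ^+ d \is d.-homog.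
Proof. by have := dhomogMn d (dhomog_X i); rewrite mul1n. Qed.

Lemma pihomog_partition N f :
  exists2 K, (N <= K)%N & f = \sum_(d < K) pihomog mdeg d f.
Proof.
exists (maxn N (mmeasure mdeg f)); first exact: leq_maxl.
by apply: pihomog_partitionE; exact: leq_maxr.
Qed.

Lemma pihomog_dhomogMl d e f g : f \is e.-homog -> (e <= d)%N ->
  pihomog mdeg d (f * g) = f * pihomog mdeg (d - e) g.
Proof.
move=> hf le_ed; have [K leK Eg] := pihomog_partition d.+1 g.
rewrite {1}Eg mulr_sumr raddf_sum /=.
have ltK : (d - e < K)%N by apply: leq_trans leK; rewrite ltnS leq_subr.
rewrite (bigD1 (Ordinal ltK)) //= big1 ?addr0.
  rewrite pihomog_dE // -{2}(subnKC le_ed).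
  by apply: dhomogM => //; exact: pihomogP.
move=> i ne; apply: (pihomog_ne0 (d := (e + i)%N)); last first.
  by apply: dhomogM => //; exact: pihomogP.
by apply: contraNneq ne => E; apply/eqP/val_inj => /=; rewrite -E addKn.
Qed.

Lemma pihomog_dhomogMl_eq0 d e f g : f \is e.-homog -> (d < e)%N ->
  pihomog mdeg d (f * g) = 0.
Proof.
move=> hf lt_de; have [K _ Eg] := pihomog_partition 0 g.
rewrite {1}Eg mulr_sumr raddf_sum /= big1 // => i _.
apply: (pihomog_ne0 (d := (e + i)%N)); first by rewrite gtn_eqF // ltn_addr.
by apply: dhomogM => //; exact: pihomogP.
Qed.

Lemma pihomogM d f g : pihomog mdeg d (f * g) =
  \sum_(i < d.+1) pihomog mdeg i f * pihomog mdeg (d - i) g.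
Proof.
have [K leK Ef] := pihomog_partition d.+1 f.
rewrite {1}Ef mulr_suml raddf_sum /= (big_ord_widen K
  (fun i => pihomog mdeg i f * pihomog mdeg (d - i) g)) //.
rewrite [RHS]big_mkcond; apply: eq_bigr => i _; rewrite ltnS.
case: leqP => h; first by rewrite (pihomog_dhomogMl (e := i)) // pihomogP.
by rewrite (pihomog_dhomogMl_eq0 (e := i)) // pihomogP.
Qed.

Definition homog_part P : S -> Prop := fun f => forall d, P (pihomog mdeg d f).

Lemma homog_part_dhomog P f d :
  P 0 -> f \is d.-homog -> (homog_part P f <-> P f).
Proof.
move=> P0 hf; split=> [/(_ d)|Pf e]; first by rewrite pihomog_dE.
have [<-|ne] := eqVneq d e; last by rewrite (pihomog_ne0 ne hf).
by rewrite pihomog_dE.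
Qed.

Lemma least_component_notin P f : ~ homog_part P f ->
  exists2 a, ~ P (pihomog mdeg a f) &
    forall b, (b < a)%N -> P (pihomog mdeg b f).
Proof.
move=> /existsNP[a0 Na0].
have exN : exists a, `[< ~ P (pihomog mdeg a f) >] by exists a0; apply/asboolP.
case: (ex_minnP exN) => a /asboolP Na min_a.
exists a => // b lt_ba; apply: contrapT => Nb.
by have := min_a b (asboolT Nb); rewrite leqNgt lt_ba.
Qed.

(* If neither f nor g lies in the homogeneous part, the product of their
   first components outside P is, modulo P, a component of f * g. *)
Lemma homog_part_or P f g : prime_pred P -> homog_part P (f * g) ->
  homog_part P f \/ homog_part P g.
Proof.
move=> prP Pfg; have idP := prime_ideal_pred prP.
apply: contrapT => /not_orP[].
move=> /least_component_notin[a Na min_a] /least_component_notin[c Nc min_c].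
have lt_a : (a < (a + c).+1)%N by rewrite ltnS leq_addr.
have := Pfg (a + c)%N; rewrite pihomogM (bigD1 (Ordinal lt_a)) //= addKn.
set rest := \sum_(_ < _ | _) _ => Psum.
have Prest : P rest.
  apply: ideal_pred_sum => // i ne; case: (ltngtP i a) => [lt_ia|lt_ai|E].
  - by apply: ideal_predMr => //; exact: min_a.
  - apply: ideal_predMl => //; apply: min_c.
    by rewrite ltn_subLR ?ltn_add2r // -ltnS ltn_ord.
  - by case/eqP: ne; exact: val_inj.
suff /(prime_pred_or prP)[] : P (pihomog mdeg a f * pihomog mdeg c g) by [].
by rewrite -[X in P X](addrK rest); exact: ideal_predB.
Qed.

End HomogeneousComponents.

Lemma homog_part_prime (k : fieldType) (n : nat)
    (P : {mpoly k[n.+1]} -> Prop) i :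
  prime_pred P -> ~ P 'X_i -> homog_prime (homog_part P).
Proof.
move=> prP PXi; have idP := prime_ideal_pred prP.
have P0 := ideal_pred0 idP; split=> [d|f g Pf Pg d|f g Pg d|f g|f d Pf e|].
- by rewrite raddf0.
- by rewrite raddfD; apply: ideal_predD => //; [exact: Pf | exact: Pg].
- by rewrite pihomogM; apply: ideal_pred_sum => // j _; exact: ideal_predMl.
- exact: homog_part_or.
- have [<-|ne] := eqVneq d e; first by rewrite pihomog_id.
  by rewrite (pihomog_ne0 ne) // pihomogP.
- by exists i => /(homog_part_dhomog P0 (dhomog_X k i)).
Qed.

(** * Valuation rings *)

Section Valuation.
Variable K : fieldType.
Implicit Types (A V W : subringClosed K) (m : K -> Prop) (x y z : K).

Record subring_prime V m : Prop := SubringPrime {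
  subring_prime0 : m 0;
  subring_primeD : forall x y, m x -> m y -> m (x + y);
  subring_primeMl : forall x y, x \in V -> m y -> m (x * y);
  subring_prime_or : forall x y, x \in V -> y \in V -> m (x * y) -> m x \/ m y;
  subring_prime1 : ~ m 1 }.

Definition val_ring V := forall x, (x \in V) || (x^-1 \in V).
Definition val_max V x := (x == 0) || (x^-1 \notin V).

Lemma val_max_prime V : val_ring V -> subring_prime V (val_max V).
Proof.
move=> valV.
have mM x y : x \in V -> val_max V y -> val_max V (x * y).
  move=> Vx; case/orP=> [/eqP->|Ny]; first by rewrite mulr0 /val_max eqxx.
  have [->|x0] := eqVneq x 0; first by rewrite mul0r /val_max eqxx.
  apply/orP; right; apply: contra Ny => Vxy.
  by rewrite -[y^-1](mulVKf x0) -invfM rpredM.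
have mD x y : x != 0 -> y / x \in V -> val_max V x -> val_max V (x + y).
  move=> x0 Vyx.
  have -> : x + y = (1 + y / x) * x by rewrite mulrDl mul1r divfK.
  by apply: mM; rewrite rpredD ?rpred1.
split=> [|x y mx my|//|x y Vx Vy|].
- by rewrite /val_max eqxx.
- have [->|x0] := eqVneq x 0; first by rewrite add0r.
  have [->|y0] := eqVneq y 0; first by rewrite addr0.
  case/orP: (valV (y / x)) => Vyx; first exact: mD.
  by rewrite addrC; apply: mD => //; rewrite -invf_div.
- rewrite {1}/val_max mulf_eq0 -orbA => /or3P[x0|y0|NVxy].
  + by left; rewrite /val_max x0.
  + by right; rewrite /val_max y0.
  + have : ~~ ((x^-1 \in V) && (y^-1 \in V)).
      by apply: contra NVxy => /andP[Vx' Vy']; rewrite invfM rpredM.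
    by rewrite negb_and => /orP[N|N]; [left | right]; rewrite /val_max N orbT.
- by rewrite /val_max oner_eq0 invr1 rpred1.
Qed.

Definition adjoin V x : {pred K} :=
  fun y => `[< exists2 p, p \is a polyOver V & y = p.[x] >].

Lemma adjoin_subring V x : subring_closed (adjoin V x).
Proof.
split=> [|y z /asboolP[p Vp ->] /asboolP[q Vq ->]|
  y z /asboolP[p Vp ->] /asboolP[q Vq ->]]; apply/asboolP.
- by exists 1; rewrite ?rpred1 ?hornerC.
- by exists (p - q); rewrite ?rpredB ?hornerD ?hornerN.
- by exists (p * q); rewrite ?rpredM ?hornerM.
Qed.

HB.instance Definition _ V x :=
  GRing.isSubringClosed.Build K (adjoin V x) (adjoin_subring V x).

Lemma sub_adjoin V x : {subset V <= adjoin V x}.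
Proof.
by move=> y Vy; apply/asboolP; exists y%:P; rewrite ?polyOverC ?hornerC.
Qed.

Lemma adjoin_gen V x : x \in adjoin V x.
Proof. by apply/asboolP; exists 'X; rewrite ?polyOverX ?hornerX. Qed.

Lemma exists_maximal_subring A z : z \notin A ->
  exists V, [/\ {subset A <= V}, z \notin V &
    forall W, {subset V <= W} -> z \notin W -> {subset W <= V}].
Proof.
move=> Nz; pose rule x y w := w = x - y \/ w = x * y.
have ruleP W (x y w : K) : rule x y w -> x \in W -> y \in W -> w \in W.
  by case=> ->; [exact: rpredB | exact: rpredM].
have [] := @maximal_closed_set K rule (fun x => x = z) (fun x => x \in A).
- exact: ruleP.
- by move=> x Ax E; rewrite -E Ax in Nz.
move=> P [AP cP Pz maxP].
have cV : subring_closed (fun x => `[< P x >]).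
  split=> [|x y /asboolP Px /asboolP Py|x y /asboolP Px /asboolP Py];
    apply/asboolP.
  - exact/AP/rpred1.
  - by apply: cP Px Py; left.
  - by apply: cP Px Py; right.
pose V : subringClosed K :=
  HB.pack (fun x => `[< P x >]) (GRing.isSubringClosed.Build K _ cV).
exists V; split=> [x Ax||W VW Nz' x Wx].
- exact/asboolP/AP.
- by apply/asboolP => Pz'; exact: Pz Pz' _.
- apply/asboolP; apply: (maxP (fun x => x \in W)) Wx.
  + by move=> y Py; apply/VW/asboolP.
  + exact: ruleP.
  + by move=> y Wy E; rewrite -E Wy in Nz'.
Qed.

Section MaximalSubring.
Variables (V : subringClosed K) (z : K).
Hypotheses (Vz : z \in V) (NVz : z^-1 \notin V).
Hypothesis maxV : forall W,
  {subset V <= W} -> z^-1 \notin W -> {subset W <= V}.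

Lemma maximal_subring_inv x : x \notin V ->
  exists2 p : {poly K}, p \is a polyOver V & z^-1 = p.[x].
Proof.
move=> NVx; have : z^-1 \in adjoin V x; last by move/asboolP.
apply: contraNT NVx => Nadj.
exact: maxV (@sub_adjoin V x) Nadj x (adjoin_gen V x).
Qed.

Lemma one_sub_mul_neq0 b : b \in V -> 1 - z * b != 0.
Proof.
move=> Vb; apply: contraNneq NVz => /eqP; rewrite subr_eq0 => /eqP E.
have z0 : z != 0 by apply: contra_eq_neq E => ->; rewrite mul0r oner_eq0.
by rewrite -[z^-1]mulr1 E mulKf.
Qed.

(* z divides a power of u = 1 - z b, which is 1 modulo z. *)
Lemma one_sub_mul_inv b : b \in V -> (1 - z * b)^-1 \in V.
Proof.
move=> Vb; have u0 := one_sub_mul_neq0 Vb; set u := 1 - z * b in u0 *.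
have Vu : u \in V by rewrite rpredB ?rpred1 ?rpredM.
apply: contraNT NVz => /maximal_subring_inv[p Vp Ep].
have z0 : z != 0 by apply: contraNneq NVz => ->; rewrite invr0 rpred0.
have [v Vv Ev] : exists2 v, v \in V & u ^+ size p = z * v.
  exists (u ^+ size p * z^-1); last by rewrite mulrCA mulfV // mulr1.
  rewrite Ep horner_coef mulr_sumr rpred_sum // => i _.
  rewrite exprVn mulrCA rpredM ?(polyOverP Vp) //.
  by rewrite -expfB ?ltn_ord // rpredX.
have [w Vw Ew] : exists2 w, w \in V & u ^+ size p = 1 - z * w.
  elim: (size p) => [|m [w Vw E]]; first by exists 0;
    rewrite ?rpred0 ?mulr0 ?subr0.
  exists (w + b * u ^+ m); first by rewrite rpredD ?rpredM ?rpredX.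
  by rewrite exprS {1}/u mulrBl mul1r {1}E mulrDr opprD addrA mulrA.
have E1 : 1 = z * (v + w) by rewrite mulrDr -Ev Ew subrK.
by rewrite -[z^-1]mulr1 E1 mulKf // rpredD.
Qed.

(* The constant term of the relation in 1 / y can be made a unit, which
   expresses the power y ^+ c by lower ones and shortens the relation in y. *)
Lemma shorten_relation y c (p q : {poly K}) : y != 0 ->
    p \is a polyOver V -> q \is a polyOver V ->
    (size p <= c.+1)%N -> (size q <= c.+1)%N ->
    z^-1 = p.[y] -> z^-1 = q.[y^-1] ->
  exists2 r : {poly K}, r \is a polyOver V /\ (size r <= c)%N & z^-1 = r.[y].
Proof.
move=> y0 Vp Vq szp szq Ep Eq; have Vq0 := polyOverP Vq.
have u0 := one_sub_mul_neq0 (Vq0 0%N).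
have Vu := one_sub_mul_inv (Vq0 0%N); set u := 1 - z * q`_0 in u0 Vu.
have z0 : z != 0 by apply: contraNneq NVz => ->; rewrite invr0 rpred0.
have Eu : u = z * \sum_(i < c) q`_i.+1 * y^-1 ^+ i.+1.
  have : 1 = z * q.[y^-1] by rewrite -Eq mulfV.
  rewrite (horner_coef_wide _ szq) big_ord_recl expr0 mulr1 mulrDr /u => {1}->.
  by rewrite addrC addKr.
have Ey : y ^+ c = z * u^-1 * \sum_(i < c) q`_i.+1 * y ^+ (c - i.+1).
  rewrite -[LHS](mulKf u0) {2}Eu -!mulrA mulrCA; congr (_ * (_ * _)).
  rewrite mulr_suml; apply: eq_bigr => i _; rewrite -mulrA; congr (_ * _).
  by rewrite exprVn mulrC -expfB_cond // (negPf y0) ltn_ord.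
exists (\poly_(i < c) (p`_i + p`_c * (z * u^-1 * q`_(c - i)))).
  split; last exact: size_poly.
  apply/polyOverP => i; rewrite coef_poly; case: ifP => _; rewrite ?rpred0 //.
  by rewrite rpredD ?rpredM ?(polyOverP Vp) ?(polyOverP Vq).
rewrite Ep (horner_coef_wide _ szp) big_ord_recr /= horner_poly Ey.
rewrite (eq_bigr _ (fun i _ => mulrDl _ _ _)) big_split /=; congr (_ + _).
rewrite mulr_sumr mulr_sumr (reindex_inj rev_ord_inj) /=; apply: eq_bigr => i _.
by rewrite subnSK // subKn ?(ltnW (ltn_ord i)) // !mulrA.
Qed.

Lemma maximal_subring_valuation : val_ring V.
Proof.
pose relation (c : nat) y :=
  exists2 p : {poly K}, p \is a polyOver V /\ (size p <= c)%N & z^-1 = p.[y].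
have no_relation y : y != 0 -> forall c, relation c y -> ~ relation c y^-1.
  move=> + c; elim: c y => [|c IHc] y y0 [p [Vp szp] Ep] [q [Vq szq] Eq].
    by case/negP: NVz; rewrite Ep (size_poly_leq0P _ szp) horner0 rpred0.
  have y'0 : y^-1 != 0 by rewrite invr_eq0.
  have rel_y : relation c y by exact: shorten_relation Ep Eq.
  apply: (IHc y y0 rel_y); apply: (shorten_relation y'0 Vq Vp szq szp Eq).
  by rewrite invrK.
move=> x; have [->|x0] := eqVneq x 0; first by rewrite rpred0.
apply: contraT; rewrite negb_or => /andP[].
move=> /maximal_subring_inv[p Vp Ep] /maximal_subring_inv[q Vq Eq].
case: (no_relation x x0 (maxn (size p) (size q))).
- by exists p; rewrite ?leq_maxl.
- by exists q; rewrite ?leq_maxr.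
Qed.

End MaximalSubring.

Lemma chevalley A z : z \in A -> z^-1 \notin A ->
  exists V, [/\ val_ring V, {subset A <= V} & z^-1 \notin V].
Proof.
move=> Az NAz; have [V [AV NVz maxV]] := exists_maximal_subring NAz.
exists V; split=> //; apply: maximal_subring_valuation (AV z Az) NVz maxV.
Qed.

End Valuation.

(** * Charts of projective space and centres of valuations *)

Section ChartEval.
Variables (k K : fieldType) (n : nat).
Local Notation S := {mpoly k[n.+1]}.
Variables (phi : {rmorphism S -> K}) (i0 : 'I_n.+1).
Implicit Types (f g : S) (d : nat) (m : K -> Prop).

(* Dehomogenisation: the value of f at the point with coordinates x_j / x_i0. *)
Definition chart_eval : S -> K :=
  mmap (phi \o @mpolyC n.+1 k) (fun j => phi 'X_j / phi 'X_i0).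
HB.instance Definition _ := GRing.RMorphism.on chart_eval.

Lemma chart_evalX j : chart_eval 'X_j = phi 'X_j / phi 'X_i0.
Proof. by rewrite /chart_eval mmapX mmap1U. Qed.

Lemma chart_eval_subring (V : subringClosed K) f :
    (forall c : k, phi c%:MP \in V) ->
    (forall j, phi 'X_j / phi 'X_i0 \in V) ->
  chart_eval f \in V.
Proof.
move=> Vk VX; rewrite /chart_eval /mmap rpred_sum // => m _.
by rewrite rpredM ?rpred_prod //= => j _; rewrite rpredX.
Qed.

Hypothesis phi_i0 : phi 'X_i0 != 0.

Lemma dhomog_chart_eval f d : f \is d.-homog ->
  phi f = phi 'X_i0 ^+ d * chart_eval f.
Proof.
move=> /dhomogP hf.
rewrite {1}(mpolyE f) rmorph_sum /chart_eval /mmap mulr_sumr.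
rewrite big_seq [RHS]big_seq; apply: eq_bigr => m m_f.
rewrite -mul_mpolyC rmorphM /= mulrCA; congr (_ * _).
have <- : mdeg m = d := hf m m_f.
rewrite mpolyXE_id rmorph_prod /mmap1 mdegE -prodrXr -big_split /=.
by apply: eq_bigr => j _; rewrite rmorphXn -exprMn mulrC divfK.
Qed.

Lemma chart_eval_dhomog f d : f \is d.-homog ->
  chart_eval f = phi f / phi ('X_i0 ^+ d).
Proof.
by move=> hf; rewrite (dhomog_chart_eval hf) rmorphXn mulrC mulKf ?expf_neq0.
Qed.

Lemma chart_eval_ratio a b d : a \is d.-homog -> b \is d.-homog ->
  phi a / phi b = chart_eval a / chart_eval b.
Proof.
move=> ha hb; rewrite (dhomog_chart_eval ha) (dhomog_chart_eval hb).
by rewrite -mulf_div divff ?mul1r // expf_neq0.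
Qed.

Lemma chart_eval_eq0 f d : f \is d.-homog -> (chart_eval f == 0) = (phi f == 0).
Proof.
by move=> hf; rewrite (dhomog_chart_eval hf) mulf_eq0 (negPf (expf_neq0 _ _)).
Qed.

Definition chart_prime m : S -> Prop := homog_part (fun f => m (chart_eval f)).

Lemma chart_prime_dhomog (V : subringClosed K) m f d :
  subring_prime V m -> f \is d.-homog -> (chart_prime m f <-> m (chart_eval f)).
Proof.
by move=> prm; apply: homog_part_dhomog; rewrite rmorph0;
  exact: subring_prime0 prm.
Qed.

Lemma chart_primeP (V : subringClosed K) m : subring_prime V m ->
  (forall f, chart_eval f \in V) -> homog_prime (chart_prime m).
Proof.
move=> prm Vev; apply: (homog_part_prime (i := i0)).
  split=> [|f g]; last by rewrite rmorphM; apply: (subring_prime_or prm).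
  split=> [|f g mf mg|f g mg].
  - by rewrite rmorph0; exact: subring_prime0 prm.
  - by rewrite rmorphD; exact: (subring_primeD prm).
  - by rewrite rmorphM; exact: (subring_primeMl prm).
by rewrite chart_evalX divff //; exact: subring_prime1 prm.
Qed.

Lemma chart_prime_ker (V : subringClosed K) m f : subring_prime V m ->
  (forall d, phi (pihomog mdeg d f) = 0) -> chart_prime m f.
Proof.
move=> prm fker d; rewrite (chart_eval_dhomog (pihomogP _ _ _)) fker mul0r.
exact: subring_prime0 prm.
Qed.

End ChartEval.

Section Center.
Variables (k K : fieldType) (n : nat) (phi : {rmorphism {mpoly k[n.+1]} -> K}).

Lemma exists_val_chart (V : subringClosed K) : val_ring V ->
  (exists i, phi 'X_i != 0) ->
  exists2 i0, phi 'X_i0 != 0 & forall j, phi 'X_j / phi 'X_i0 \in V.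
Proof.
move=> valV [i Xi]; suff [i0 Xi0 H] : exists2 i0, phi 'X_i0 != 0 &
    forall j, j \in enum 'I_n.+1 -> phi 'X_j / phi 'X_i0 \in V.
  by exists i0 => // j; apply: H; rewrite mem_enum.
elim: (enum _) => [|j s [i1 Xi1 Vs]]; first by exists i.
have [Vj|NVj] := boolP (phi 'X_j / phi 'X_i1 \in V).
  by exists i1 => // l; rewrite inE => /orP[/eqP->|/Vs].
have Xj : phi 'X_j != 0 by apply: contraNneq NVj => ->; rewrite mul0r rpred0.
exists j => // l; rewrite inE => /orP[/eqP->|/Vs Vl];
  first by rewrite divff ?rpred1.
have := valV (phi 'X_j / phi 'X_i1); rewrite (negPf NVj) invf_div /= => Vij.
by have := rpredM Vl Vij; rewrite mulrA divfK.
Qed.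

Definition poly_image (iota : {rmorphism k -> K}) z : {pred K} :=
  fun x => `[< exists g : {poly k}, x = (map_poly iota g).[z] >].

Lemma poly_image_subring iota z : subring_closed (poly_image iota z).
Proof.
split=> [|x y /asboolP[p ->] /asboolP[q ->]|x y /asboolP[p ->] /asboolP[q ->]];
  apply/asboolP.
- by exists 1; rewrite rmorph1 hornerC.
- by exists (p - q); rewrite rmorphB hornerD hornerN.
- by exists (p * q); rewrite rmorphM hornerM.
Qed.

HB.instance Definition _ iota z :=
  GRing.isSubringClosed.Build K (poly_image iota z) (poly_image_subring iota z).

(* The centre q of a valuation ring that contains z but not 1 / z. *)
Lemma exists_center (z : K) : (exists i, phi 'X_i != 0) ->
    (forall g : {poly k}, z^-1 != (map_poly (phi \o @mpolyC _ k) g).[z]) ->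
  exists q : {mpoly k[n.+1]} -> Prop, [/\ homog_prime q,
    forall f, (forall d, phi (pihomog mdeg d f) = 0) -> q f,
    forall d a b, a \is d.-homog -> b \is d.-homog -> ~ q b ->
      z^-1 != phi a / phi b
  & forall d a b, a \is d.-homog -> b \is d.-homog -> phi b != 0 ->
      z = phi a / phi b -> q a].
Proof.
move=> Xi Nz; pose A := poly_image (phi \o @mpolyC _ k) z.
have Az : z \in A by apply/asboolP; exists 'X; rewrite map_polyX hornerX.
have NAz : z^-1 \notin A by apply/asboolP => -[g E]; have := Nz g;
  rewrite {1}E eqxx.
have [V [valV AV NVz]] := chevalley Az NAz.
have [i0 Xi0 VX] := exists_val_chart valV Xi.
have prm := val_max_prime valV; have Vz := AV z Az.
have Vev f : chart_eval phi i0 f \in V.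
  apply: chart_eval_subring => // c; apply/AV/asboolP.
  by exists c%:P; rewrite map_polyC hornerC.
have qP f d : f \is d.-homog -> _ := chart_prime_dhomog phi i0 prm.
exists (chart_prime phi i0 (val_max V)); split=> [|f|d a b ha hb /(qP b d hb)|
  d a b ha hb b0 Ez].
- exact: (chart_primeP Xi0 prm Vev).
- exact: (chart_prime_ker Xi0 prm).
- rewrite (chart_eval_ratio Xi0 ha hb) => Nqb; apply: contraNneq NVz => ->.
  rewrite rpredM //; apply: contraT => NVb; case: Nqb.
  by rewrite /val_max NVb orbT.
- apply/(qP a d ha); have {b0} b0 : chart_eval phi i0 b != 0.
    by rewrite (chart_eval_eq0 Xi0 hb).
  have -> : chart_eval phi i0 a = chart_eval phi i0 b * z.
    by rewrite Ez (chart_eval_ratio Xi0 ha hb) mulrC divfK.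
  by apply: (subring_primeMl prm) => //; rewrite /val_max NVz orbT.
Qed.

End Center.

(** * Powers of the cardinality of a finite field *)

Lemma finType_pigeonhole (T : finType) (F : nat -> T) :
  exists a b, (a < b)%N /\ F a = F b.
Proof.
have : ~~ injectiveb (fun i : 'I_#|T|.+1 => F i).
  by apply/injectiveP => /leq_card; rewrite card_ord ltnn.
move=> /injectivePn[a [b ne E]].
case: (ltngtP a b) => [lt|lt|/val_inj/eqP]; last by rewrite (negPf ne).
  by exists a, b.
by exists b, a.
Qed.

Section FiniteBase.
Variable k : finFieldType.

Lemma pnat_card_pchar (R : comNzRingType) (iota : {rmorphism k -> R}) :
  [pchar R].-nat #|k|.
Proof.
have [p p_pr pk] := finPcharP k.
rewrite (eq_pnat _ (pcharf_eq (rmorph_pchar iota pk))).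
by have := card_pprimeChar pk; rewrite -/(#|k|) => ->; rewrite pnatX pnat_id.
Qed.

Definition card_power (Q : nat) := exists2 r, (0 < r)%N & Q = (#|k| ^ r)%N.

Lemma card_power_gt1 Q : card_power Q -> (1 < Q)%N.
Proof.
move=> [r r0 ->]; apply: (@leq_trans (#|k| ^ 1)%N).
  by rewrite expn1 finNzRing_gt1.
by apply: leq_pexp2l => //; rewrite ltnW ?finNzRing_gt1.
Qed.

Lemma expf_card_power Q (c : k) : card_power Q -> c ^+ Q = c.
Proof.
move=> [r _ ->]; elim: r => [|r IHr]; first by rewrite expr1.
by rewrite expnSr exprM IHr expf_card.
Qed.

Lemma pnat_card_power (R : comNzRingType) (iota : {rmorphism k -> R}) Q :
  card_power Q -> [pchar R].-nat Q.
Proof. by move=> [r _ ->]; rewrite pnatX (pnat_card_pchar iota). Qed.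

Lemma expr_card_power_mul (R : pzSemiRingType) (y : R) r m :
  y ^+ (#|k| ^ r) = y -> y ^+ (#|k| ^ (r * m)) = y.
Proof.
by move=> E; elim: m => [|m IHm]; rewrite ?muln0 ?expr1 // mulnS expnD exprM E.
Qed.

Lemma common_card_power (R : pzSemiRingType) (J : finType) (y : J -> R) :
  (forall j, exists2 Q, card_power Q & y j ^+ Q = y j) ->
  exists2 Q, card_power Q & forall j, y j ^+ Q = y j.
Proof.
move=> fixed; suff [r r0 fixed_r] : exists2 r, (0 < r)%N &
    forall j, j \in enum J -> y j ^+ (#|k| ^ r) = y j.
  by exists (#|k| ^ r)%N => [|j]; [exists r | rewrite fixed_r ?mem_enum].
elim: (enum J) => [|j s [r r0 fixed_r]]; first by exists 1%N.
have [_ [r' r'0 ->] fixed_j] := fixed j.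
exists (r * r')%N; first by rewrite muln_gt0 r0.
move=> l; rewrite inE => /orP[/eqP->|/fixed_r]; last exact: expr_card_power_mul.
by rewrite mulnC; exact: expr_card_power_mul.
Qed.

Variables (K : fieldType) (iota : {rmorphism k -> K}).

Lemma expf_eq1_of_inv_poly (z : K) (g : {poly k}) : z != 0 ->
  z^-1 = (map_poly iota g).[z] -> exists2 M, (0 < M)%N & z ^+ M = 1.
Proof.
move=> z0 Eg; pose P : {poly k} := 'X * g - 1.
have Pz : (map_poly iota P).[z] = 0.
  rewrite rmorphB rmorphM rmorph1 /= map_polyX hornerD hornerN hornerC.
  by rewrite hornerM hornerX -Eg mulfV ?subrr.
have P0 : P != 0.
  apply: contraTneq (oner_neq0 k) => /(congr1 (fun p : {poly k} => p`_0)).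
  by rewrite coefB coefXM coef1 coef0 sub0r => /eqP; rewrite oppr_eq0 => ->.
have powE j : z ^+ j = (map_poly iota ('X^j %% P)).[z].
  transitivity (map_poly iota 'X^j).[z]; first by rewrite map_polyXn hornerXn.
  by rewrite {1}(divp_eq 'X^j P) rmorphD rmorphM hornerD hornerM Pz mulr0 add0r.
have [a [b [lt_ab E]]] :=
  finType_pigeonhole (fun j => poly_rV ('X^j %% P) : 'rV[k]_(size P)).
have {}E : 'X^a %% P = 'X^b %% P.
  have size_mod (p : {poly k}) : (size (p %% P)%R <= size P)%N.
    by rewrite ltnW ?ltn_modp.
  by rewrite -(poly_rV_K (size_mod 'X^a)) -(poly_rV_K (size_mod 'X^b)) E.
exists (b - a)%N; first by rewrite subn_gt0.
by rewrite expfB // !powE E divff // -powE expf_neq0.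
Qed.

Lemma card_power_of_expf_eq1 (z : K) M : (0 < M)%N -> z ^+ M = 1 ->
  exists2 Q, card_power Q & z ^+ Q = z.
Proof.
move=> M0 zM.
have [a [b [lt_ab E]]] :=
  finType_pigeonhole (fun j => Ordinal (ltn_pmod (#|k| ^ j) M0)).
have {E} : z ^+ (#|k| ^ a) = z ^+ (#|k| ^ b).
  have expr_modM j : z ^+ j = z ^+ (j %% M).
    by rewrite {1}(divn_eq j M) exprD mulnC exprM zM expr1n mul1r.
  by rewrite expr_modM [RHS]expr_modM; have /= -> := congr1 val E.
rewrite -(subnK (ltnW lt_ab)) expnD exprM => /esym/eqP; rewrite -subr_eq0 => E.
exists (#|k| ^ (b - a))%N; first by exists (b - a)%N; rewrite ?subn_gt0.
have pchar_pow j : [pchar K].-nat (#|k| ^ j)%N.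
  by rewrite pnatX (pnat_card_pchar iota).
have : (z ^+ (#|k| ^ (b - a)) - z) ^+ (#|k| ^ a) == 0.
  by rewrite exprDn_pchar // exprNn_pchar.
by rewrite expf_eq0 => /andP[_]; rewrite subr_eq0 => /eqP.
Qed.

End FiniteBase.

(** * Points and local rings *)

Section ProjPoints.
Variables (k : fieldType) (n : nat) (T : {mpoly k[n.+1]} -> Prop).
Local Notation S := {mpoly k[n.+1]}.
Implicit Types (p q : proj_point T) (f g : S).

Lemma pt_prime_pred p : prime_pred p.
Proof.
by have [p0 pD pM pP _ _] := pt_prime p. Qed.

Lemma pt0 p : p 0. Proof. exact: hp_0 (pt_prime p).
Qed.
Lemma ptD p f g : p f -> p g -> p (f + g).
Proof. exact: hp_add (pt_prime p) _ _. Qed.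
Lemma ptMl p f g : p g -> p (f * g). Proof. exact: hp_mul (pt_prime p) _ _. Qed.
Lemma ptMr p f g : p f -> p (f * g). Proof. by rewrite mulrC; exact: ptMl. Qed.
Lemma ptM p f g : p (f * g) -> p f \/ p g.
Proof. exact: hp_prime (pt_prime p) _ _. Qed.
Lemma ptB p f g : p f -> p g -> p (f - g).
Proof. exact: ideal_predB (prime_ideal_pred (pt_prime_pred p)). Qed.
Lemma pt1 p : ~ p 1.
Proof.
have [i Xi] := hp_relevant (pt_prime p).
by move=> p1; apply: Xi; rewrite -['X_i]mulr1; exact: ptMl.
Qed.
Lemma ptX p f m : p (f ^+ m) -> p f.
Proof. by elim: m => [/pt1//|m IHm]; rewrite exprS => /ptM[]. Qed.
Lemma ptXn p f m : (0 < m)%N -> p f -> p (f ^+ m).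
Proof.
by case: m => // m _ pf; rewrite exprS; exact: ptMr. Qed.
Lemma pt_nX p f m : ~ p f -> ~ p (f ^+ m). Proof. by move=> ? /ptX.
Qed.

Lemma pt_pihomog p f d : p f -> p (pihomog mdeg d f).
Proof. exact: hp_homog (pt_prime p) _ _. Qed.

Lemma pt_components p f : (forall d, p (pihomog mdeg d f)) -> p f.
Proof.
have [N _ {2}->] := pihomog_partition 0 f => pf.
by apply: ideal_pred_sum (prime_ideal_pred (pt_prime_pred p)) _ => d _.
Qed.

Lemma point_ext p q : (forall f, p f <-> q f) -> p = q.
Proof.
case: p q => p pp pa [q qp qa] /= E.
have {}E : p = q by apply/funext => f; apply/propext.
by case: q / E qp qa => qp qa; congr ProjPoint; exact: Prop_irrelevance.
Qed.

Lemma point_dhomog_ext p q :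
  (forall d f, f \is d.-homog -> (p f <-> q f)) -> p = q.
Proof.
move=> E; apply: point_ext => f.
by split=> pf; apply: pt_components => d; apply/(E d);
  rewrite ?pihomogP //; exact: pt_pihomog.
Qed.

Definition pt_pred p : pred S := fun f => `[< p f >].

Lemma pt_pred_ideal p : idealr_closed (pt_pred p).
Proof.
split=> [||a f g /asboolP pf /asboolP pg]; first exact/asboolP/pt0.
  by apply/negP => /asboolP/pt1.
by apply/asboolP/ptD => //; exact: ptMl.
Qed.

Lemma pt_pred_prime p : prime_idealr_closed (pt_pred p).
Proof.
by move=> f g /asboolP/ptM[] h; apply/orP; [left|right]; apply/asboolP.
Qed.

HB.instance Definition _ p := isIdealr.Build S (pt_pred p) (pt_pred_ideal p).
HB.instance Definition _ p :=
  isPrimeIdealrClosed.Build S (pt_pred p) (@pt_pred_prime p).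

Definition cone_residue_field p : fieldType :=
  projT1 (frac_quot (PrimeIdealr.clone S (pt_pred p) _)).
Definition residue_map p : {rmorphism S -> cone_residue_field p} :=
  sval (projT2 (frac_quot (PrimeIdealr.clone S (pt_pred p) _))).

Lemma residue_mapP p f : residue_map p f = 0 <-> p f.
Proof.
have res0 : (residue_map p f == 0) = `[< p f >].
  exact: (svalP (projT2 (frac_quot (PrimeIdealr.clone S (pt_pred p) _)))).1.
by split=> [/eqP|pf];
  [rewrite res0 => /asboolP | apply/eqP; rewrite res0; apply/asboolP].
Qed.

Lemma residue_map_neq0 p f : ~ p f -> residue_map p f != 0.
Proof. by move=> pf; apply/eqP => /residue_mapP. Qed.

Lemma residue_chart_dhomog p i0 f d : ~ p 'X_i0 -> f \is d.-homog ->
  (p f <-> chart_eval (residue_map p) i0 f = 0).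
Proof.
move=> /residue_map_neq0 Xi0 hf; rewrite -residue_mapP.
by split=> /eqP;
  [rewrite -(chart_eval_eq0 Xi0 hf) | rewrite (chart_eval_eq0 Xi0 hf)];
  move/eqP.
Qed.

End ProjPoints.

(* An ideal without projective zeros contains a power of each coordinate. *)
Lemma coordinate_power_in_ideal (k : fieldType) (n : nat)
    (T A : {mpoly k[n.+1]} -> Prop) i :
    ideal_pred A -> (forall f d, T f -> A (pihomog mdeg d f)) ->
    (forall q : proj_point T, exists (d : nat) (h : {mpoly k[n.+1]}),
      [/\ h \is d.-homog, ~ q h & A h]) ->
  exists N, A ('X_i ^+ N).
Proof.
move=> idA TA nozero; apply: contrapT => /forallNP NX.
have [P prP [AP PXi]] := prime_avoiding_powers idA NX.
pose q : proj_point T := ProjPoint (homog_part_prime prP PXi)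
  (fun f Tf d => AP _ (TA f d Tf)).
have [d [h [hh qh Ah]]] := nozero q; apply: qh => /=.
by apply/(homog_part_dhomog (ideal_pred0 (prime_ideal_pred prP)) hh);
  exact: (AP h Ah).
Qed.

Section LocalRing.
Variables (k : fieldType) (X : proj_variety k).
Local Notation I := (var_ideal X).
Local Notation S := {mpoly k[(amb_dim X).+1]}.
Local Notation kappa := (@cone_elt k X).
Implicit Types (p : point X) (f g : S) (z w t u : cone_field X).

Lemma cone_elt_eq (f g : S) : (kappa f == kappa g) = (f - g \in I).
Proof. by rewrite -subr_eq0 -rmorphB cone_elt_eq0. Qed.

Lemma cone_elt_pihomog_eq0 f d : f \in I -> kappa (pihomog mdeg d f) = 0.
Proof. by move=> If; apply/eqP; rewrite cone_elt_eq0 var_homog. Qed.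

Lemma pt_cone_eq p f g : kappa f = kappa g -> (p f <-> p g).
Proof.
move=> /eqP; rewrite cone_elt_eq => /(pt_above p) pfg.
by split=> pf; [rewrite -[g](subKr f) | rewrite -[f](subrK g)];
  [exact: ptB | exact: ptD].
Qed.

Lemma dhomog_regular p d (a b : S) :
  a \is d.-homog -> b \is d.-homog -> ~ p b ->
  regular_at p (kappa a / kappa b).
Proof. by move=> ha hb pb; exists d, a, b. Qed.

Lemma dhomog_vanishing p d (a b : S) :
  a \is d.-homog -> b \is d.-homog -> ~ p b ->
  vanishing_at p (kappa a / kappa b) <-> p a.
Proof.
move=> ha hb pb; split=> [|pa]; last by exists d, a, b.
move=> [e [a' [b' [ha' hb' pa' pb' E]]]].
have Ecross : kappa (a * b') = kappa (a' * b).
  by apply/eqP; rewrite !rmorphM -eqr_div ?(pt_cone pb) ?(pt_cone pb') // E.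
have : p (a * b') by apply/(pt_cone_eq p Ecross); exact: ptMr.
by case/ptM.
Qed.

Lemma vanishing_regular p z : vanishing_at p z -> regular_at p z.
Proof. by move=> [d [a [b [ha hb pa pb ->]]]]; exists d, a, b. Qed.

Lemma vanishingMl p z w :
  regular_at p z -> vanishing_at p w -> vanishing_at p (z * w).
Proof.
move=> [d [a [b [ha hb pb ->]]]] [e [a' [b' [ha' hb' pa' pb' ->]]]].
exists (d + e)%N, (a * a'), (b * b'); split; try exact: dhomogM.
- exact: ptMl.
- exact: pt_nmul.
- by rewrite !rmorphM mulf_div.
Qed.

Lemma vanishing_neq1 p : ~ vanishing_at p 1.
Proof.
rewrite -[1]divr1 -(rmorph1 kappa);
  have h1 : (1 : S) \is 0.-homog by exact: dhomog1.
by move=> /(dhomog_vanishing h1 h1 (@pt1 _ _ _ p)); exact: pt1.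
Qed.

Lemma unit_or_vanishing p z : regular_at p z -> unit_at p z \/ vanishing_at p z.
Proof.
move=> [d [a [b [ha hb pb ->]]]]; have [pa|pa] := pselect (p a).
  by right; exists d, a, b.
left; split.
- by rewrite mulf_neq0 ?invr_eq0 ?(pt_cone pa) ?(pt_cone pb).
- by exists d, a, b.
- by exists d, b, a; rewrite invf_div.
Qed.

Lemma unit_not_vanishing p u : unit_at p u -> ~ vanishing_at p u.
Proof.
move=> [u0 _ ruV] /(vanishingMl ruV); rewrite mulVf //; exact: vanishing_neq1.
Qed.

Lemma unit_atV p z : unit_at p z -> unit_at p z^-1.
Proof. by move=> /(unit_at_div (unit_at1 p)); rewrite div1r. Qed.

Lemma unit_atM p z w : unit_at p z -> unit_at p w -> unit_at p (z * w).
Proof. by move=> uz /unit_atV/(unit_at_div uz); rewrite invrK. Qed.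

Lemma unit_atX p z m : unit_at p z -> unit_at p (z ^+ m).
Proof.
move=> uz; elim: m => [|m IHm]; first exact: unit_at1.
by rewrite exprS; exact: unit_atM.
Qed.

Lemma unit_at_exprz p z (m : int) : unit_at p z -> unit_at p (z ^ m).
Proof. by case: m => m uz; [|apply: unit_atV]; exact: unit_atX. Qed.

Lemma unit_at_inverse p z w :
  regular_at p z -> regular_at p w -> w * z = 1 -> unit_at p z.
Proof.
move=> rz rw E; have z0 : z != 0.
  by apply: contra_eq_neq E => ->; rewrite mulr0 eq_sym oner_eq0.
by split=> //; rewrite -[z^-1]mul1r -E mulfK.
Qed.

Definition local_ring p : {pred cone_field X} := fun z => `[< regular_at p z >].

Lemma local_ringP p z : reflect (regular_at p z) (z \in local_ring p).
Proof. exact: asboolP. Qed.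

Lemma local_ring_subring p : subring_closed (local_ring p).
Proof.
by split=>
  [|z w /local_ringP rz /local_ringP rw|z w /local_ringP rz /local_ringP rw];
  apply/local_ringP; [exact: regular1 | exact: regularB | exact: regularM].
Qed.

HB.instance Definition _ p :=
  GRing.isSubringClosed.Build _ (local_ring p) (local_ring_subring p).

Section Chart.
Variables (p : point X) (i0 : 'I_(amb_dim X).+1).
Hypothesis pi0 : ~ p 'X_i0.
Local Notation ev := (chart_eval kappa i0).
Let Xi0 : kappa 'X_i0 != 0 := pt_cone pi0.

Lemma chart_eval_regular f : ev f \in local_ring p.
Proof.
apply: chart_eval_subring => [c|j]; apply/local_ringP.
  have hc : (c%:MP : S) \is 0.-homog by rewrite -alg_mpolyC rpredZ ?dhomog1.
  rewrite -[kappa _]divr1 -(rmorph1 kappa).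
  by apply: dhomog_regular hc _ (@pt1 _ _ _ p); exact: dhomog1.
exact: dhomog_regular (dhomog_X k j) (dhomog_X k i0) pi0.
Qed.

Lemma chart_eval_ideal f : f \in I -> ev f = 0.
Proof.
move=> If; have [N _ ->] := pihomog_partition 0 f.
rewrite rmorph_sum big1 // => d _ /=.
by rewrite (chart_eval_dhomog Xi0 (pihomogP _ _ _)) cone_elt_pihomog_eq0 ?mul0r.
Qed.

Lemma chart_eval_vanishing f d : f \is d.-homog ->
  vanishing_at p (ev f) <-> p f.
Proof.
move=> hf; rewrite (chart_eval_dhomog Xi0 hf).
by apply: dhomog_vanishing hf (dhomog_Xn k i0 d) _; exact: pt_nX.
Qed.

Lemma chart_eval_unit f d : f \is d.-homog -> ~ p f -> unit_at p (ev f).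
Proof.
move=> hf pf.
case: (unit_or_vanishing (local_ringP _ _ (chart_eval_regular f))) => //.
by move/(chart_eval_vanishing hf).
Qed.

End Chart.

Lemma uniformizer_neq0 p t : uniformizer p t -> t != 0.
Proof. by case. Qed.

Lemma uniformizer_vanishing p t : uniformizer p t -> vanishing_at p t.
Proof. by case. Qed.

Lemma unit_at_uniformizer_div p t t' :
  uniformizer p t -> uniformizer p t' -> unit_at p (t / t').
Proof.
move=> [t0 vt t_div] [t'0 vt' t'_div].
have [w rw Ew] := t'_div t vt; have [w' rw' Ew'] := t_div t' vt'.
rewrite Ew mulfK //; apply: (unit_at_inverse rw rw').
by apply: (mulIf t'0); rewrite -mulrA -Ew -Ew' mul1r.
Qed.

Lemma has_order_uniformizer p z (m : int) t u :
  uniformizer p t -> unit_at p u -> z = t ^ m * u -> has_order p z m.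
Proof.
move=> ut uu -> t' ut'; exists ((t / t') ^ m * u).
  by apply: unit_atM => //; apply/unit_at_exprz/unit_at_uniformizer_div.
by rewrite mulrA -expfzMl [t' * _]mulrC divfK ?(uniformizer_neq0 ut').
Qed.

Definition infinitely_divisible p t z :=
  forall m, exists2 w, w \in local_ring p & z = w * t ^+ m.

Lemma uniformizer_power_or_divisible p t z :
  uniformizer p t -> regular_at p z ->
  (exists (m : nat) u, unit_at p u /\ z = t ^+ m * u) \/
  infinitely_divisible p t z.
Proof.
move=> [t0 vt t_div] rz.
have [|none] := pselect (exists (m : nat) u, unit_at p u /\ z = t ^+ m * u).
  by left.
right; elim=> [|m [w /local_ringP rw E]].
  by exists z; [exact/local_ringP | rewrite mulr1].
case: (unit_or_vanishing rw) => [uw|/t_div[w' rw' Ew]].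
  by case: none; exists m, w; rewrite mulrC.
by exists w'; [exact/local_ringP | rewrite E Ew exprS mulrA].
Qed.

Lemma infinitely_divisible_prime p t :
  uniformizer p t -> subring_prime (local_ring p) (infinitely_divisible p t).
Proof.
move=> ut; have t0 := uniformizer_neq0 ut; have vt := uniformizer_vanishing ut.
split=> [m|z w dz dw m|z w rz dw m|z w|/(_ 1%N)[w rw E]].
- by exists 0; rewrite ?rpred0 ?mul0r.
- have [v rv ->] := dz m; have [v' rv' ->] := dw m.
  by exists (v + v'); rewrite ?rpredD ?mulrDl.
- by have [v rv ->] := dw m; exists (z * v); rewrite ?rpredM ?mulrA.
- move=> /local_ringP rz /local_ringP rw dzw.
  case: (uniformizer_power_or_divisible ut rz) => [[a [u [uu Ez]]]|];
    last by left.
  case: (uniformizer_power_or_divisible ut rw) => [[b [v [uv Ew]]]|];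
    last by right.
  have [x /local_ringP rx Ex] := dzw (a + b).+1; exfalso.
  apply: (unit_not_vanishing (unit_atM uu uv)).
  have -> : u * v = x * t; last exact: vanishingMl.
  apply: (mulIf (expf_neq0 (a + b) t0)).
  by rewrite -[RHS]mulrA -exprS -Ex Ez Ew exprD [RHS]mulrACA mulrC.
- by apply: (@vanishing_neq1 p); rewrite E; apply: vanishingMl => //;
    exact/local_ringP.
Qed.

Lemma infinitely_divisible_vanishing p t z :
  uniformizer p t -> infinitely_divisible p t z -> vanishing_at p z.
Proof.
move=> ut /(_ 1%N)[w /local_ringP rw ->].
by apply: vanishingMl => //; exact: uniformizer_vanishing.
Qed.

Lemma uniformizer_not_infinitely_divisible p t :
  uniformizer p t -> ~ infinitely_divisible p t t.
Proof.
move=> ut /(_ 2%N)[w /local_ringP rw E]; have t0 := uniformizer_neq0 ut.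
apply: (@vanishing_neq1 p); have -> : 1 = w * t.
  by apply: (mulIf t0); rewrite mul1r {1}E expr2 mulrA.
by apply: vanishingMl => //; exact: uniformizer_vanishing.
Qed.

End LocalRing.

(** * Cramer's rule modulo an ideal *)

Lemma row'_submx (K : fieldType) (m p n : nat) (M : 'M[K]_(m, n))
    (N : 'M[K]_(p, n)) i :
  (row i M <= N)%MS -> (row' i M <= N)%MS -> (M <= N)%MS.
Proof.
move=> Ni N'i; apply/row_subP => s; case: (unliftP i s) => [j ->|-> //].
by apply: submx_trans N'i; rewrite -row_rowsub row_sub.
Qed.

Lemma exists_row'_rank (K : fieldType) (m n : nat) (M : 'M[K]_(m.+1, n)) :
  (m <= \rank M)%N -> exists i, \rank (row' i M) = m.
Proof.
move=> rkM; suff [i rk_i] : exists i, (m <= \rank (row' i M))%N.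
  by exists i; apply/eqP; rewrite eqn_leq rank_leq_row.
have [free|/row_freePn[i Mi]] := boolP (row_free M).
  exists ord0; rewrite -ltnS; move: (eqP free) => {1}<-.
  have sub : (M <= row ord0 M + row' ord0 M)%MS.
    by apply: (row'_submx (i := ord0)); [exact: addsmxSl | exact: addsmxSr].
  apply: leq_trans (mxrankS sub) (leq_trans (mxrank_adds_leqif _ _) _).
  by rewrite -[X in (_ <= X)%N]add1n leq_add2r rank_leq_row.
exists i; apply: leq_trans rkM (mxrankS _).
exact: row'_submx Mi (submx_refl _).
Qed.

Lemma exists_col'_full (K : fieldType) (m n : nat) (M : 'M[K]_(m, n.+1)) :
  (n <= \rank M)%N -> exists j, row_full (col' j M).
Proof.
rewrite -mxrank_tr => /exists_row'_rank[j rk_j]; exists j.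
by rewrite /row_full -mxrank_tr tr_col' rk_j.
Qed.

Lemma cramer_mod_ideal (R : comNzRingType) (A : R -> Prop) (K : fieldType)
    (phi : {rmorphism R -> K}) (m n : nat) (H : 'M[R]_(m, n)) (g : 'cV[R]_n) :
    ideal_pred A -> (forall s, A ((H *m g) s 0)) ->
    (0 < n)%N -> (n.-1 <= \rank (map_mx phi H))%N ->
  exists2 delta, phi delta != 0 &
    exists j0, forall j, exists w, A (delta * g j 0 - w * g j0 0).
Proof.
case: n H g => // n H g idA AHg _ /= rkH.
have [j0 full] : exists j0 : 'I_n.+1, row_full (col' j0 (map_mx phi H)).
  exact: exists_col'_full.
rewrite -map_col' in full; set B := col' j0 H in full.
pose D := rowsub (fullrankfun full) B; exists (\det D).
  by rewrite -det_map_mx -unitfE -unitmxE map_mxsub; exact: fullrowsub_unit.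
exists j0 => j; case: (unliftP j0 j) => [l ->|->]; last first.
  by exists (\det D); rewrite subrr; exact: ideal_pred0 idA.
pose u := rowsub (fullrankfun full) (col j0 H); exists (- (\adj D *m u) l 0).
have -> : \det D * g (fintype.lift j0 l) 0 - - (\adj D *m u) l 0 * g j0 0 =
    (\adj D *m rowsub (fullrankfun full) (H *m g)) l 0.
  have -> : rowsub (fullrankfun full) (H *m g) = D *m row' j0 g + g j0 0 *: u.
    apply/matrixP => s z; rewrite !mxE (bigD1_ord j0) //= addrC ord1;
      congr (_ + _).
      by apply: eq_bigr => i _; rewrite !mxE.
    by rewrite mulrC.
  rewrite mulmxDr mulmxA mul_adj_mx mul_scalar_mx -scalemxAr mulNr opprK.
  by rewrite mulrC [_ * g j0 0]mulrC !mxE mulrC.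
rewrite mxE; apply: ideal_pred_sum => // s _; apply: ideal_predMl => //.
by rewrite mxE.
Qed.

(** * The forms x_j^Q - x_j x_i0^(Q-1) *)

Section FrobeniusForms.
Variables (k : finFieldType) (n : nat) (i0 : 'I_n.+1) (Q : nat).
Local Notation S := {mpoly k[n.+1]}.
Hypothesis Q_pow : card_power k Q.
Implicit Types (f g : S) (d : nat).

Definition frob_form (j : 'I_n.+1) : S := 'X_j ^+ Q - 'X_j * 'X_i0 ^+ Q.-1.

Let Q_gt0 : (0 < Q)%N := ltnW (card_power_gt1 Q_pow).

Lemma frob_form_base : frob_form i0 = 0.
Proof. by rewrite /frob_form -exprS prednK ?subrr. Qed.

Lemma dhomog_frob_form j : frob_form j \is Q.-homog.
Proof.
apply: rpredB; first exact: dhomog_Xn.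
by have := dhomogM (dhomog_X k j) (dhomog_Xn k i0 Q.-1); rewrite add1n prednK.
Qed.

Definition frob_congruent f d :=
  ideal_gen frob_form (f ^+ Q - f * 'X_i0 ^+ (d * Q.-1)).

Lemma frob_congruentM f d g e : frob_congruent f d -> frob_congruent g e ->
  frob_congruent (f * g) (d + e)%N.
Proof.
rewrite /frob_congruent mulnDl exprMn exprD => Ef Eg.
set a := f ^+ Q in Ef *; set w := 'X_i0 ^+ (d * _) in Ef *.
set b := g ^+ Q in Eg *; set v := 'X_i0 ^+ (e * _) in Eg *.
have -> : a * b - f * g * (w * v) = b * (a - f * w) + (f * w) * (b - g * v).
  by ring.
by apply: (ideal_predD (ideal_genP frob_form));
  exact: ideal_predMl (ideal_genP frob_form) _ _ _.
Qed.

Lemma frob_congruentX (m : 'X_{1..n.+1}) : frob_congruent 'X_[m] (mdeg m).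
Proof.
have one_congruent : frob_congruent 1 0.
  rewrite /frob_congruent expr1n mul0n mulr1 subrr.
  exact: ideal_pred0 (ideal_genP frob_form).
rewrite mpolyXE_id mdegE; apply: (big_ind2 frob_congruent) => // [*|j _].
  exact: frob_congruentM.
elim: (m j) => [|e IHe] //; rewrite exprS;
  apply: (@frob_congruentM _ 1%N _ e) => //.
by rewrite /frob_congruent mul1n; exact: ideal_gen_mem.
Qed.

Lemma dhomog_frob_congruent f d : f \is d.-homog -> frob_congruent f d.
Proof.
have pcharQ := pnat_card_power (@mpolyC n.+1 k : {rmorphism k -> S}) Q_pow.
move=> /dhomogP hf; rewrite (mpolyE f) big_seq.
apply: (big_ind (frob_congruent^~ d)) => [|g h Eg Eh|m m_f].
- rewrite /frob_congruent expr0n gtn_eqF // mul0r subrr.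
  exact: ideal_pred0 (ideal_genP frob_form).
- rewrite /frob_congruent exprDn_pchar // mulrDl opprD addrACA.
  exact: ideal_predD (ideal_genP frob_form) _ _ Eg Eh.
- have <- : mdeg m = d := hf m m_f.
  rewrite /frob_congruent exprZn (expf_card_power _ Q_pow) -scalerAl -scalerBr.
  rewrite -mul_mpolyC; apply: ideal_predMl (ideal_genP frob_form) _ _ _.
  exact: frob_congruentX.
Qed.

Lemma chart_eval_frob_form (K : fieldType) (phi : {rmorphism S -> K}) j :
    phi 'X_i0 != 0 ->
  chart_eval phi i0 (frob_form j) =
    chart_eval phi i0 'X_j ^+ Q - chart_eval phi i0 'X_j.
Proof.
move=> Xi0; rewrite rmorphB rmorphXn rmorphM rmorphXn /=.
by rewrite (chart_evalX _ _ i0) divff // expr1n mulr1.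
Qed.

Lemma chart_eval_frob_congruent (K : fieldType) (phi : {rmorphism S -> K}) f d :
    phi 'X_i0 != 0 -> f \is d.-homog ->
  exists h : 'I_n.+1 -> S, chart_eval phi i0 f ^+ Q - chart_eval phi i0 f =
    \sum_j chart_eval phi i0 (h j) * chart_eval phi i0 (frob_form j).
Proof.
move=> Xi0 /dhomog_frob_congruent[h /(congr1 (chart_eval phi i0)) E]; exists h.
move: E; rewrite rmorphB rmorphXn rmorphM rmorphXn /=
  (chart_evalX _ _ i0) divff //.
rewrite expr1n mulr1 => ->; rewrite rmorph_sum; apply: eq_bigr => j _.
exact: rmorphM.
Qed.

End FrobeniusForms.

Section FrobeniusJacobian.
Variables (k : finFieldType) (X : proj_variety k) (p : point X).
Local Notation n := (amb_dim X).
Local Notation I := (var_ideal X).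
Local Notation S := {mpoly k[n.+1]}.
Variables (i0 : 'I_n.+1) (Q : nat).
Hypotheses (pi0 : ~ p 'X_i0) (Q_pow : card_power k Q).
Local Notation fr := (frob_form k i0 Q).
Hypothesis pfrob : forall j, p (fr j).

Let Q_gt1 : (1 < Q)%N := card_power_gt1 Q_pow.

Definition frob_lift (f : S) N (r : S) := [/\ r \in I, ideal_gen fr r &
  forall l, p (mderiv l r - 'X_i0 ^+ N * mderiv l f)].

Lemma frob_liftD f g N M r s : frob_lift f N r -> frob_lift g M s ->
  frob_lift (f + g) (N + M) ('X_i0 ^+ M * r + 'X_i0 ^+ N * s).
Proof.
move=> [Ir fr_r dr] [Is fr_s ds]; split=> [||l].
- by rewrite rpredD ?idealMr.
- by apply: (ideal_predD (ideal_genP fr));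
    exact: ideal_predMl (ideal_genP fr) _ _ _.
rewrite !mderivD !mderivM exprD.
set x := 'X_i0 ^+ N; set y := 'X_i0 ^+ M.
have -> : mderiv l y * r + y * mderiv l r + (mderiv l x * s + x * mderiv l s)
    - x * y * (mderiv l f + mderiv l g) =
    mderiv l y * r + y * (mderiv l r - x * mderiv l f)
    + (mderiv l x * s + x * (mderiv l s - y * mderiv l g)) by ring.
by do !apply: ptD; apply: ptMl => //; exact: pt_above.
Qed.

(* If f of degree d lies in I, the derivatives of x_i0^(d(Q-1)) f - f^Q and
   of f differ, modulo p, by the factor x_i0^(d(Q-1)). *)
Lemma exists_frob_lift f : f \in I -> exists N r, frob_lift f N r.
Proof.
move=> If; have [K _ ->] := pihomog_partition 0 f.
apply: (big_ind (fun g => exists N r, frob_lift g N r)).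
- exists 0%N, 0; split=> [||l]; first exact: rpred0.
    exact: ideal_pred0 (ideal_genP fr).
  by rewrite mderiv0 mulr0 subrr; exact: pt0.
- by move=> g h [N [r r_lift]] [M [s s_lift]]; do 2 eexists;
    exact: frob_liftD r_lift s_lift.
- move=> d _; have Ig := var_homog d If.
  have := pihomogP mdeg d f; move: (pihomog _ _ _) Ig => g Ig hg.
  have pg : p g by exact: pt_above.
  exists (d * Q.-1)%N, ('X_i0 ^+ (d * Q.-1) * g - g ^+ Q); split=> [||l].
  + by rewrite -(subnK (ltnW Q_gt1)) addn1 exprSr rpredB ?idealMr.
  + rewrite -opprB mulrC; apply: ideal_predN (ideal_genP fr) _.
    exact: dhomog_frob_congruent.
  + rewrite mderivB mderivM addrAC addrK -(prednK (ltnW Q_gt1)) exprSr mderivM.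
    apply: ptB; first exact: ptMl.
    apply: ptD; first exact: ptMl.
    by apply: ptMr; apply: ptXn => //; rewrite -ltnS prednK ?(ltnW Q_gt1).
Qed.

(* The Jacobian matrix of f factors, modulo p, through the matrix H of
   coefficients of the lifts of f on the forms frob_form j. *)
Lemma exists_frob_relations r (f : 'I_r -> S) (c : 'I_r -> 'I_n.+1) :
    (forall i, f i \in I) -> ~ p (jacobian_minor f c) ->
  exists H : 'M[S]_(r, n), (r <= \rank (map_mx (residue_map p) H))%N /\
    forall s, (H *m \col_j fr (fintype.lift i0 j)) s 0 \in I.
Proof.
move=> If minor; pose res := residue_map p.
have /choice[N /choice[g g_lift]] i := exists_frob_lift (If i).
have /choice[h hE] i : exists h : 'I_n.+1 -> S, g i = \sum_j h j * fr j.
  by have [] := g_lift i.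
pose H : 'M[S]_(r, n) := \matrix_(i, j) h i (fintype.lift i0 j).
have HE i : (H *m \col_j fr (fintype.lift i0 j)) i 0 = g i.
  rewrite hE (bigD1_ord i0) //= frob_form_base // mulr0 add0r mxE.
  by apply: eq_bigr => j _; rewrite !mxE.
exists H; split=> [|s]; last by rewrite HE; have [] := g_lift s.
pose J : 'M_r := \matrix_(i, l) res (mderiv (c l) (f i)).
pose G : 'M_(n, r) :=
  \matrix_(j, l) res (mderiv (c l) (fr (fintype.lift i0 j))).
have rankJ : \rank J = r.
  apply: mxrank_unit; rewrite unitmxE unitfE.
  have -> : J = map_mx res (\matrix_(i, l) mderiv (c l) (f i)).
    by apply/matrixP => i l; rewrite !mxE.
  by rewrite det_map_mx; exact: residue_map_neq0.
have JE i : row i (map_mx res H *m G) = res 'X_i0 ^+ N i *: row i J.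
  apply/rowP => l; rewrite !mxE -rmorphXn -rmorphM; apply/esym/eqP.
  rewrite -subr_eq0; apply/eqP; transitivity (- res (mderiv (c l) (g i) -
    'X_i0 ^+ N i * mderiv (c l) (f i))); last first.
    by rewrite (residue_mapP p _).2 ?oppr0 //; have [_ _] := g_lift i; exact.
  rewrite rmorphB opprB /=; congr (_ - _).
  rewrite hE (bigD1_ord i0) //= frob_form_base // mulr0 add0r
    (raddf_sum (mderiv (c l))) rmorph_sum.
  apply: eq_bigr => j _; rewrite !mxE /= mderivM rmorphD !rmorphM.
  by rewrite [res (fr _)](residue_mapP p _).2 // mulr0 add0r.
rewrite -{1}rankJ; apply: leq_trans (mxrankM_maxl _ G); apply: mxrankS.
apply/row_subP => i; have Xi0 : res 'X_i0 ^+ N i != 0.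
  by rewrite expf_neq0 ?residue_map_neq0.
by rewrite -[row i J](scalerK Xi0) -JE scalemx_sub ?row_sub.
Qed.

Lemma exists_frob_pivot : smooth_var X 1 ->
  exists (e : nat) delta j0, [/\ delta \is e.-homog, ~ p delta &
    forall j, exists w, delta * fr j - w * fr j0 \in I].
Proof.
move=> [n_gt0 /(_ p)[[f [c [If minor]]] _]].
have [H [rankH HI]] := exists_frob_relations If minor.
have idI : ideal_pred (fun f : S => f \in I).
  by split=> [|f1 f2|f1 f2]; [exact: rpred0 | exact: rpredD | exact: idealMr].
have {}rankH : (n.-1 <= \rank (map_mx (residue_map p) H))%N.
  by rewrite -[X in (X <= _)%N]subn1.
have [delta pdelta [j0 rel]] := cramer_mod_ideal idI HI n_gt0 rankH.
have [e pe] : exists e, ~ p (pihomog mdeg e delta).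
  by apply/existsNP => /pt_components/residue_mapP/eqP; rewrite (negPf pdelta).
exists e, (pihomog mdeg e delta), (fintype.lift i0 j0).
split=> // [|j]; first exact: pihomogP.
case: (unliftP i0 j) => [l ->|->]; last first.
  by exists 0; rewrite frob_form_base // mulr0 mul0r subrr rpred0.
have [w] := rel l; rewrite !mxE => /(var_homog (Q + e)).
rewrite raddfB /= ![_ * fr _]mulrC.
rewrite !(pihomog_dhomogMl _ (dhomog_frob_form i0 Q_pow _)) ?leq_addr //.
rewrite addKn => Iw.
by exists (pihomog mdeg e w); rewrite ![_ * fr _]mulrC.
Qed.

End FrobeniusJacobian.

(** * Closed points of the curve *)

Section GenericPoint.
Variables (k : fieldType) (X : proj_variety k).
Hypothesis hdim : var_dim X 1.
Local Notation I := (var_ideal X).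
Local Notation S := {mpoly k[(amb_dim X).+1]}.
Implicit Types (p q : point X) (f g : S).

Lemma generic_point_prime : homog_prime (fun f : S => f \in I).
Proof.
have [[c _] _] := hdim; split.
- exact: rpred0.
- by move=> f g; exact: rpredD.
- by move=> f g; exact: idealMr.
- by move=> f g; rewrite prime_idealrM => /orP.
- by move=> f d; exact: var_homog.
- have [i Xi] := hp_relevant (pt_prime (c ord0)); exists i.
  by move=> /(pt_above (c ord0)).
Qed.

Definition generic_point : point X :=
  ProjPoint generic_point_prime (fun f If => If).
Local Notation eta := generic_point.

Lemma generic_point_not_closed : ~ closed_point_pred eta.
Proof.
have [[c /(_ ord0 ord_max isT)[_ [f [c1f c0f]]]] _] := hdim.
move=> closed_eta; apply: c0f; apply: pt_above.
by apply: (closed_eta (c ord_max)) => // g; exact: pt_above.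
Qed.

Lemma point_cases p : closed_point_pred p \/ p = eta.
Proof.
apply: contrapT => /not_orP[].
move=> /existsNP[q /not_implyP[pq /existsNP[f /not_implyP[qf pf]]]] ne.
have [g [pg Ig]] : exists g, p g /\ ~ g \in I.
  apply: contrapT => none; apply: ne; apply: point_ext => g.
  split=> [pg|]; last exact: pt_above.
  by apply: contrapT => Ig; apply: none; exists g.
apply: hdim.2; exists (fun i : 'I_3 => nth eta [:: eta; p; q] i).
case=> [[|[|[|//]]] ?] [[|[|[|//]]] ?] //= _; split=> //.
- by move=> h; exact: pt_above.
- by exists g.
- by move=> h; exact: pt_above.
- by exists g; split=> //; exact: pq.
- by exists f.
Qed.

Lemma closed_point_dhomog p : closed_point_pred p ->
  exists d g, [/\ g \is d.-homog, p g & g \notin I].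
Proof.
move=> cp; apply: contrapT => none; apply: generic_point_not_closed.
suff <- : p = eta by [].
apply: point_dhomog_ext => d g hg; split=> [pg|]; last exact: pt_above.
by apply/negPn/negP => Ig; apply: none; exists d, g.
Qed.

Lemma regular_at_generic_point (z : cone_field X) :
  regular_at eta z <-> ratfun z.
Proof.
split; first exact: regular_ratfun.
by move=> [d [a [b [ha hb Ib ->]]]]; exists d, a, b; split=> //; apply/negP.
Qed.

Lemma open_generic_point (U : opens (fun f : S => f \in I)) p : U p -> U eta.
Proof.
by move=> /open_setP[d [f [_ pf Uf]]]; apply: Uf => /= If; apply: pf;
  exact: pt_above.
Qed.

End GenericPoint.

Section ClosedPoints.
Variables (k : finFieldType) (X : proj_variety k).
Hypothesis hdim : var_dim X 1.
Local Notation n := (amb_dim X).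
Local Notation I := (var_ideal X).
Local Notation S := {mpoly k[n.+1]}.
Local Notation kappa := (@cone_elt k X).
Implicit Types (p q : point X) (f g : S) (z w : cone_field X).

(* If y = x_j / x_i0 were not a root of unity in the residue field, the
   centre of a valuation ring containing y but not 1 / y would specialise p. *)
Lemma closed_point_coordinate p i0 j : closed_point_pred p -> ~ p 'X_i0 ->
  exists2 Q, card_power k Q & chart_eval (residue_map p) i0 'X_j ^+ Q =
                              chart_eval (residue_map p) i0 'X_j.
Proof.
move=> cp pi0; set y := chart_eval _ _ _.
have [y0|y0] := eqVneq y 0.
  have card1 : card_power k (#|k| ^ 1) by exists 1%N.
  by exists (#|k| ^ 1)%N => //;
    rewrite y0 expr0n gtn_eqF // ltnW ?(card_power_gt1 card1).
pose iota : {rmorphism k -> cone_residue_field p} :=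
  residue_map p \o @mpolyC _ k.
suff [M M0 yM] : exists2 M, (0 < M)%N & y ^+ M = 1.
  exact: (card_power_of_expf_eq1 iota M0 yM).
apply: contrapT => no_root.
have inv_poly (g : {poly k}) : y^-1 != (map_poly iota g).[y].
  by apply/eqP => /(expf_eq1_of_inv_poly y0).
have [|q [prime_q ker_q _ num_q]] := exists_center _ inv_poly.
  by exists i0; exact: residue_map_neq0.
have pq f : p f -> q f.
  by move=> pf; apply: ker_q => d; apply/residue_mapP/pt_pihomog.
pose q' : point X := ProjPoint prime_q (fun f If => pq f (pt_above p If)).
have pj : p 'X_j.
  apply: (cp q' pq); apply: num_q (dhomog_X k j) (dhomog_X k i0) _ _.
    exact: residue_map_neq0.
  by rewrite -chart_evalX.
by move: y0; rewrite /y chart_evalX (residue_mapP p _).2 // mul0r eqxx.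
Qed.

Lemma closed_point_frob_form p i0 : closed_point_pred p -> ~ p 'X_i0 ->
  exists2 Q, card_power k Q & forall j, p (frob_form k i0 Q j).
Proof.
move=> cp pi0.
have [Q Q_pow fixQ] :=
  common_card_power (fun j => closed_point_coordinate j cp pi0).
exists Q => // j;
  apply/(residue_chart_dhomog pi0 (dhomog_frob_form i0 Q_pow j)).
by rewrite chart_eval_frob_form ?residue_map_neq0 // fixQ subrr.
Qed.

Section FrobUniformizer.
Variables (p : point X) (i0 : 'I_n.+1) (Q e : nat) (delta : S) (j0 : 'I_n.+1).
Local Notation fr := (frob_form k i0 Q).
Local Notation ev := (chart_eval kappa i0).
Hypotheses (pi0 : ~ p 'X_i0) (Q_pow : card_power k Q)
    (pfrob : forall j, p (fr j)).
Hypotheses (hdelta : delta \is e.-homog) (pdelta : ~ p delta).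
Hypothesis pivot : forall j, exists w : S, delta * fr j - w * fr j0 \in I.

Let Q_gt1 : (1 < Q)%N := card_power_gt1 Q_pow.
Let Xi0 : kappa 'X_i0 != 0 := pt_cone pi0.

Lemma chart_eval_frob_pivot j :
  exists2 w, w \in local_ring p & ev (fr j) = w * ev (fr j0).
Proof.
have [w] := pivot j.
have [delta0 _ rdelta] := chart_eval_unit pi0 hdelta pdelta.
move=> /(chart_eval_ideal pi0)/eqP; rewrite rmorphB !rmorphM subr_eq0 => /eqP E.
exists (ev w / ev delta); last by rewrite mulrAC -E mulrC mulKf.
by rewrite rpredM ?chart_eval_regular //; exact/local_ringP.
Qed.

(* Since f^Q = x_i0^(d(Q-1)) f modulo the forms fr j, and f^(Q-1) vanishes at
   p with f, the function f / x_i0^d is a multiple of the pivot. *)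
Lemma chart_eval_pivot_multiple f d : f \is d.-homog -> p f ->
  exists2 w, w \in local_ring p & ev f = w * ev (fr j0).
Proof.
move=> hf pf; pose v := 'X_i0 ^+ (d * Q.-1) - f ^+ Q.-1.
have hv : v \is (d * Q.-1).-homog by rewrite rpredB ?dhomog_Xn ?dhomogMn.
have pv : ~ p v.
  move=> pv; apply: (pt_nX (m := (d * Q.-1)%N) pi0).
  rewrite -['X_i0 ^+ _](subrK (f ^+ Q.-1)); apply: ptD => //.
  by apply: ptXn => //; rewrite -ltnS prednK // ltnW.
have [v0 _ rv] := chart_eval_unit pi0 hv pv.
have [h Eh] := chart_eval_frob_congruent Q_pow Xi0 hf.
have /choice[w wP] j :
    exists w, w \in local_ring p /\ ev (fr j) = w * ev (fr j0).
  by have [w rw Ew] := chart_eval_frob_pivot j; exists w.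
exists (- (\sum_j ev (h j) * w j) / ev v).
  rewrite rpredM ?rpredN ?rpred_sum //; last exact/local_ringP.
  by move=> j _; rewrite rpredM ?chart_eval_regular //; have [] := wP j.
rewrite mulrAC; apply: (canRL (mulfK v0)); rewrite mulNr rmorphB !rmorphXn /=.
rewrite chart_evalX divff // expr1n mulrBr mulr1 -exprS prednK ?(ltnW Q_gt1) //.
rewrite -opprB Eh [in RHS]mulr_suml; congr (- _); apply: eq_bigr => j _.
by have [_ ->] := wP j; rewrite mulrA.
Qed.

Lemma pivot_uniformizer : closed_point_pred p -> uniformizer p (ev (fr j0)).
Proof.
move=> cp; split=> [||z [d [a [b [ha hb pa pb ->]]]]].
- have [d [g [hg pg Ig]]] := closed_point_dhomog hdim cp.
  have [w _ Eg] := chart_eval_pivot_multiple hg pg.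
  apply: contraNneq Ig => t0; rewrite -cone_elt_eq0 -(chart_eval_eq0 Xi0 hg).
  by rewrite Eg t0 mulr0.
- exact/(chart_eval_vanishing pi0 (dhomog_frob_form i0 Q_pow j0)).
- have [w rw Ea] := chart_eval_pivot_multiple ha pa.
  have [b0 _ rb] := chart_eval_unit pi0 hb pb.
  exists (w / ev b); first by apply: regularM rb; exact/local_ringP.
  by rewrite (chart_eval_ratio Xi0 ha hb) Ea mulrAC.
Qed.

End FrobUniformizer.
End ClosedPoints.

Section Orders.
Variables (k : finFieldType) (X : proj_variety k).
Hypotheses (hdim : var_dim X 1) (hsmooth : smooth_var X 1).
Local Notation n := (amb_dim X).
Local Notation I := (var_ideal X).
Local Notation S := {mpoly k[n.+1]}.
Local Notation kappa := (@cone_elt k X).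
Local Notation eta := (generic_point hdim).
Implicit Types (p q : point X) (f : S) (z w t u : cone_field X).

Record frob_chart p i0 Q (delta : S) j0 : Prop := FrobChart {
  frob_chart_base : ~ p 'X_i0;
  frob_chart_pow : card_power k Q;
  frob_chart_uniformizer :
    uniformizer p (chart_eval kappa i0 (frob_form k i0 Q j0));
  frob_chart_homog : exists e, delta \is e.-homog;
  frob_chart_unit : ~ p delta;
  frob_chart_pivot : forall j, exists w : S,
    delta * frob_form k i0 Q j - w * frob_form k i0 Q j0 \in I }.

Lemma exists_frob_chart p : closed_point_pred p ->
  exists i0 Q delta j0, frob_chart p i0 Q delta j0.
Proof.
move=> cp; have [i0 pi0] := hp_relevant (pt_prime p).
have [Q Q_pow pfrob] := closed_point_frob_form cp pi0.
have [e [delta [j0 [hdelta pdelta pivot]]]] :=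
  exists_frob_pivot pi0 Q_pow pfrob hsmooth.
exists i0, Q, delta, j0; split=> //; last by exists e.
exact: (pivot_uniformizer hdim pi0 Q_pow pfrob hdelta pdelta pivot cp).
Qed.

Lemma exists_uniformizer p : closed_point_pred p -> exists t, uniformizer p t.
Proof.
by move=> /exists_frob_chart[i0 [Q [delta [j0 []]]]]; eexists; eassumption.
Qed.

(* The homogeneous prime of the infinitely divisible elements is contained in
   p, and it is not p because a uniformizer is not infinitely divisible. *)
Lemma infinitely_divisible_eq0 p t z : closed_point_pred p -> uniformizer p t ->
  infinitely_divisible p t z -> z = 0.
Proof.
move=> cp ut dz; have [i0 pi0] := hp_relevant (pt_prime p).
have Xi0 := pt_cone pi0.
have prm := infinitely_divisible_prime ut.
pose q : point X := ProjPoint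
  (chart_primeP Xi0 prm (chart_eval_regular pi0))
  (fun f If => chart_prime_ker Xi0 prm
    (fun d => eqP (etrans (cone_elt_eq0 _) (var_homog d If)))).
have qP f d (hf : f \is d.-homog) :
    q f <-> infinitely_divisible p t (chart_eval kappa i0 f).
  exact: (chart_prime_dhomog kappa i0 prm hf).
have qp f : q f -> p f.
  move=> qf; apply: pt_components => d.
  apply/(chart_eval_vanishing pi0 (pihomogP _ _ _)).
  by apply: (infinitely_divisible_vanishing ut); exact: qf.
have q_eta : q = eta.
  have [cq|//] := point_cases hdim q.
  have [_ [d [a [b [ha hb pa pb Et]]]] _] := ut.
  case: (uniformizer_not_infinitely_divisible ut); rewrite {2}Et.
  have [_ _ /local_ringP rb] := chart_eval_unit pi0 hb pb.
  rewrite (chart_eval_ratio Xi0 ha hb) mulrC; apply: (subring_primeMl prm) rb _.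
  exact/(qP a d ha)/(cq p qp).
have [w /local_ringP rw Ez] := dz 0%N; rewrite mulr1 in Ez.
have [d [a [b [ha hb pb Ew]]]] := rw.
suff : q a by rewrite q_eta Ez Ew /= -cone_elt_eq0 => /eqP->; rewrite mul0r.
have [b0 _ _] := chart_eval_unit pi0 hb pb.
apply/(qP a d ha); have -> : chart_eval kappa i0 a = chart_eval kappa i0 b * z.
  by rewrite Ez Ew (chart_eval_ratio Xi0 ha hb) mulrC divfK.
exact: (subring_primeMl prm) (chart_eval_regular pi0 b) dz.
Qed.

Lemma regular_uniformizer_power p t z :
    closed_point_pred p -> uniformizer p t -> regular_at p z -> z != 0 ->
  exists (m : nat) u, unit_at p u /\ z = t ^+ m * u.
Proof.
move=> cp ut rz z0; case: (uniformizer_power_or_divisible ut rz) => //.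
by move=> /(infinitely_divisible_eq0 cp ut) E; rewrite E eqxx in z0.
Qed.

Lemma exists_order p z : closed_point_pred p -> ratfun z -> z != 0 ->
  exists m, has_order p z m.
Proof.
move=> cp [d [a [b [ha hb Ib Ez]]]] z0; have [t ut] := exists_uniformizer cp.
have [i0 pi0] := hp_relevant (pt_prime p); have Xi0 := pt_cone pi0.
have form_power f : f \is d.-homog -> kappa f != 0 -> exists (m : nat) u,
    unit_at p u /\ chart_eval kappa i0 f = t ^+ m * u.
  move=> hf f0; apply: regular_uniformizer_power => //.
    exact/local_ringP/(chart_eval_regular pi0).
  by rewrite (chart_eval_eq0 Xi0 hf).
have a0 : kappa a != 0 by apply: contraNneq z0 => a0; rewrite Ez a0 mul0r.
have b0 : kappa b != 0 by rewrite cone_elt_eq0.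
have [ma [ua [uua Ea]]] := form_power a ha a0.
have [mb [ub [uub Eb]]] := form_power b hb b0.
exists (ma%:Z - mb%:Z); apply: (has_order_uniformizer ut (unit_at_div uua uub)).
rewrite Ez (chart_eval_ratio Xi0 ha hb) Ea Eb expfzDr ?(uniformizer_neq0 ut) //.
by rewrite -invr_expz -!exprnP mulf_div.
Qed.

End Orders.

(** * Zeros of forms and global functions *)

Lemma finite_of_injective_on (T : choiceType) (C : finType) (s : T -> C)
    (Z : T -> Prop) :
  (forall x y, Z x -> Z y -> s x = s y -> x = y) ->
  exists r : seq T, forall x, Z x -> x \in r.
Proof.
move=> inj; have /choice[o oP] c : exists o : option T,
    forall x, Z x -> s x = c -> o = Some x.
  have [[x [Zx sx]]|none] := pselect (exists x, Z x /\ s x = c).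
    by exists (Some x) => y Zy sy; congr Some; apply: inj => //; rewrite sx.
  by exists None => x Zx sx; case: none; exists x.
exists (pmap o (enum C)) => x Zx; rewrite mem_pmap; apply/mapP; exists (s x).
  by rewrite mem_enum.
by rewrite (oP _ x).
Qed.

Lemma expr_fixed_reduce (Q a : nat) : (1 < Q)%N -> exists b : 'I_Q,
  forall (K : fieldType) (y : K), y ^+ Q = y -> y ^+ a = y ^+ b.
Proof.
move=> Q1; elim/ltn_ind: a => a IHa; have [lt|le] := ltnP a Q.
  by exists (Ordinal lt).
have [|b bE] := IHa (a - Q).+1.
  by rewrite -addn1 -[X in (_ < X)%N](subnK le) ltn_add2l.
by exists b => K y yQ; rewrite -bE // -{1}(subnK le) exprD yQ exprSr.
Qed.

Section ReducedPolynomials.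
Variables (k : finFieldType) (n Q : nat).
Local Notation S := {mpoly k[n.+1]}.

Definition reduced_poly (b : {ffun {ffun 'I_n.+1 -> 'I_Q} -> k}) : S :=
  \sum_e b e *: \prod_j 'X_j ^+ e j.

Lemma exists_reduced_poly i0 f : (1 < Q)%N ->
  exists b, forall (K : fieldType) (phi : {rmorphism S -> K}),
    (forall j, chart_eval phi i0 'X_j ^+ Q = chart_eval phi i0 'X_j) ->
    chart_eval phi i0 f = chart_eval phi i0 (reduced_poly b).
Proof.
move=> Q1; have /choice[red redP] a := expr_fixed_reduce a Q1.
pose redm (m : 'X_{1..n.+1}) : {ffun 'I_n.+1 -> 'I_Q} := [ffun j => red (m j)].
exists [ffun e => \sum_(m <- msupp f | redm m == e) f@_m] => K phi fixQ.
have -> : reduced_poly [ffun e => \sum_(m <- msupp f | redm m == e) f@_m] =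
    \sum_(m <- msupp f) f@_m *: \prod_j ('X_j : S) ^+ redm m j.
  rewrite /reduced_poly; under eq_bigr => e _ do rewrite ffunE scaler_suml.
  rewrite (exchange_big_dep xpredT) //=; apply: eq_bigr => m _.
  by rewrite (eq_bigl (pred1 (redm m))) ?big_pred1_eq // => e;
    rewrite /= eq_sym.
rewrite {1}(mpolyE f) !rmorph_sum; apply: eq_bigr => m _ /=.
rewrite -!mul_mpolyC !rmorphM /= mpolyXE_id !rmorph_prod; congr (_ * _).
by apply: eq_bigr => j _; rewrite !rmorphXn /= ffunE; exact: redP.
Qed.

End ReducedPolynomials.

Section FiniteZeros.
Variables (k : finFieldType) (X : proj_variety k).
Hypotheses (hdim : var_dim X 1) (hsmooth : smooth_var X 1).
Local Notation n := (amb_dim X).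
Local Notation I := (var_ideal X).
Local Notation S := {mpoly k[n.+1]}.
Local Notation kappa := (@cone_elt k X).
Implicit Types (P : closed_point X) (p q : point X) (f g h : S).

Lemma closed_point_ext P P' : cp_point P = cp_point P' -> P = P'.
Proof.
case: P P' => p cp [p' cp'] /= E; case: p' / E cp' => cp'.
by congr ClosedPoint; exact: Prop_irrelevance.
Qed.

(* A point with coordinates in F_Q is determined by which of the finitely
   many reduced polynomials vanish there. *)
Lemma finite_frob_zeros i0 Q : card_power k Q ->
  exists s : seq (closed_point X), forall P,
    ~ cp_point P 'X_i0 -> (forall j, cp_point P (frob_form k i0 Q j)) ->
    P \in s.
Proof.
move=> Q_pow.
pose ev P := chart_eval (residue_map (cp_point P)) i0.
pose Z P := ~ cp_point P 'X_i0 /\ forall j, cp_point P (frob_form k i0 Q j).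
pose s P := [set b | ev P (@reduced_poly k n Q b) == 0]%SET.
have [|r rP] := @finite_of_injective_on _ _ s Z; last first.
  by exists r => P *; apply: rP.
have pt_signature f d : f \is d.-homog ->
    exists b, forall P, Z P -> cp_point P f <-> b \in s P.
  move=> hf; have [b bE] := exists_reduced_poly i0 f (card_power_gt1 Q_pow).
  exists b => P [Pi0 Pfr]; rewrite (residue_chart_dhomog Pi0 hf) bE => [|j].
    by rewrite finset.in_set; split=> /eqP.
  apply/eqP; rewrite -subr_eq0 -chart_eval_frob_form ?residue_map_neq0 //.
  exact/eqP/(residue_chart_dhomog Pi0 (dhomog_frob_form i0 Q_pow j)).
move=> P P' ZP ZP' Es; apply/closed_point_ext/point_dhomog_ext => d f hf.
have [b bP] := pt_signature f d hf.
by rewrite (bP P ZP) (bP P' ZP') Es.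
Qed.

(* Where the uniformizer frob_form j0 of q is a local equation for all forms
   frob_form j, a zero of f = t^m u is a zero of all of them. *)
Lemma finite_zeros_near f d q : f \is d.-homog -> f \notin I ->
  exists (e : nat) h, [/\ h \is e.-homog, ~ q h &
    exists s : seq (closed_point X),
      forall P, cp_point P f -> P \notin s -> cp_point P h].
Proof.
move=> hf If; have [qf|qf] := pselect (q f); last first.
  by exists d, f; split=> //; exists [::].
have [cq|q_eta] := point_cases hdim q; last first.
  by rewrite q_eta /= (negPf If) in qf.
have [i0 [Q [delta [j0 [qi0 Q_pow ut [e hdelta] qdelta pivot]]]]] :=
  exists_frob_chart hdim hsmooth cq.
have [s sP] := finite_frob_zeros i0 Q_pow; set t := chart_eval _ _ _ in ut.
have Xi0 := pt_cone qi0.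
have [||m [u [uu Ef]]] :=
  @regular_uniformizer_power _ _ hdim q t (chart_eval kappa i0 f) cq ut.
- exact/local_ringP/(chart_eval_regular qi0).
- by rewrite (chart_eval_eq0 Xi0 hf) cone_elt_eq0.
have [u0 [c [a [b [ha hb qb Eu]]]] _] := uu.
have qa : ~ q a.
  by move=> qa; apply: (unit_not_vanishing uu); rewrite Eu; exists c, a, b.
exists (1 + c + c + e)%N, ('X_i0 * a * b * delta); split.
- by do !apply: dhomogM => //; exact: dhomog_X.
- by do !apply: pt_nmul.
exists s => P Pf; apply: contraNP => Ph.
have [Pi0 Pa Pb Pdelta] : [/\ ~ cp_point P 'X_i0, ~ cp_point P a,
    ~ cp_point P b & ~ cp_point P delta].
  split=> Px; apply: Ph; last exact: ptMl.
  - by do 3!apply: ptMr.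
  - by do 2!apply: ptMr; exact: ptMl.
  - by apply: ptMr; exact: ptMl.
have Pj0 : cp_point P (frob_form k i0 Q j0).
  apply/(chart_eval_vanishing Pi0 (dhomog_frob_form i0 Q_pow j0)).
  have rt := local_ringP _ _ (chart_eval_regular Pi0 (frob_form k i0 Q j0)).
  case: (unit_or_vanishing rt) => // ut'; exfalso.
  have uP : unit_at (cp_point P) u.
    by rewrite Eu; split;
      [rewrite -Eu | exists c, a, b | exists c, b, a; rewrite invf_div].
  apply: (unit_not_vanishing (unit_atM (unit_atX m ut') uP)).
  by rewrite -Ef; exact/(chart_eval_vanishing Pi0 hf).
apply: sP => // j; have [w Iw] := pivot j.
suff /ptM[] : cp_point P (delta * frob_form k i0 Q j) by [].
rewrite -[_ * _](subrK (w * frob_form k i0 Q j0)); apply: ptD; last exact: ptMl.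
exact: pt_above.
Qed.

Lemma finite_zeros f d : f \is d.-homog -> f \notin I ->
  exists s : seq (closed_point X), forall P, cp_point P f -> P \in s.
Proof.
move=> hf If.
pose A (x : S) := exists s : seq (closed_point X),
  forall P, cp_point P f -> P \notin s -> cp_point P x.
have idA : ideal_pred A.
  split=> [|x y [s sP] [r rP]|x y [s sP]].
  - by exists [::] => P _ _; exact: pt0.
  - exists (s ++ r) => P Pf; rewrite mem_cat negb_or => /andP[Ps Pr].
    by apply: ptD; [exact: sP | exact: rP].
  - by exists s => P Pf Ps; apply: ptMl; exact: sP.
have /choice[N /choice[s sP]] i : exists N, A ('X_i ^+ N).
  apply: (@coordinate_power_in_ideal k n (fun g => g \in I)) => // [g e Ig|q].
    by exists [::] => P _ _; exact/pt_above/var_homog.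
  by have [e [h [hh qh Ah]]] := finite_zeros_near q hf If; exists e, h.
exists (flatten [seq s i | i <- enum 'I_n.+1]) => P Pf.
have [i Pi] := hp_relevant (pt_prime (cp_point P)).
apply/flattenP; exists (s i); first by apply: map_f; rewrite mem_enum.
by apply/negPn/negP => /(sP i P Pf)/ptX.
Qed.

Lemma global_regular_unit z : (forall p, regular_at p z) -> z != 0 ->
  forall p, unit_at p z.
Proof.
move=> rz z0 p; pose iota := kappa \o @mpolyC _ k.
have [M M0 zM] : exists2 M, (0 < M)%N & z ^+ M = 1.
  apply: contrapT => no_root; have zV0 : z^-1 != 0 by rewrite invr_eq0.
  have inv_poly (g : {poly k}) : z^-1^-1 != (map_poly iota g).[z^-1].
    apply/eqP => /(expf_eq1_of_inv_poly zV0)[M M0 E].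
    by apply: no_root; exists M => //; apply: invr_inj; rewrite -exprVn E invr1.
  have [|q [prime_q ker_q den_q _]] := exists_center _ inv_poly.
    by have [i Xi] := hp_relevant (pt_prime p); exists i; exact: pt_cone Xi.
  have Iq f : f \in I -> q f.
    by move=> If; apply: ker_q => d; exact: cone_elt_pihomog_eq0.
  have [d [a [b [ha hb qb Ez]]]] := rz (ProjPoint prime_q Iq).
  by have := den_q _ _ _ ha hb qb; rewrite invrK Ez eqxx.
apply: (unit_at_inverse (w := z ^+ M.-1)) => //; last by rewrite -exprSr prednK.
by apply/local_ringP; rewrite rpredX //; exact/local_ringP.
Qed.

End FiniteZeros.

(** * Sheaves of modules *)

Local Notation opens_of X :=
  (opens (fun f : {mpoly _[(amb_dim X).+1]} => f \in var_ideal X)).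

Section Opens.
Variables (k : fieldType) (X : proj_variety k).

Lemma osub_refl (U : opens_of X) : osub U U. Proof. by []. Qed.
Lemma osub_capl (U V : opens_of X) : osub (open_cap U V) U.
Proof. by move=> p []. Qed.
Lemma osub_capr (U V : opens_of X) : osub (open_cap U V) V.
Proof. by move=> p []. Qed.

End Opens.
Arguments osub_refl {k X} U.
Arguments osub_capl {k X} U V.
Arguments osub_capr {k X} U V.

Section Sheaves.
Variables (k : fieldType) (X : proj_variety k).
Implicit Types (E F G L M : omodule X) (U V W : opens_of X) (p q : point X).

Lemma res0 E U V (h : osub V U) : res h (0 : sec E U) = 0.
Proof. by apply: (addrI (res h 0)); rewrite -resD !addr0. Qed.

Lemma sec_eq_near E U (s t : sec E U) :
  (forall p, U p -> exists V (h : osub V U), V p /\ res h s = res h t) -> s = t.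
Proof.
move=> near; pose J := {p : point X | U p}.
have /choice[V VP] (p : J) : exists V : {V : opens_of X & osub V U},
    tag V (sval p) /\ res (tagged V) s = res (tagged V) t.
  by have [V [h [Vp E']]] := near _ (svalP p);
    exists (Tagged (fun V => osub V U) h).
apply: (sec_eq (h := fun p : J => tagged (V p))) => [p Up|p];
  last by have [] := VP p.
by exists (exist _ p Up); have [] := VP (exist _ p Up).
Qed.

Lemma sec_glue_near E (U : point X -> opens_of X) V
    (s : forall p, sec E (open_cap V (U p))) :
  (forall p, U p p) ->
  (forall p q W (hp : osub W (open_cap V (U p)))
      (hq : osub W (open_cap V (U q))),
     res hp (s p) = res hq (s q)) ->
  exists t, forall p, res (osub_capl V (U p)) t = s p.
Proof. by move=> Upp; apply: sec_glue => p Vp; exists p; split. Qed.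

Section MorphismOfMaps.
Variables (E F : omodule X) (f : forall U, sec E U -> sec F U).
Arguments f : clear implicits.
Hypothesis f_linear : forall U, linear (f U).
Hypothesis f_res : forall U V (h : osub V U) s, f V (res h s) = res h (f U s).

Definition omorphism_of : omorphism E F :=
  @OMorphism k X E F
    (fun U =>
      HB.pack (f U) (GRing.isLinear.Build _ _ _ _ (f U) (@f_linear U))) f_res.

End MorphismOfMaps.

Definition oid E : omorphism E E.
Proof. by apply: (@omorphism_of E E (fun U s => s)). Defined.

Definition ocomp E F G (g : omorphism F G) (f : omorphism E F) : omorphism E G.
Proof.
apply: (@omorphism_of E G (fun U s => g U (f U s))) => [U a s t|U V h s].
  by rewrite !linearP.
by rewrite !omap_res.
Defined.

Definition osum_map E F G M (f : omorphism E G) (g : omorphism F M) :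
  omorphism (osum E F) (osum G M).
Proof.
apply: (@omorphism_of (osum E F) (osum G M) (fun U s => (f U s.1, g U s.2)))
  => [U a s t|U V h s].
  by rewrite !linearP.
by rewrite !omap_res.
Defined.

Definition osum_swap E F : omorphism (osum E F) (osum F E).
Proof.
by apply: (@omorphism_of (osum E F) (osum F E) (fun U s => (s.2, s.1))).
Defined.

Definition ofst E F : omorphism (osum E F) E.
Proof. by apply: (@omorphism_of (osum E F) E (fun U s => s.1)). Defined.

Definition osnd E F : omorphism (osum E F) F.
Proof. by apply: (@omorphism_of (osum E F) F (fun U s => s.2)). Defined.

Definition oinl E F : omorphism E (osum E F).
Proof.
apply: (@omorphism_of E (osum E F) (fun U s => (s, 0))) => [U a s t|U V h s].
  by congr pair; rewrite /= scaler0 addr0.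
by congr pair; rewrite /= res0.
Defined.

Definition oinr E F : omorphism F (osum E F).
Proof.
apply: (@omorphism_of F (osum E F) (fun U s => (0, s))) => [U a s t|U V h s].
  by congr pair; rewrite /= scaler0 addr0.
by congr pair; rewrite /= res0.
Defined.

Lemma oiso_refl E : oiso E E.
Proof. by exists (oid E), (oid E). Qed.

Lemma oiso_sym E F : oiso E F -> oiso F E.
Proof. by move=> [f [g fg]]; exists g, f => U; have [] := fg U. Qed.

Lemma oiso_trans E F G : oiso E F -> oiso F G -> oiso E G.
Proof.
move=> [f [f' ff']] [g [g' gg']]; exists (ocomp g f), (ocomp f' g') => U.
have [fK f'K] := ff' U; have [gK g'K] := gg' U.
by split; [exact: can_comp gK fK | exact: can_comp f'K g'K].
Qed.

Lemma oiso_bij E F (f : omorphism E F) :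
  (forall U, injective (f U)) -> (forall U y, exists x, f U x = y) -> oiso E F.
Proof.
move=> inj surj; pose g U y := projT1 (cid (surj U y)).
have gK U : cancel (g U) (f U) by move=> y; rewrite /g; case: cid.
have g_linear U : linear (g U).
  by move=> a s t; apply: (inj U); rewrite linearP !gK.
have g_res U V (h : osub V U) s : g V (res h s) = res h (g U s).
  by apply: (inj V); rewrite omap_res !gK.
exists f, (omorphism_of g_linear g_res) => U; split; last exact: gK.
by move=> s; apply: (inj U); exact: gK.
Qed.

Lemma oiso_osum E F G M : oiso E G -> oiso F M -> oiso (osum E F) (osum G M).
Proof.
move=> [f [f' ff']] [g [g' gg']]; exists (osum_map f g), (osum_map f' g') => U.
have [fK f'K] := ff' U; have [gK g'K] := gg' U.
by split=> -[s t] /=; rewrite ?fK ?gK ?f'K ?g'K.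
Qed.

Lemma oiso_osumC E F : oiso (osum E F) (osum F E).
Proof. by exists (osum_swap E F), (osum_swap F E) => U; split=> -[]. Qed.

Lemma vector_bundle_oiso r E F : oiso E F -> vector_bundle r E ->
  vector_bundle r F.
Proof.
move=> [f [g fg]] vE p; have [U [Up [e e_basis]]] := vE p; exists U; split=> //.
exists (fun i => f U (e i)) => V h s; have [fK gK] := fg V.
have fe (a : 'I_r -> OX V) :
    \sum_i a i *: res h (f U (e i)) = f V (\sum_i a i *: res h (e i)).
  by rewrite linear_sum; apply: eq_bigr => i _; rewrite linearZ /= omap_res.
have [a [Ea a_unique]] := e_basis V h (g V s); exists a; split.
  by rewrite fe -Ea gK.
by move=> b; rewrite fe => Eb; apply: a_unique; rewrite Eb fK.
Qed.

Definition free_generator E U (e : sec E U) :=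
  forall V (h : osub V U) (s : sec E V), exists! a : OX V, s = a *: res h e.

Lemma free_generator_inj E U (e : sec E U) V (h : osub V U) (a b : OX V) :
  free_generator e -> a *: res h e = b *: res h e -> a = b.
Proof.
move=> gen_e E'; have [c [_ uc]] := gen_e V h (a *: res h e).
by rewrite -(uc a) // -(uc b).
Qed.

Lemma line_bundleP L : line_bundle L <->
  forall p, exists U, U p /\ exists e : sec L U, free_generator e.
Proof.
split=> vL p; have [U [Up [e eP]]] := vL p; exists U; split=> //.
  exists (e ord0) => V h s; have [a [Ea ua]] := eP V h s; exists (a ord0).
  by split=> [|b Eb];
    [rewrite Ea big_ord1 | rewrite (ua (fun=> b)) // big_ord1].
exists (fun=> e) => V h s; have [a [Ea ua]] := eP V h s; exists (fun=> a).
split=> [|b]; rewrite big_ord1 // => Eb.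
by apply/funext => i; rewrite ord1; exact: ua.
Qed.

Lemma osum_vector_bundle L M :
  line_bundle L -> line_bundle M -> vector_bundle 2 (osum L M).
Proof.
move=> /line_bundleP vL /line_bundleP vM p.
have [U [Up [e gen_e]]] := vL p; have [W [Wp [e' gen_e']]] := vM p.
exists (open_cap U W); split=> //.
pose basis (i : 'I_2) : sec (osum L M) (open_cap U W) :=
  if i == ord0 then (res (osub_capl U W) e, 0) else (0, res (osub_capr U W) e').
exists basis => V h s.
have hU : osub V U by move=> q /h[].
have hW : osub V W by move=> q /h[].
have basisE (a : 'I_2 -> OX V) :
    \sum_i a i *: res h (basis i) =
      (a ord0 *: res hU e, a ord_max *: res hW e').
  have -> : ord_max = fintype.lift ord0 ord0 :> 'I_2 by exact: val_inj.
  rewrite !big_ord_recl big_ord0 addr0 /basis /= /osum_res /= !res0.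
  rewrite (res_comp _ h hU) (res_comp _ h hW).
  by congr pair; rewrite /= scaler0 ?addr0 ?add0r.
have [a [Ea ua]] := gen_e V hU s.1; have [b [Eb ub]] := gen_e' V hW s.2.
exists (fun i => if i == ord0 then a else b); split.
  by rewrite basisE /= -Ea -Eb; case: s {Ea Eb ua ub}.
move=> c; rewrite basisE => E; apply/funext => i.
have [->|ne] := eqVneq i ord0; first by apply: ua; rewrite E.
have -> : i = ord_max by case: i ne => [[|[|//]] ?] // _; apply: val_inj.
by apply: ub; rewrite E.
Qed.

End Sheaves.

(** * Generic values of sections *)

Section GenericValues.
Variables (k : fieldType) (X : proj_variety k).
Hypothesis hdim : var_dim X 1.
Local Notation F := (cone_field X).
Local Notation eta := (generic_point hdim).
Implicit Types (A : point X -> F -> Prop) (U V : opens_of X) (z : F)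
    (D : divisor X).

(* The junk value 0 is used on the empty set only. *)
Definition generic_value U (s : {p : point X | U p} -> F) : F :=
  if pselect (U eta) is left Ue then s (exist _ eta Ue) else 0.

Lemma generic_valueE U (s : {p : point X | U p} -> F) (Ue : U eta) :
  generic_value s = s (exist _ eta Ue).
Proof.
by rewrite /generic_value; case: pselect => // ?; congr s;
  exact: sig_pt_inj.
Qed.

Lemma local_section_generic A U s : @local_section k X A U s ->
  forall y, s y = generic_value s /\ A (sval y) (generic_value s).
Proof.
move=> local_s y; have [V [Vy [z zP]]] := local_s y; have [-> Az] := zP y Vy.
have Ue := open_generic_point hdim (svalP y).
by rewrite (generic_valueE _ Ue)
  (zP (exist _ eta Ue) (open_generic_point hdim Vy)).1.
Qed.

Lemma local_section_const A U z :
  (forall q, U q -> A q z) -> @local_section k X A U (fun=> z).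
Proof.
move=> Az p; exists U; split; first exact: svalP.
by exists z => q Uq; split=> //; exact: Az.
Qed.

Definition OX_val U (a : OX U) : F := generic_value (OX_fun a).

Lemma OX_funE U (a : OX U) y : OX_fun a y = OX_val a.
Proof. by have [] := local_section_generic (OX_local a) y. Qed.

Lemma OX_val_regular U (a : OX U) q : U q -> regular_at q (OX_val a).
Proof.
by move=> Uq;
  have [] := local_section_generic (OX_local a) (exist _ q Uq).
Qed.

Lemma OX_eq_val U (a b : OX U) : (U eta -> OX_val a = OX_val b) -> a = b.
Proof.
move=> E; apply: val_inj; apply/funext => y /=; rewrite !OX_funE E //.
exact: open_generic_point (svalP y).
Qed.

Lemma OX_val_res U V (h : osub V U) (a : OX U) : V eta ->
  OX_val (OX_res h a) = OX_val a.
Proof.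
by move=> Ve; rewrite -(OX_funE _ (exist _ eta Ve));
  exact: (OX_funE a (incl h _)).
Qed.

Lemma OX_valM U (a b : OX U) : U eta -> OX_val (a * b) = OX_val a * OX_val b.
Proof. by move=> Ue; rewrite /OX_val !(generic_valueE _ Ue). Qed.

Lemma OX_valD U (a b : OX U) : U eta -> OX_val (a + b) = OX_val a + OX_val b.
Proof. by move=> Ue; rewrite /OX_val !(generic_valueE _ Ue). Qed.

Lemma OX_val1 U : U eta -> OX_val (1 : OX U) = 1.
Proof. by move=> Ue; rewrite /OX_val (generic_valueE _ Ue). Qed.

Definition OX_const U z (rz : forall q, U q -> regular_at q z) : OX U :=
  MkOX (asboolT (local_section_const rz)).

Lemma OX_val_const U z (rz : forall q, U q -> regular_at q z) : U eta ->
  OX_val (OX_const rz) = z.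
Proof. exact: generic_valueE. Qed.

Definition LD_val D U (s : LD_sec D U) : F := generic_value (LD_fun s).

Lemma LD_funE D U (s : LD_sec D U) y : LD_fun s y = LD_val s.
Proof. by have [] := local_section_generic (LD_local s) y. Qed.

Lemma LD_val_at D U (s : LD_sec D U) q : U q -> LD_at D q (LD_val s).
Proof.
by move=> Uq;
  have [] := local_section_generic (LD_local s) (exist _ q Uq).
Qed.

Lemma LD_eq_val D U (s t : LD_sec D U) :
  (U eta -> LD_val s = LD_val t) -> s = t.
Proof.
move=> E; apply: val_inj; apply/funext => y /=; rewrite !LD_funE E //.
exact: open_generic_point (svalP y).
Qed.

Lemma LD_val_res D U V (h : osub V U) (s : LD_sec D U) : V eta ->
  LD_val (res (o := LD D) h s) = LD_val s.
Proof.
by move=> Ve; rewrite -(LD_funE _ (exist _ eta Ve));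
  exact: (LD_funE s (incl h _)).
Qed.

Lemma LD_valD D U (s t : LD_sec D U) : U eta ->
  LD_val (s + t) = LD_val s + LD_val t.
Proof. by move=> Ue; rewrite /LD_val !(generic_valueE _ Ue). Qed.

Lemma LD_valZ D U (a : OX U) (s : LD_sec D U) : U eta ->
  LD_val (a *: s) = OX_val a * LD_val s.
Proof. by move=> Ue; rewrite /LD_val /OX_val !(generic_valueE _ Ue). Qed.

Lemma LD_val_linear D U (a : OX U) (s t : LD_sec D U) : U eta ->
  LD_val (a *: s + t) = OX_val a * LD_val s + LD_val t.
Proof. by move=> Ue; rewrite LD_valD // LD_valZ. Qed.

Lemma LD_val0 D U : LD_val (0 : LD_sec D U) = 0.
Proof. by rewrite /LD_val /generic_value; case: pselect. Qed.

Definition LD_const D U z (Dz : forall q, U q -> LD_at D q z) : LD_sec D U :=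
  MkLD (asboolT (local_section_const Dz)).

Lemma LD_val_const D U z (Dz : forall q, U q -> LD_at D q z) : U eta ->
  LD_val (LD_const Dz) = z.
Proof. exact: generic_valueE. Qed.

End GenericValues.

Arguments OX_eq_val {k X} hdim {U a b} _.
Arguments LD_eq_val {k X} hdim {D U s t} _.

(** * The line bundles L_D *)

Section Divisors.
Variables (k : fieldType) (X : proj_variety k).
Implicit Types (p q : point X) (z w t : cone_field X) (D E : divisor X).

Lemma clD D E : cl (D + E) = cl D + cl E.
Proof. by rewrite /cl raddfD. Qed.

Lemma clB D E : cl (D - E) = cl D - cl E.
Proof. by rewrite /cl raddfB. Qed.

Lemma clN D : cl (- D) = - cl D.
Proof. by rewrite /cl raddfN. Qed.

Lemma cl_eq0 D : cl D = 0 <-> principal_prop D.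
Proof.
have cl0 : @cl k X 0 = 0 by rewrite /cl raddf0.
rewrite -cl0 -[in X in _ <-> X](subr0 D); split=> [/eqP|pD].
  by rewrite /cl -Quotient.idealrBE => /asboolP.
by apply/eqP; rewrite /cl -Quotient.idealrBE; exact/asboolP.
Qed.

Lemma ratfun_exprz z (m : int) : z != 0 -> ratfun z -> ratfun (z ^ m).
Proof.
move=> z0 rz; have rzX (j : nat) : ratfun (z ^+ j).
  by elim: j => [|j IHj]; [exact: ratfun1 | rewrite exprS; exact: ratfunM].
by case: m => m; [|apply: ratfunV; [exact: expf_neq0|]]; exact: rzX.
Qed.

Lemma LD_at_mul D E q z w : LD_at D q z -> LD_at E q w ->
  LD_at (D + E) q (z * w).
Proof.
move=> [rz Dz] [rw Ew]; split=> [|c t ut]; first exact: ratfunM.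
rewrite raddfD /= expfzDr ?(uniformizer_neq0 ut) // mulrACA.
by apply: regularM; [exact: Dz | exact: Ew].
Qed.

Definition LD_generator D q e := [/\ e != 0, LD_at D q e & LD_at (- D) q e^-1].

Lemma LD_at_div D E q z e : LD_generator E q e ->
  LD_at (D + E) q z <-> LD_at D q (z / e).
Proof.
move=> [e0 Ee Ee']; split=> [Dz|Dz].
  by rewrite -[D](addrK E); exact: LD_at_mul.
by rewrite -[z](divfK e0); exact: LD_at_mul.
Qed.

Lemma LD_generator_unitM D q e u :
  unit_at q u -> LD_generator D q e -> LD_generator D q (u * e).
Proof.
move=> [u0 ru ru'] [e0 De De']; split; first exact: mulf_neq0.
  exact: LD_atM.
by rewrite invfM; exact: LD_atM.
Qed.

Lemma LD_generator_order D q z : ratfun z -> z != 0 ->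
  (forall c : closed_point_pred q, has_order q z (- coeff (ClosedPoint c) D)) ->
  LD_generator D q z.
Proof.
move=> rz z0 ord; split=> //; (split; first by [|exact: ratfunV]) => c t ut;
  have [u [_ ru ru'] ->] := ord c t ut; have t0 := uniformizer_neq0 ut.
- by rewrite mulrA -expfzDr // addrN expr0z mul1r.
- by rewrite invfM raddfN mulrA invr_expz opprK -expfzDr // addNr expr0z mul1r.
Qed.

Lemma has_order_LD_generator (P : closed_point X) D z :
  LD_generator D P z -> has_order P z (- coeff P D).
Proof.
case: P => p c [z0 [_ Dz] [_ Dz']] t ut; have t0 := uniformizer_neq0 ut.
exists (t ^ coeff (ClosedPoint c) D * z).
  split; [by rewrite mulf_neq0 ?expfz_neq0 | exact: (Dz c) |].
  by rewrite invfM invr_expz -raddfN; exact: (Dz' c).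
by rewrite mulrA -expfzDr // addNr expr0z mul1r.
Qed.

Definition LD_global D z := forall q, LD_at D q z.

Lemma LD_global_mul D E z w :
  LD_global D z -> LD_global E w -> LD_global (D + E) (z * w).
Proof. by move=> Dz Ew q; exact: LD_at_mul. Qed.

Lemma LD_globalB D z w : LD_global D z -> LD_global D w -> LD_global D (z - w).
Proof. by move=> Dz Dw q; exact: LD_atB. Qed.

End Divisors.

Section LineBundles.
Variables (k : finFieldType) (X : proj_variety k).
Hypotheses (hdim : var_dim X 1) (hsmooth : smooth_var X 1).
Local Notation I := (var_ideal X).
Local Notation S := {mpoly k[(amb_dim X).+1]}.
Local Notation F := (cone_field X).
Local Notation eta := (generic_point hdim).
Local Notation LD_val := (LD_val hdim).
Implicit Types (p q : point X) (U V : opens_of X) (z e t u : F)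
    (D E : divisor X).

Lemma cl_eq0P D : cl D = 0 <->
  exists z, [/\ z != 0, LD_global (- D) z & LD_global D z^-1].
Proof.
rewrite cl_eq0; split=> [[z [rz z0 ord]]|[z [z0 Dz Dz']]]; exists z.
  have gen q : LD_generator (- D) q z.
    apply: LD_generator_order => // c; rewrite raddfN opprK.
    exact: (ord (ClosedPoint c)).
  by split=> // q; have [_] := gen q; rewrite ?opprK.
split=> // [|P]; first by have [] := Dz eta.
rewrite -[D]opprK raddfN; apply: has_order_LD_generator.
by split=> //; rewrite opprK.
Qed.

Lemma LD_at0 q z : LD_at 0 q z <-> regular_at q z.
Proof.
split=> [[rz reg_z]|rz]; last first.
  split=> [|c t _]; first exact: regular_ratfun rz.
  by rewrite raddf0 expr0z mul1r.
have [cq|->] := point_cases hdim q; last exact/regular_at_generic_point.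
have [t ut] := exists_uniformizer hdim hsmooth cq.
by have := reg_z cq t ut; rewrite raddf0 expr0z mul1r.
Qed.

Lemma LD_generator_regular D q z e : LD_generator D q e ->
  LD_at D q z <-> regular_at q (z / e).
Proof. by move=> ge; rewrite -LD_at0 -(LD_at_div 0 _ ge) add0r. Qed.

Lemma unit_LD_generator D q u : unit_at q u ->
  (forall c : closed_point_pred q, coeff (ClosedPoint c) D = 0) ->
    LD_generator D q u.
Proof.
move=> [u0 ru ru'] D0; split=> //; split.
- exact: regular_ratfun ru.
- by move=> c t _; rewrite D0 expr0z mul1r.
- exact: regular_ratfun ru'.
- by move=> c t _; rewrite raddfN /= D0 oppr0 expr0z mul1r.
Qed.

Lemma exists_LD_generator D q : exists e, LD_generator D q e.
Proof.
have [cq|->] := point_cases hdim q; last first.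
  exists 1; apply: unit_LD_generator (unit_at1 _) _ => c.
  by case: (generic_point_not_closed c).
have [t ut] := exists_uniformizer hdim hsmooth cq.
have t0 := uniformizer_neq0 ut.
have rt := vanishing_regular (uniformizer_vanishing ut).
exists (t ^ (- coeff (ClosedPoint cq) D)); apply: LD_generator_order => [||c].
- exact/ratfun_exprz/(regular_ratfun rt).
- exact: expfz_neq0.
- rewrite (Prop_irrelevance c cq);
    apply: has_order_uniformizer ut (unit_at1 q) _.
  by rewrite mulr1.
Qed.

Lemma zariski_open_avoid (s : seq (closed_point X)) :
  zariski_open (fun q : point X => forall P, P \in s -> q <> cp_point P).
Proof.
move=> q; elim: s => [_|P s IHs qs].
  by exists 0%N, 1; split=> //; [exact: dhomog1 | exact: pt1].
have [|d [f [hf qf fs]]] := IHs; first by move=> P' P's; apply: qs;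
  rewrite inE P's orbT.
have [e [g [hg Pg qg]]] : exists (e : nat) (g : S),
    [/\ g \is e.-homog, cp_point P g & ~ q g].
  apply: contrapT => none; apply: (qs P); first by rewrite inE eqxx.
  have Pq g : cp_point P g -> q g.
    move=> Pg; apply: pt_components => e; apply: contrapT => qg; apply: none.
    by exists e, (pihomog mdeg e g); split=> //;
      [exact: pihomogP | exact: pt_pihomog].
  by apply: point_ext => g; split=> [|/Pq//]; exact: (cp_closed Pq).
exists (d + e)%N, (f * g); split; [exact: dhomogM | exact: pt_nmul |].
move=> q' q'fg P'; rewrite inE => /orP[/eqP-> E|P's].
  by apply: q'fg; rewrite E; exact: ptMl.
by apply: fs => // q'f; apply: q'fg; exact: ptMr.
Qed.
Definition open_avoid s : opens_of X := Open (@zariski_open_avoid s).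

Lemma unit_almost_everywhere z : ratfun z -> z != 0 ->
  exists s : seq (closed_point X), forall q, open_avoid s q -> unit_at q z.
Proof.
move=> [d [a [b [ha hb Ib Ez]]]] z0.
have Ia : a \notin I.
  by rewrite -cone_elt_eq0; apply: contraNneq z0 => a0; rewrite Ez a0 mul0r.
have Iab : a * b \notin I by rewrite prime_idealrM negb_or Ia.
have [s sP] := finite_zeros hdim hsmooth (dhomogM ha hb) Iab.
exists s => q qs; have qab : ~ q (a * b).
  move=> qab; have [cq|q_eta] := point_cases hdim q.
    by apply: (qs (ClosedPoint cq)) => //; exact: sP.
  by move: qab; rewrite q_eta; exact/negP.
have qa : ~ q a by move=> qa; apply: qab; exact: ptMr.
have qb : ~ q b by move=> qb; apply: qab; exact: ptMl.
split=> //; first by exists d, a, b.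
by exists d, b, a; split=> //; rewrite Ez invf_div.
Qed.

Lemma LD_generator_near D p : exists e U,
  U p /\ forall q, U q -> LD_generator D q e.
Proof.
have [e ge] := exists_LD_generator D p; have [e0 [re _] _] := ge.
have [s sP] := unit_almost_everywhere re e0.
pose s' := [seq P <- dom D ++ s | cp_point P != p :> {classic point X}].
exists e, (open_avoid s'); split=> [P|q qs'].
  by rewrite mem_filter => /andP[/eqP ne _] E; exact: ne.
have [->//|ne] := pselect (q = p).
have qs P : P \in dom D ++ s -> q <> cp_point P.
  move=> Ps E; apply: (qs' P) => //; rewrite mem_filter Ps andbT.
  by apply/eqP => EP; apply: ne; rewrite E EP.
apply: unit_LD_generator => [|c].
  by apply: sP => P Ps; apply: qs; rewrite mem_cat Ps orbT.
by apply: coeff_outdom; apply/negP => Dq; apply: (qs (ClosedPoint c) _ erefl);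
  rewrite mem_cat Dq.
Qed.

Definition LD_generator_section D U e
    (ge : forall q, U q -> LD_generator D q e) : sec (LD D) U :=
  LD_const (fun q Uq => let: And3 _ De _ := ge q Uq in De).

Lemma LD_free_generator D U e (ge : forall q, U q -> LD_generator D q e) :
  free_generator (LD_generator_section ge).
Proof.
move=> V h s.
have rs q (Vq : V q) : regular_at q (LD_val s / e).
  by apply/(LD_generator_regular _ (ge q (h q Vq))); exact: LD_val_at.
have val_e : V eta -> LD_val (res h (LD_generator_section ge)) = e.
  move=> Ve; rewrite LD_val_res // LD_val_const //.
  exact: open_generic_point (h _ Ve).
have e0 : V eta -> e != 0 by move=> /h/ge[].
exists (OX_const rs); split=> [|a Ea].
  apply: (LD_eq_val hdim) => Ve.
  by rewrite LD_valZ // val_e // OX_val_const // divfK ?e0.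
apply: (OX_eq_val hdim) => Ve.
by rewrite OX_val_const // Ea LD_valZ // val_e // mulfK ?e0.
Qed.

Lemma LD_line_bundle D : line_bundle (LD D).
Proof.
apply/line_bundleP => p; have [e [U [Up ge]]] := LD_generator_near D p.
by exists U; split=> //; exists (LD_generator_section ge);
  exact: LD_free_generator.
Qed.

End LineBundles.

Section LineBundleMorphisms.
Variables (k : finFieldType) (X : proj_variety k).
Hypotheses (hdim : var_dim X 1) (hsmooth : smooth_var X 1).
Local Notation eta := (generic_point hdim).
Local Notation LD_val := (LD_val hdim).
Local Notation OX_val := (OX_val hdim).
Implicit Types (U V : opens_of X) (z : cone_field X) (D E : divisor X).

Lemma LD_val_mul_at D E z U (s : LD_sec D U) : LD_global (E - D) z ->
  forall q, U q -> LD_at E q (z * LD_val s).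
Proof.
move=> Gz q Uq; rewrite -[E](subrK D).
by apply: LD_at_mul (Gz q) _; exact: LD_val_at.
Qed.

Definition LD_homothety D E z (Gz : LD_global (E - D) z) :
  omorphism (LD D) (LD E).
Proof.
apply: (@omorphism_of _ _ (LD D) (LD E)
  (fun U s => LD_const (LD_val_mul_at s Gz))).
- move=> U a s t; apply: (LD_eq_val hdim) => Ue.
  rewrite LD_val_const // [RHS]LD_val_linear // !LD_val_const //
    LD_val_linear //.
  by rewrite mulrDr mulrCA.
- move=> U V h s; apply: (LD_eq_val hdim) => Ve; have Ue := h _ Ve.
  by rewrite LD_val_const // [RHS]LD_val_res // LD_val_const // LD_val_res.
Defined.

Lemma LD_homothetyE D E z (Gz : LD_global (E - D) z) U (s : LD_sec D U) :
  U eta ->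
  LD_val (LD_homothety Gz U s) = z * LD_val s.
Proof. exact: LD_val_const. Qed.

Lemma oiso_LD D E : cl D = cl E -> oiso (LD D) (LD E).
Proof.
move=> clDE; have /(cl_eq0P hdim)[z [z0 Gz Gz']] : cl (D - E) = 0.
  by rewrite clB clDE subrr.
have {}Gz : LD_global (E - D) z by rewrite -opprB.
exists (LD_homothety Gz), (LD_homothety Gz') => U; split=> s;
  apply: (LD_eq_val hdim) => Ue; rewrite !LD_homothetyE //.
  by rewrite mulKf.
by rewrite mulVKf.
Qed.

Lemma oiso_structure_sheaf : oiso (structure_sheaf X) (LD 0).
Proof.
have aP U (a : OX U) q : U q -> LD_at 0 q (OX_val a).
  by move=> Uq; apply/(LD_at0 hdim hsmooth)/OX_val_regular.
have sP U (s : LD_sec 0 U) q : U q -> regular_at q (LD_val s).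
  by move=> Uq; apply/(LD_at0 hdim hsmooth)/LD_val_at.
pose f U (a : (OX U)^o) : sec (LD 0) U := LD_const (aP U a).
pose g U (s : LD_sec 0 U) : OX U := OX_const (sP U s).
have fK U : cancel (f U) (g U).
  by move=> a; apply: (OX_eq_val hdim) => Ue;
    rewrite OX_val_const ?LD_val_const.
have gK U : cancel (g U) (f U).
  by move=> s; apply: (LD_eq_val hdim) => Ue;
    rewrite LD_val_const ?OX_val_const.
have f_linear U : linear (f U).
  move=> a b c; apply: (LD_eq_val hdim) => Ue.
  rewrite LD_val_const // [RHS]LD_val_linear // !LD_val_const //.
  by rewrite OX_valD // OX_valM.
have f_res U V (h : osub V U) a : f V (OX_res h a) = LD_res h (f U a).
  apply: (LD_eq_val hdim) => Ve; have Ue := h _ Ve.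
  by rewrite LD_val_const // (LD_val_res h) // LD_val_const // OX_val_res.
pose f_mor := @omorphism_of _ _ (structure_sheaf X) (LD 0) f f_linear f_res.
apply: (oiso_bij (f := f_mor)).
- by move=> U; exact: can_inj (fK U).
- by move=> U s; exists (g U s); exact: gK.
Qed.

Lemma structure_sheaf_line_bundle : line_bundle (structure_sheaf X).
Proof.
apply: vector_bundle_oiso (oiso_sym oiso_structure_sheaf) _.
exact: LD_line_bundle.
Qed.

Lemma LD_hom_mul D E (g : omorphism (LD D) (LD E)) :
  exists2 z, LD_global (E - D) z &
  forall U (s : LD_sec D U), U eta -> LD_val (g U s) = z * LD_val s.
Proof.
have [e [U0 [U0e ge]]] := LD_generator_near hdim hsmooth D eta.
have e0 : e != 0 by have [] := ge _ U0e.
pose s0 := LD_generator_section ge; pose z := LD_val (g U0 s0) / e.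
have gE U (s : LD_sec D U) : U eta -> LD_val (g U s) = z * LD_val s.
  move=> Ue; pose V := open_cap U U0; have Ve : V eta by [].
  have [a [Ea _]] := LD_free_generator hdim hsmooth ge (osub_capr U U0)
    (res (o := LD D) (osub_capl U U0) s).
  have := congr1 (fun t : LD_sec D V => LD_val t) Ea.
  rewrite LD_valZ // !LD_val_res // LD_val_const // => ->.
  have := congr1 (fun t : LD_sec D V => LD_val (g V t)) Ea.
  rewrite linearZ /= !omap_res LD_valZ // !LD_val_res // => ->.
  by rewrite mulrCA mulfVK.
exists z => // q; have [e' [U [Uq ge']]] := LD_generator_near hdim hsmooth D q.
have [e'0 _ De'] := ge' q Uq; have Ue := open_generic_point hdim Uq.
rewrite -[z](mulfK e'0); apply: LD_at_mul De'.
have -> : e' = LD_val (LD_generator_section ge') by rewrite LD_val_const.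
by rewrite -gE //; exact: LD_val_at.
Qed.

End LineBundleMorphisms.

(** * The divisor of a line bundle *)

Lemma coeff_sum_undup (T : choiceType) (s : seq T) (m : T -> int) x :
  coeff x (\sum_(y <- undup s) << m y *g y >>) = if x \in s then m x else 0.
Proof.
rewrite raddf_sum /=; under eq_bigr => y _ do rewrite coeffU.
rewrite -mem_undup; case: ifPn => sx.
  rewrite (bigD1_seq x) ?undup_uniq //= eqxx mulr1 big1 ?addr0 // => y /negPf->.
  by rewrite mulr0.
rewrite big1_seq // => y /andP[_ sy]; case: eqP => [E|]; rewrite ?mulr0 //.
by rewrite -E sy in sx.
Qed.

Section LineBundleDivisor.
Variables (k : finFieldType) (X : proj_variety k).
Hypotheses (hdim : var_dim X 1) (hsmooth : smooth_var X 1).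
Local Notation F := (cone_field X).
Local Notation eta := (generic_point hdim).
Local Notation OX_val := (OX_val hdim).
Local Notation LD_val := (LD_val hdim).
Implicit Types (p q : point X) (U V W : opens_of X) (D : divisor X).

Variables (L : omodule X) (U0 : opens_of X) (e0 : sec L U0).
Hypotheses (U0e : U0 eta) (gen_e0 : free_generator e0).

Lemma generic_coord_subproof V (s : sec L V) : exists a : OX (open_cap V U0),
  res (osub_capl V U0) s = a *: res (osub_capr V U0) e0.
Proof.
by have [a [Ea _]] := gen_e0 (osub_capr V U0) (res (osub_capl V U0) s);
  exists a.
Qed.

(* The rational function s / e0. *)
Definition sec_ratio V (s : sec L V) : F :=
  OX_val (projT1 (cid (generic_coord_subproof s))).

Lemma sec_ratioE V (s : sec L V) W (hV : osub W V) (h0 : osub W U0) (a : OX W) :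
  W eta -> res hV s = a *: res h0 e0 -> sec_ratio s = OX_val a.
Proof.
rewrite /sec_ratio; case: cid => b /= Eb We Ea.
have hW : osub W (open_cap V U0) by move=> q Wq; split;
  [exact: (hV q) | exact: (h0 q)].
rewrite -(OX_val_res hW b We); congr OX_val.
apply: (free_generator_inj (h := h0) gen_e0).
by rewrite -Ea -(res_comp (osub_capl V U0) hW hV) Eb resZ (res_comp _ hW h0).
Qed.

Lemma sec_ratio_coord V (s : sec L V) : exists a : OX (open_cap V U0),
  res (osub_capl V U0) s = a *: res (osub_capr V U0) e0 /\
    sec_ratio s = OX_val a.
Proof. by rewrite /sec_ratio; case: cid => a /= Ea; exists a. Qed.

Lemma sec_ratio_linear V (a : OX V) (s t : sec L V) : V eta ->
  sec_ratio (a *: s + t) = OX_val a * sec_ratio s + sec_ratio t.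
Proof.
move=> Ve; have We : open_cap V U0 eta by [].
have [b [Eb ->]] := sec_ratio_coord s; have [c [Ec ->]] := sec_ratio_coord t.
rewrite -(OX_val_res (osub_capl V U0) a We) -OX_valM // -OX_valD //.
apply: (sec_ratioE (hV := osub_capl V U0) (h0 := osub_capr V U0)) => //.
by rewrite resD resZ Eb Ec scalerDl scalerA.
Qed.

Lemma sec_ratioZ V (a : OX V) (s : sec L V) : V eta ->
  sec_ratio (a *: s) = OX_val a * sec_ratio s.
Proof.
move=> Ve; have We : open_cap V U0 eta by [].
have [b [Eb ->]] := sec_ratio_coord s.
rewrite -(OX_val_res (osub_capl V U0) a We) -OX_valM //.
apply: (sec_ratioE (hV := osub_capl V U0) (h0 := osub_capr V U0)) => //.
by rewrite resZ Eb scalerA.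
Qed.

Lemma sec_ratio_res V W (h : osub W V) (s : sec L V) : W eta ->
  sec_ratio (res h s) = sec_ratio s.
Proof.
move=> We; have [a [Ea ->]] := sec_ratio_coord (res h s).
have We' : open_cap W U0 eta by [].
have hV : osub (open_cap W U0) V by move=> q [/h].
apply/esym; apply: (sec_ratioE (hV := hV) (h0 := osub_capr W U0)) => //.
by rewrite -Ea (res_comp _ _ hV).
Qed.

Lemma sec_ratio_base : sec_ratio e0 = 1.
Proof.
rewrite -(OX_val1 U0e);
  apply: (@sec_ratioE _ _ _ (osub_refl U0) (osub_refl U0)) => //.
by rewrite scale1r.
Qed.

Lemma sec_ratio_generator_neq0 U (e : sec L U) : U eta -> free_generator e ->
  sec_ratio e != 0.
Proof.
move=> Ue gen_e; have We : open_cap U U0 eta by [].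
have [a [Ea _]] := gen_e _ (osub_capl U U0) (res (osub_capr U U0) e0).
have E : 1 = OX_val a * sec_ratio e.
  by rewrite -(sec_ratio_res (osub_capl U U0) e We) -sec_ratioZ // -Ea
    sec_ratio_res ?sec_ratio_base.
by apply: contra_eq_neq E => ->; rewrite mulr0 oner_neq0.
Qed.

Lemma sec_ratio_generator_regular U (e : sec L U) V (s : sec L V) q :
  U q -> V q -> free_generator e -> regular_at q (sec_ratio s / sec_ratio e).
Proof.
move=> Uq Vq gen_e; have Wq : open_cap V U q by [].
have Ue := open_generic_point hdim Uq; have We := open_generic_point hdim Wq.
have [a [Ea _]] := gen_e _ (osub_capr V U) (res (osub_capl V U) s).
rewrite -(sec_ratio_res (osub_capl V U) s We) Ea sec_ratioZ // sec_ratio_res //.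
by rewrite mulfK ?sec_ratio_generator_neq0 //; exact: OX_val_regular.
Qed.

Lemma sec_ratio_generator_unit U (e : sec L U) V (e' : sec L V) q :
  U q -> V q -> free_generator e -> free_generator e' ->
    unit_at q (sec_ratio e' / sec_ratio e).
Proof.
move=> Uq Vq gen_e gen_e'; have Ue := open_generic_point hdim Uq.
have Ve := open_generic_point hdim Vq.
split; first by rewrite mulf_neq0 ?invr_eq0 ?sec_ratio_generator_neq0.
  exact: sec_ratio_generator_regular.
by rewrite invf_div; exact: sec_ratio_generator_regular.
Qed.

Variables (U : point X -> opens_of X) (e : forall p, sec L (U p)).
Hypotheses (Upp : forall p, U p p) (gen_e : forall p, free_generator (e p)).

Let Ue p : U p eta := open_generic_point hdim (Upp p).

Lemma sec_ratio_inj V (s t : sec L V) :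
  (V eta -> sec_ratio s = sec_ratio t) -> s = t.
Proof.
move=> E; apply: sec_eq_near => p Vp.
exists (open_cap V (U p)), (osub_capl V (U p)); split; first by split.
have Ve := open_generic_point hdim Vp; have We : open_cap V (U p) eta by split.
have [a [Ea _]] := gen_e (osub_capr V (U p)) (res (osub_capl V (U p)) s).
have [b [Eb _]] := gen_e (osub_capr V (U p)) (res (osub_capl V (U p)) t).
rewrite Ea Eb; congr (_ *: _); apply: (OX_eq_val hdim) => _.
apply: (mulIf (sec_ratio_generator_neq0 (Ue p) (@gen_e p))).
by rewrite -!(sec_ratio_res (osub_capr V (U p)) (e p) We) -!sec_ratioZ // -Ea
  -Eb !sec_ratio_res ?E.
Qed.

Lemma ratfun_sec_ratio_generator p : ratfun (sec_ratio (e p)).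
Proof.
apply/(regular_at_generic_point hdim);
  rewrite -[sec_ratio _]divr1 -sec_ratio_base.
exact: sec_ratio_generator_regular.
Qed.

(* The order of e p vanishes at the points of U0, and only finitely many
   points lie outside U0. *)
Lemma exists_sec_ratio_divisor : exists D : divisor X,
  forall p q, U p q -> LD_generator D q (sec_ratio (e p)).
Proof.
have e_neq0 p := sec_ratio_generator_neq0 (Ue p) (@gen_e p).
have [d [f [hf ef U0f]]] := open_setP U0e.
have [s sP] := finite_zeros hdim hsmooth hf (introN idP ef).
have /choice[m mP] (P : closed_point X) :
    exists m, has_order P (sec_ratio (e P)) m.
  by apply: (exists_order hdim hsmooth);
    [exact: cp_closed | exact: ratfun_sec_ratio_generator |].
exists (\sum_(P <- undup s) << - m P *g P >>) => p q Upq.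
have gen_q :
  LD_generator (\sum_(P <- undup s) << - m P *g P >>) q (sec_ratio (e q)).
  apply: LD_generator_order => // [|c]; first exact: ratfun_sec_ratio_generator.
  rewrite coeff_sum_undup; case: ifPn => Ps; first by rewrite opprK;
    exact: (mP (ClosedPoint c)).
  rewrite oppr0 => t _; exists (sec_ratio (e q)); last by rewrite expr0z mul1r.
  rewrite -[sec_ratio _]divr1 -sec_ratio_base;
    apply: sec_ratio_generator_unit => //.
  by apply: U0f => qf; case/negP: Ps; exact: (sP (ClosedPoint c)).
rewrite -[sec_ratio (e p)](divfK (e_neq0 q)); apply: LD_generator_unitM gen_q.
exact: sec_ratio_generator_unit.
Qed.

Variable D : divisor X.
Hypothesis sec_ratio_D : forall p q, U p q ->
  LD_generator D q (sec_ratio (e p)).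

Lemma sec_ratio_LD_at V (s : sec L V) q : V q -> LD_at D q (sec_ratio s).
Proof.
move=> Vq; apply/(LD_generator_regular hdim hsmooth _ (sec_ratio_D (Upp q))).
exact: sec_ratio_generator_regular.
Qed.

Definition sec_ratio_map : omorphism L (LD D).
Proof.
apply: (@omorphism_of _ _ L (LD D)
  (fun V s => LD_const (@sec_ratio_LD_at V s))).
- move=> V a s t; apply: (LD_eq_val hdim) => Ve.
  by rewrite LD_val_const // [RHS]LD_val_linear // !LD_val_const //
    sec_ratio_linear.
- move=> V W h s; apply: (LD_eq_val hdim) => We; have Ve := h _ We.
  by rewrite LD_val_const // [RHS]LD_val_res // LD_val_const // sec_ratio_res.
Defined.

Lemma sec_ratio_mapE V (s : sec L V) : V eta ->
  LD_val (sec_ratio_map V s) = sec_ratio s.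
Proof. exact: LD_val_const. Qed.

Lemma sec_ratio_surj V (x : LD_sec D V) :
  exists s : sec L V, V eta -> sec_ratio s = LD_val x.
Proof.
pose W p := open_cap V (U p).
have rx p q : W p q -> regular_at q (LD_val x / sec_ratio (e p)).
  move=> [Vq Uq]; apply/(LD_generator_regular hdim hsmooth _ (sec_ratio_D Uq)).
  exact: LD_val_at.
pose s p : sec L (W p) := OX_const (rx p) *: res (osub_capr V (U p)) (e p).
have sec_ratio_s p : W p eta -> sec_ratio (s p) = LD_val x.
  move=> We; rewrite sec_ratioZ // OX_val_const // sec_ratio_res // divfK //.
  exact: sec_ratio_generator_neq0 (Ue p) (@gen_e p).
have [p q W' hp hq|t tE] := sec_glue_near (s := s) Upp.
  apply: sec_ratio_inj => We'; rewrite !sec_ratio_res // !sec_ratio_s //.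
    exact: hq.
  exact: hp.
exists t => Ve; have We : W eta eta by split; [|exact: Upp].
by rewrite -(sec_ratio_res (osub_capl V (U eta)) t We) tE sec_ratio_s.
Qed.

Lemma sec_ratio_oiso : oiso L (LD D).
Proof.
apply: (oiso_bij (f := sec_ratio_map)) => V.
  move=> s t E; apply: sec_ratio_inj => Ve; rewrite -!sec_ratio_mapE //.
  by rewrite E.
move=> x; have [s sE] := sec_ratio_surj x; exists s.
by apply: (LD_eq_val hdim) => Ve; rewrite sec_ratio_mapE // sE.
Qed.

End LineBundleDivisor.

Lemma line_bundle_oiso_LD (k : finFieldType) (X : proj_variety k)
    (L : omodule X) :
  var_dim X 1 -> smooth_var X 1 -> line_bundle L -> exists D, oiso L (LD D).
Proof.
move=> hdim hsmooth /line_bundleP vL.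
have /choice[u uP] p : exists u : {U : opens_of X & sec L U},
    tag u p /\ free_generator (tagged u).
  by have [U [Up [e gen_e]]] := vL p; exists (Tagged (fun U => sec L U) e).
have Upp p : tag (u p) p := proj1 (uP p).
have gen_u p : free_generator (tagged (u p)) := proj2 (uP p).
have [D sec_ratio_D] :=
  exists_sec_ratio_divisor hsmooth (Upp (generic_point hdim)) (gen_u _) Upp
    gen_u.
by exists D; exact: sec_ratio_oiso sec_ratio_D.
Qed.

(** * Tensor products *)

Section Bilinear.
Variables (k : fieldType) (X : proj_variety k).
Implicit Types (U V : opens_of X) (E L T M : omodule X).

Lemma obilZl E L T (b : obilinear E L T) U (a : OX U) s l :
  b U (a *: s) l = a *: b U s l.
Proof. exact: (GRing.scalable_linear (obil_l b (U := U) l)). Qed.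

Lemma obilZr E L T (b : obilinear E L T) U (a : OX U) s l :
  b U s (a *: l) = a *: b U s l.
Proof. exact: (GRing.scalable_linear (obil_r b (U := U) s)). Qed.

Definition obil_comp E L T E' L' T' (b : obilinear E L T) (u : omorphism E' E)
  (v : omorphism L' L) (w : omorphism T T') : obilinear E' L' T'.
Proof.
apply: (@OBilinear _ _ E' L' T' (fun U s l => w U (b U (u U s) (v U l)))).
- by move=> U l a s t; rewrite linearP (obil_l b) linearP.
- by move=> U s a l m; rewrite linearP (obil_r b) linearP.
- by move=> U V h s l; rewrite !omap_res obil_res omap_res.
Defined.

Definition universal_bilinear E L T (b : obilinear E L T) :=
  forall (M : omodule X) (c : obilinear E L M), exists f : omorphism T M,
    (forall U s l, f U (b U s l) = c U s l) /\
    (forall g : omorphism T M, (forall U s l, g U (b U s l) = c U s l) ->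
       forall U x, g U x = f U x).

Lemma universal_bilinear_ext E L T (b : obilinear E L T) M
    (f g : omorphism T M) :
  universal_bilinear b -> (forall U s l, f U (b U s l) = g U (b U s l)) ->
  forall U x, f U x = g U x.
Proof.
move=> bU fg U x; have [h [_ h_unique]] := bU M (obil_comp b (oid E) (oid L) f).
by rewrite (h_unique f) // (h_unique g) // => V s l; rewrite -fg.
Qed.

Lemma otensor_unique E L T T' : is_otensor E L T -> is_otensor E L T' ->
  oiso T T'.
Proof.
move=> [b bU] [b' bU']; have [f [fb _]] := bU T' b'; have [g [gb _]] := bU' T b.
exists f, g => U; split=> x.
  by apply: (universal_bilinear_ext (f := ocomp g f) (g := oid T) bU) =>
    V s l /=; rewrite fb gb.
by apply: (universal_bilinear_ext (f := ocomp f g) (g := oid T') bU') =>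
  V s l /=; rewrite gb fb.
Qed.

Lemma otensor_oiso E L T E' L' T' : is_otensor E L T ->
  oiso E E' -> oiso L L' -> oiso T T' -> is_otensor E' L' T'.
Proof.
move=> [b bU] [u [u' uu']] [v [v' vv']] [w [w' ww']].
exists (obil_comp b u' v' w) => M c.
have [f [fb f_unique]] := bU M (obil_comp c u v (oid M)).
exists (ocomp f w'); split=> [U s l|g gb U x] /=.
  have [_ u'K] := uu' U; have [_ v'K] := vv' U; have [wK _] := ww' U.
  by rewrite wK fb /= u'K v'K.
have [_ w'K] := ww' U; rewrite -{1}[x]w'K.
apply: (f_unique (ocomp g w)) => V s l /=.
have [uK _] := uu' V; have [vK _] := vv' V.
by rewrite -[in LHS](uK s) -[in LHS](vK l); exact: gb.
Qed.

End Bilinear.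

Section LocalCriterion.
Variables (k : fieldType) (X : proj_variety k).
Implicit Types (p q : point X) (V W : opens_of X).

Variables (E L T : omodule X) (b : obilinear E L T).
Variables (U : point X -> opens_of X) (e : forall p, sec L (U p)).
Hypothesis Upp : forall p, U p p.
Hypothesis gen_e : forall p, free_generator (e p).
Hypothesis b_inj : forall p V (h : osub V (U p)),
  injective (fun s => b V s (res h (e p))).
Hypothesis b_surj : forall p V (h : osub V (U p)) x,
  exists s, b V s (res h (e p)) = x.

Section Extension.
Variables (M : omodule X) (c : obilinear E L M).

(* The image of x is glued from the sections c s e_p with x = b s e_p. *)
Definition extension_image V (x : sec T V) (m : sec M V) :=
  forall W (h : osub W V) s l, res h x = b W s l -> res h m = c W s l.

Lemma obil_factor p V (h : osub V (U p)) s l s' l' :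
  b V s l = b V s' l' -> c V s l = c V s' l'.
Proof.
have [a [-> _]] := gen_e h l; have [a' [-> _]] := gen_e h l'.
by rewrite !obilZr -!obilZl => /b_inj ->.
Qed.

Lemma b_local V (x : sec T V) p :
  exists s, b _ s (res (osub_capr V (U p)) (e p)) = res (osub_capl V (U p)) x.
Proof. exact: b_surj. Qed.

Lemma extension_image_unique V (x : sec T V) (m m' : sec M V) :
    extension_image x m ->
    (forall p, V p -> exists W (h : osub W V), W p /\
      exists s l, res h x = b W s l /\ res h m' = c W s l) ->
  m = m'.
Proof.
move=> im_m local_m'; apply: sec_eq_near => p Vp.
have [W [h [Wp [s [l [Ex Em']]]]]] := local_m' p Vp.
by exists W, h; rewrite Em'; split=> //; exact: im_m.
Qed.

Lemma exists_extension_image V (x : sec T V) : exists m, extension_image x m.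
Proof.
pose s p := projT1 (cid (b_local x p)).
have sP p : b _ (s p) (res (osub_capr V (U p)) (e p)) =
  res (osub_capl V (U p)) x.
  by rewrite /s; case: cid.
pose m p := c _ (s p) (res (osub_capr V (U p)) (e p)).
have [p q W hp hq|t tE] := sec_glue_near (s := m) Upp.
  have hU : osub W (U p) by move=> r /hp[].
  have hV : osub W V by move=> r /hp[].
  rewrite -!obil_res; apply: (obil_factor hU).
  by rewrite !obil_res !sP !(res_comp _ _ hV).
exists t => W h s' l Ex; apply: sec_eq_near => p Wp.
exists (open_cap W (U p)), (osub_capl W (U p)); split; first by split.
have hWV : osub (open_cap W (U p)) (open_cap V (U p)) by move=> q [/h].
have hV : osub (open_cap W (U p)) V by move=> q [/h].
rewrite (res_comp h _ hV) -(res_comp (osub_capl V (U p)) hWV hV) tE -!obil_res.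
apply: (obil_factor (osub_capr W (U p))); rewrite !obil_res sP -Ex.
by rewrite !(res_comp _ _ hV).
Qed.

Lemma bilinear_extension : exists f : omorphism T M,
  (forall V s l, f V (b V s l) = c V s l) /\
  (forall g : omorphism T M, (forall V s l, g V (b V s l) = c V s l) ->
     forall V x, g V x = f V x).
Proof.
pose im V (x : sec T V) := projT1 (cid (exists_extension_image x)).
have imP V (x : sec T V) : extension_image x (im V x) by rewrite /im; case: cid.
have im_eq V (x : sec T V) m : (forall p, V p -> exists s,
    b _ s (res (osub_capr V (U p)) (e p)) = res (osub_capl V (U p)) x /\
    c _ s (res (osub_capr V (U p)) (e p)) = res (osub_capl V (U p)) m) ->
      im V x = m.
  move=> local_m; apply: extension_image_unique (imP V x) _ => p Vp.
  exists (open_cap V (U p)), (osub_capl V (U p)); split; first by split.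
  by have [s [<- <-]] := local_m p Vp;
    exists s, (res (osub_capr V (U p)) (e p)).
have im_local V (x : sec T V) p s :
    b _ s (res (osub_capr V (U p)) (e p)) = res (osub_capl V (U p)) x ->
    c _ s (res (osub_capr V (U p)) (e p)) = res (osub_capl V (U p)) (im V x).
  by move=> Ex; apply/esym/(imP V x).
have im_linear V : linear (im V).
  move=> a x y; apply: im_eq => p Vp.
  have [s sx] := b_local x p; have [t ty] := b_local y p.
  exists (OX_res (osub_capl V (U p)) a *: s + t).
  rewrite (obil_l b) (obil_l c) !resD !resZ sx ty.
  by rewrite (im_local _ _ _ _ sx) (im_local _ _ _ _ ty).
have im_res V W (h : osub W V) x : im W (res h x) = res h (im V x).
  apply: im_eq => p Wp; have [s sx] := b_local (res h x) p; exists s;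
    split=> //.
  have hV : osub (open_cap W (U p)) V by move=> q [/h].
  by rewrite (res_comp h _ hV); apply/esym/(imP V x);
    rewrite sx (res_comp h _ hV).
have im_b V s l : im V (b V s l) = c V s l.
  by have := imP V (b V s l) V (osub_refl V) s l (res_id _ _); rewrite res_id.
exists (omorphism_of im_linear im_res); split=> // g gb V x;
  apply/esym/im_eq => p Vp.
by have [s sx] := b_local x p; exists s; rewrite -gb sx omap_res.
Qed.

End Extension.

Lemma otensor_of_local_bijection : is_otensor E L T.
Proof. by exists b => M c; exact: bilinear_extension. Qed.

End LocalCriterion.

Section LineBundleTensor.
Variables (k : finFieldType) (X : proj_variety k).
Hypotheses (hdim : var_dim X 1) (hsmooth : smooth_var X 1).
Local Notation eta := (generic_point hdim).
Local Notation LD_val := (LD_val hdim).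
Implicit Types (U V : opens_of X) (a b A D : divisor X).

Lemma LD_val_at_mul D A U (s : LD_sec D U) (l : LD_sec A U) :
  forall q, U q -> LD_at (D + A) q (LD_val s * LD_val l).
Proof. by move=> q Uq; apply: LD_at_mul; exact: LD_val_at. Qed.

Definition LD_mul D A : obilinear (LD D) (LD A) (LD (D + A)).
Proof.
apply: (@OBilinear _ _ (LD D) (LD A) (LD (D + A))
  (fun U s l => LD_const (LD_val_at_mul s l))).
- move=> U l a s t; apply: (LD_eq_val hdim) => Ue.
  rewrite LD_val_const // [RHS]LD_val_linear // !LD_val_const //
    LD_val_linear //.
  by rewrite mulrDl mulrA.
- move=> U s a l m; apply: (LD_eq_val hdim) => Ue.
  rewrite LD_val_const // [RHS]LD_val_linear // !LD_val_const //
    LD_val_linear //.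
  by rewrite mulrDr mulrCA.
- move=> U V h s l; apply: (LD_eq_val hdim) => Ve; have Ue := h _ Ve.
  by rewrite LD_val_const // [RHS]LD_val_res // LD_val_const // !LD_val_res.
Defined.

Lemma LD_mulE D A U (s : LD_sec D U) (l : LD_sec A U) : U eta ->
  LD_val (LD_mul D A U s l) = LD_val s * LD_val l.
Proof. exact: LD_val_const. Qed.

Section MulGenerator.
Variables (A : divisor X) (U : opens_of X) (e : cone_field X).
Hypothesis ge : forall q, U q -> LD_generator A q e.
Variables (D : divisor X) (V : opens_of X) (h : osub V U).
Local Notation e_sec := (res h (LD_generator_section ge)).

Let val_e : V eta -> LD_val (e_sec : LD_sec A V) = e.
Proof.
by move=> Ve; rewrite LD_val_res // LD_val_const //;
  exact: open_generic_point (h Ve).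
Qed.

Let e_neq0 : V eta -> e != 0. Proof. by move=> /h/ge[]. Qed.

Lemma LD_mul_generator_inj : injective (fun s => LD_mul D A V s e_sec).
Proof.
move=> s t E; apply: (LD_eq_val hdim) => Ve.
apply: (mulIf (e_neq0 Ve)); rewrite -(val_e Ve) -!LD_mulE //.
by rewrite E.
Qed.

Lemma LD_mul_generator_surj (x : LD_sec (D + A) V) :
  exists s, LD_mul D A V s e_sec = x.
Proof.
have Dx q : V q -> LD_at D q (LD_val x / e).
  by move=> Vq; apply/(LD_at_div D _ (ge (h Vq))); exact: LD_val_at.
exists (LD_const Dx); apply: (LD_eq_val hdim) => Ve.
by rewrite LD_mulE // LD_val_const // val_e // divfK ?e_neq0.
Qed.

End MulGenerator.

Definition split_bundle a b : omodule X := osum (LD a) (LD b).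

Definition split_mul a b A :
  obilinear (split_bundle a b) (LD A) (split_bundle (a + A) (b + A)).
Proof.
apply: (@OBilinear _ _ (split_bundle a b) (LD A) (split_bundle (a + A) (b + A))
  (fun U s l => (LD_mul a A U s.1 l, LD_mul b A U s.2 l))).
- by move=> U l r s t; rewrite !(obil_l (LD_mul _ _)).
- by move=> U s r l m; rewrite !(obil_r (LD_mul _ _)).
- by move=> U V h s l; rewrite !(obil_res (LD_mul _ _)).
Defined.

Lemma split_bundle_otensor a b A :
  is_otensor (split_bundle a b) (LD A) (split_bundle (a + A) (b + A)).
Proof.
have /choice[e /choice[U UP]] := LD_generator_near hdim hsmooth A.
have ge p q (Uq : U p q) : LD_generator A q (e p) := proj2 (UP p) q Uq.
apply: (@otensor_of_local_bijection _ _ _ _ _ (split_mul a b A) U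
  (fun p => LD_generator_section (ge p))).
- by move=> p; have [] := UP p.
- by move=> p; exact: (LD_free_generator hdim hsmooth).
- move=> p V h [s1 s2] [t1 t2] E; congr pair.
    exact: (LD_mul_generator_inj (ge := ge p) (h := h) (congr1 fst E)).
  exact: (LD_mul_generator_inj (ge := ge p) (h := h) (congr1 snd E)).
- move=> p V h [x1 x2]; have [s1 E1] := LD_mul_generator_surj (ge p) h x1.
  have [s2 E2] := LD_mul_generator_surj (ge p) h x2.
  by exists (s1, s2); congr pair; [exact: E1 | exact: E2].
Qed.

End LineBundleTensor.

(** * Isomorphism classes of decomposable bundles *)

Lemma det2_inverse (K : fieldType) (w11 w12 w21 w22 z11 z12 z21 z22 : K) :
  w11 * z11 + w12 * z21 = 1 -> w11 * z12 + w12 * z22 = 0 ->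
  w21 * z11 + w22 * z21 = 0 -> w21 * z12 + w22 * z22 = 1 ->
  (w11 * w22 - w12 * w21) * (z11 * z22 - z12 * z21) = 1.
Proof.
move=> E11 E12 E21 E22.
transitivity ((w11 * z11 + w12 * z21) * (w21 * z12 + w22 * z22) -
  (w11 * z12 + w12 * z22) * (w21 * z11 + w22 * z21)); first by ring.
by rewrite E11 E22 E12 mul0r subr0 mulr1.
Qed.

Section Classification.
Variables (k : finFieldType) (X : proj_variety k).
Hypotheses (hdim : var_dim X 1) (hsmooth : smooth_var X 1).
Local Notation eta := (generic_point hdim).
Local Notation LD_val := (LD_val hdim).
Implicit Types (p : point X) (U V : opens_of X) (a b c d A B D : divisor X).
Implicit Types (z w u : cone_field X) (E : omodule X).

(* The product z1 z2 w is a regular function on X, hence a unit, so 1 / z1 is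
   a global section of L_(-A). *)
Lemma cl_eq0_of_global_mul A B z1 z2 w : z1 != 0 -> z2 != 0 -> w != 0 ->
  LD_global A z1 -> LD_global B z2 -> LD_global (- (A + B)) w -> cl A = 0.
Proof.
move=> z10 z20 w0 Az1 Bz2 ABw; pose u := z1 * z2 * w.
have u0 : u != 0 by rewrite !mulf_neq0.
have ru p : regular_at p u.
  by rewrite -(LD_at0 hdim hsmooth) -(subrr (A + B)); do !apply: LD_at_mul.
have ru' : LD_global 0 u^-1.
  by move=> p; apply/(LD_at0 hdim hsmooth);
    have [] := global_regular_unit ru u0 p.
apply/eqP; rewrite -oppr_eq0 -clN; apply/eqP/(cl_eq0P hdim).
exists z1; split=> //; first by rewrite opprK.
have -> : - A = B + - (A + B) + 0 by rewrite addr0 opprD addrCA subrr addr0.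
have -> : z1^-1 = z2 * w * u^-1.
  by rewrite /u -[z1 * z2 * w]mulrA invfM mulrCA mulfV ?mulr1 // mulf_neq0.
by do !apply: LD_global_mul.
Qed.

Lemma exists_LD_val_neq0 D : exists U (s : LD_sec D U), U eta /\ LD_val s != 0.
Proof.
have [e [U [Ue ge]]] := LD_generator_near hdim hsmooth D eta.
exists U, (LD_generator_section ge); rewrite LD_val_const //.
by split=> //; have [] := ge _ Ue.
Qed.

Definition split_matrix a b c d
    (f : omorphism (split_bundle a b) (split_bundle c d))
    z11 z12 z21 z22 :=
  forall U (s : LD_sec a U) (t : LD_sec b U), U eta ->
    LD_val (f U (s, t)).1 = z11 * LD_val s + z12 * LD_val t /\
    LD_val (f U (s, t)).2 = z21 * LD_val s + z22 * LD_val t.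

Lemma exists_split_matrix a b c d
    (f : omorphism (split_bundle a b) (split_bundle c d)) :
  exists z11 z12 z21 z22, split_matrix f z11 z12 z21 z22 /\
    [/\ LD_global (c - a) z11, LD_global (c - b) z12,
        LD_global (d - a) z21 & LD_global (d - b) z22].
Proof.
have [z11 Gz11 f11] :=
  LD_hom_mul hdim hsmooth (ocomp (ofst _ _) (ocomp f (oinl _ _))).
have [z12 Gz12 f12] :=
  LD_hom_mul hdim hsmooth (ocomp (ofst _ _) (ocomp f (oinr _ _))).
have [z21 Gz21 f21] :=
  LD_hom_mul hdim hsmooth (ocomp (osnd _ _) (ocomp f (oinl _ _))).
have [z22 Gz22 f22] :=
  LD_hom_mul hdim hsmooth (ocomp (osnd _ _) (ocomp f (oinr _ _))).
exists z11, z12, z21, z22; split=> // U s t Ue.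
have -> : f U (s, t) = f U (s, 0) + f U (0, t).
  by rewrite -linearD; congr (f U _); congr pair; rewrite /= ?addr0 ?add0r.
by rewrite !LD_valD // -f11 // -f12 // -f21 // -f22.
Qed.

Lemma split_matrix_inverse a b c d f g z11 z12 z21 z22 w11 w12 w21 w22 :
  @split_matrix a b c d f z11 z12 z21 z22 ->
    @split_matrix c d a b g w11 w12 w21 w22 ->
  (forall U, cancel (f U) (g U)) ->
  (w11 * w22 - w12 * w21) * (z11 * z22 - z12 * z21) = 1.
Proof.
move=> fz gw fK.
have gf U (s : LD_sec a U) (t : LD_sec b U) : U eta ->
    LD_val s = w11 * (z11 * LD_val s + z12 * LD_val t) +
               w12 * (z21 * LD_val s + z22 * LD_val t) /\
    LD_val t = w21 * (z11 * LD_val s + z12 * LD_val t) +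
               w22 * (z21 * LD_val s + z22 * LD_val t).
  move=> Ue; have [<- <-] := fz U s t Ue.
  by have := gw U (f U (s, t)).1 (f U (s, t)).2 Ue;
    rewrite -surjective_pairing fK.
have [U [s [Ue s0]]] := exists_LD_val_neq0 a.
have [V [t [Ve t0]]] := exists_LD_val_neq0 b.
have [] := gf U s 0 Ue; rewrite LD_val0 !mulr0 !addr0 => s1 s2.
have [] := gf V 0 t Ve; rewrite LD_val0 !mulr0 !add0r => t1 t2.
apply: det2_inverse.
- by apply: (mulIf s0); rewrite mul1r [RHS]s1 mulrDl !mulrA.
- by apply: (mulIf t0); rewrite mul0r [RHS]t1 mulrDl !mulrA.
- by apply: (mulIf s0); rewrite mul0r [RHS]s2 mulrDl !mulrA.
- by apply: (mulIf t0); rewrite mul1r [RHS]t2 mulrDl !mulrA.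
Qed.

Lemma cl_eq_of_diagonal a b c d z1 z2 w : z1 != 0 -> z2 != 0 -> w != 0 ->
  LD_global (c - a) z1 -> LD_global (d - b) z2 ->
    LD_global (a - c + (b - d)) w ->
  cl a = cl c /\ cl b = cl d.
Proof.
move=> z10 z20 w0 Gz1 Gz2; rewrite -[a - c]opprB -[b - d]opprB -opprD => Gw.
have := cl_eq0_of_global_mul z10 z20 w0 Gz1 Gz2 Gw.
rewrite addrC in Gw; have := cl_eq0_of_global_mul z20 z10 w0 Gz2 Gz1 Gw.
by rewrite !clB => /subr0_eq -> /subr0_eq ->.
Qed.

Lemma oiso_split_bundle a b c d :
  oiso (split_bundle a b) (split_bundle c d) ->
  (cl a = cl c /\ cl b = cl d) \/ (cl a = cl d /\ cl b = cl c).
Proof.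
move=> [f [g fg]].
have [z11 [z12 [z21 [z22 [fz [Gz11 Gz12 Gz21 Gz22]]]]]] :=
  exists_split_matrix f.
have [w11 [w12 [w21 [w22 [gw [Gw11 Gw12 Gw21 Gw22]]]]]] :=
  exists_split_matrix g.
have detE := split_matrix_inverse fz gw (fun U => proj1 (fg U)).
set dw := w11 * w22 - w12 * w21 in detE.
have dw0 : dw != 0 by apply: contra_eq_neq detE => ->;
  rewrite mul0r eq_sym oner_eq0.
have Gdw : LD_global (a - c + (b - d)) dw.
  apply: LD_globalB; first exact: LD_global_mul.
  by rewrite addrACA [- c - d]addrC addrACA; exact: LD_global_mul.
have [E|] := eqVneq (z11 * z22) 0; last first.
  rewrite mulf_eq0 negb_or => /andP[z110 z220]; left.
  exact: cl_eq_of_diagonal z110 z220 dw0 Gz11 Gz22 Gdw.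
have : z12 * z21 != 0.
  by apply: contra_eq_neq detE => E'; rewrite E E' subrr mulr0 eq_sym oner_eq0.
rewrite mulf_eq0 negb_or => /andP[z120 z210]; right.
apply: cl_eq_of_diagonal z210 z120 dw0 Gz21 Gz12 _.
by rewrite addrACA [- d - c]addrC -addrACA.
Qed.

Lemma split_bundle_vector_bundle a b : vector_bundle 2 (split_bundle a b).
Proof. by apply: osum_vector_bundle; exact: LD_line_bundle. Qed.

Lemma bun_class_oiso E E' : oiso E E' -> bun_class E = bun_class E'.
Proof.
move=> iE; apply/funext => M; apply/propext.
by split=> -[vM [L [lL tM]]]; split=> //; exists L; split=> //;
  apply: otensor_oiso tM _ (oiso_refl L) (oiso_refl M) => //; exact: oiso_sym.
Qed.

Lemma bun_class_splitP a b E :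
  bun_class (split_bundle a b) E <->
    exists A, oiso E (split_bundle (a + A) (b + A)).
Proof.
split=> [[_ [L [lL tE]]]|[A iE]].
  have [A iL] := line_bundle_oiso_LD hdim hsmooth lL; exists A.
  apply: otensor_unique tE _;
    apply: otensor_oiso (split_bundle_otensor hdim hsmooth a b A) _ _ _;
    [exact: oiso_refl | exact: oiso_sym | exact: oiso_refl].
split; first exact: vector_bundle_oiso (oiso_sym iE)
  (split_bundle_vector_bundle _ _).
exists (LD A); split; first exact: LD_line_bundle.
exact: otensor_oiso (split_bundle_otensor hdim hsmooth a b A)
  (oiso_refl _) (oiso_refl _) (oiso_sym iE).
Qed.

Lemma bun_class_split_eq a b c d :
  bun_class (split_bundle a b) = bun_class (split_bundle c d) <->
  cl (a - b) = cl (c - d) \/ cl (a - b) = - cl (c - d).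
Proof.
have sub a1 b1 c1 d1 E : cl (a1 - b1) = cl (c1 - d1) ->
    bun_class (split_bundle a1 b1) E -> bun_class (split_bundle c1 d1) E.
  move=> clE /bun_class_splitP[A iE]; apply/bun_class_splitP;
    exists (b1 - d1 + A).
  apply: oiso_trans iE (oiso_osum _ _); apply: (oiso_LD hdim).
    move: clE; rewrite !clD !clN => /(canRL (subrK _)) ->.
    by rewrite !addrA [cl c1 - _ + _]addrAC.
  by rewrite addrA [d1 + _]addrC subrK.
have ext a1 b1 c1 d1 : cl (a1 - b1) = cl (c1 - d1) ->
    bun_class (split_bundle a1 b1) = bun_class (split_bundle c1 d1).
  by move=> clE; apply/funext => E; apply/propext; split; exact: sub.
split=> [E|[|clE]]; last 2 first.
- exact: ext.
- rewrite [RHS](bun_class_oiso (oiso_osumC _ _)); apply: ext.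
  by rewrite clE -clN opprB.
have : bun_class (split_bundle a b) (split_bundle a b).
  by apply/bun_class_splitP; exists 0; rewrite !addr0; exact: oiso_refl.
rewrite E => /bun_class_splitP[A /oiso_split_bundle[[E1 E2]|[E1 E2]]];
  [left | right].
  by rewrite clB E1 E2 -clB opprD addrACA subrr addr0.
by rewrite -clN opprB clB E1 E2 -clB opprD addrACA subrr addr0.
Qed.

Lemma c_class_split D : c_class D = bun_class (split_bundle D 0).
Proof.
apply/bun_class_oiso/oiso_osum; first exact: oiso_refl.
exact: oiso_structure_sheaf.
Qed.

Lemma c_class_eq D D' :
  c_class D = c_class D' <-> cl D = cl D' \/ cl D = cl (- D').
Proof. by rewrite !c_class_split bun_class_split_eq !subr0 clN. Qed.

Lemma decomposable_class E : decomposable E ->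
  exists D, bun_class E = c_class D.
Proof.
move=> [L [M [lL lM iE]]].
have [a iL] := line_bundle_oiso_LD hdim hsmooth lL.
have [b iM] := line_bundle_oiso_LD hdim hsmooth lM.
exists (a - b); rewrite c_class_split (bun_class_oiso iE).
rewrite (bun_class_oiso (oiso_osum iL iM)); apply/bun_class_split_eq.
by left; rewrite subr0.
Qed.

Lemma exists_c_class_point : exists c : divisor X -> PBun2dec X,
  forall D, sval (sval (c D)) = c_class D.
Proof.
have bundle D : vector_bundle 2 (osum (LD D) (structure_sheaf X)).
  by apply: osum_vector_bundle;
    [exact: LD_line_bundle | exact: structure_sheaf_line_bundle].
have class D : exists E, vector_bundle 2 E /\ c_class D = bun_class E.
  by exists (osum (LD D) (structure_sheaf X)).
have dec D :
    exists E, [/\ vector_bundle 2 E, decomposable E & c_class D = bun_class E].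
  exists (osum (LD D) (structure_sheaf X)); split=> //.
  exists (LD D), (structure_sheaf X); split; last exact: oiso_refl.
    exact: LD_line_bundle.
  exact: structure_sheaf_line_bundle.
pose point D : PBun2 X := exist _ (c_class D) (class D).
by exists (fun D => exist _ (point D) (dec D)).
Qed.

Lemma PBun2dec_ext (y y' : PBun2dec X) :
  sval (sval y) = sval (sval y') -> y = y'.
Proof.
by case: y y' => -[y ?] ? [[y' ?] ?] /= E; do 2!apply: eq_exist => /=.
Qed.

End Classification.

Theorem proposition6p3 (k : finFieldType) (X : proj_variety k)
    (hdim : var_dim X 1) (hsmooth : smooth_var X 1)
    (hirr : geom_irreducible X) :
  exists c : Cl X -> PBun2dec X,
    [/\ forall D : divisor X, sval (sval (c (cl D))) = c_class D,
        forall y : PBun2dec X, exists x : Cl X, c x = y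
      & forall (D : divisor X) (x : Cl X),
          c x = c (cl D) <-> x = cl D \/ x = cl (- D)].
Proof.
have [c0 c0E] := exists_c_class_point hdim hsmooth.
have clK (x : Cl X) : cl (repr x) = x by exact: reprK.
pose c (x : Cl X) := c0 (repr x).
have cE D : sval (sval (c (cl D))) = c_class D.
  by rewrite c0E; apply/(c_class_eq hdim hsmooth); left; exact: clK.
exists c; split=> // [y|D x].
- have [E [_ decE yE]] := svalP y.
  have [D ED] := decomposable_class hdim hsmooth decE.
  by exists (cl D); apply: PBun2dec_ext; rewrite cE yE ED.
- rewrite -[x in X in _ <-> X]clK -(c_class_eq hdim hsmooth) -!cE clK.
  by split=> [->|/PBun2dec_ext].
Qed.
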